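(* Let $A\subset P^+$ be measurable and consist only of compactly supported measures. Let $\mathrm{LISPP}(A)\subset\mathfrak{L}$ be the set of distributions of Lévy processes $(X_t)_{t\ge0}$ such that for some $\mu\in A$, $$\mathbb{E}[e^{iuX_1}]=\exp\Big\{\int_{\mathbb{R}}(e^{iux}-1)\,d\mu(x)\Big\}\quad\text{for all }u\in\mathbb{R}.$$ Then the following are equivalent: (i) $A$ is good in the discrete-time sense; (ii) $\mathrm{LISPP}(A)$ is good in the continuous-time sense; (iii) $\mathrm{LISPP}(A)$, viewed as a subset of $P(\mathbb{R})$ by identifying the law of a Lévy process $(X_t)_{t\ge0}$ with the (infinitely divisible) law of $X_1$, is good in the discrete-time sense.
   Context: $P(\mathbb{R})$ denotes the set of Borel probability measures on $\mathbb{R}$, with the $\sigma$-algebra generated by the maps $\mu\mapsto\mu(B)$, $B\subset\mathbb{R}$ Borel; $P(P(\mathbb{R}))$ is the set of probability measures on $P(\mathbb{R})$; $P^+\subset P(\mathbb{R})$ is the set of those $\mu$ supported in $[0,\infty)$. Discrete-time sense of good: For $\Theta\in P(P(\mathbb{R}))$, a sequence $X=(X_j)_{j\in\mathbb{N}}$ of real random variables is iid-$\Theta$ if $\mathbb{P}(X\in B)=\int\theta^{\mathbb{N}}(B)\,d\Theta(\theta)$ for all Borel $B\subset\mathbb{R}^{\mathbb{N}}$. A measurable set $L\subset P(\mathbb{R})$ is good if whenever $\Theta_1,\Theta_2\in P(P(\mathbb{R}))$ are concentrated on $L$, $X$ is iid-$\Theta_1$, $Y$ is iid-$\Theta_2$,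 and $\sum_{j=1}^n X_j$ and $\sum_{j=1}^n Y_j$ have the same distribution for every $n\ge 1$, then $\Theta_1=\Theta_2$. Continuous-time sense of good: A Lévy process is a real-valued process $(Z_t)_{t\ge0}$ with stationary independent increments, continuous in probability, with $Z_0=0$. $\mathfrak{L}$ is the set of distributions (laws on $\mathbb{R}^{[0,\infty)}$ with the product $\sigma$-algebra) of Lévy processes, equipped with the smallest $\sigma$-algebra making the passage from a law to each of its one-time marginals (in $P(\mathbb{R})$) measurable. A mixture of Lévy processes with mixing measure $\Theta$, a probability measure on $\mathfrak{L}$, is a process $S=(S_t)_{t\ge 0}$ such that $\mathbb{P}(S\in B)=\int_{\mathfrak{L}}\gamma(B)\,d\Theta(\gamma)$ for every product measurable $B\subset\mathbb{R}^{[0,\infty)}$. A measurable subset $L\subset\mathfrak{L}$ is good if whenever $S,T$ are mixtures of Lévy processes whose mixing measures $\Theta_1,\Theta_2$ are concentrated on $L$, and $S_t$ and $T_t$ have the same distribution for every $t\ge0$, then $S$ and $T$ have the same (joint) distribution. *)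

(* Defs.v *)
From HB Require Import structures.
From mathcomp Require Import all_boot all_order all_algebra.
From mathcomp Require Import complex.
From mathcomp Require Import all_classical all_reals all_analysis.
From mathcomp Require Import giry.

Set Implicit Arguments.
Unset Strict Implicit.
Unset Printing Implicit Defensive.
Import Order.TTheory GRing.Theory Num.Theory.
Import numFieldNormedType.Exports.

Local Open Scope classical_set_scope.
Local Open Scope ring_scope.

(* R^I with the sigma-algebra generated by the coordinate maps; for I = nat it
   is also the Borel sigma-algebra of R^nat. *)
Definition coord_sets (I : Type) (R : realType) : set (set (I -> R)) :=
  [set [set x | B (x i)] | i in [set: I] & B in @measurable _ R].

Definition prod_space (I : Type) (R : realType) :
    measurableType (@coord_sets I R).-sigma :=
  g_sigma_algebraType (@coord_sets I R).

Definition path_space (R : realType) := prod_space {nonneg R} R.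

Definition coord (I : Type) (R : realType) (i : I) : prod_space I R -> R :=
  fun x => x i.

Lemma measurable_coord (I : Type) (R : realType) (i : I) :
  measurable_fun setT (@coord I R i).
Proof.
move=> _ B mB; rewrite setTI; apply: sub_sigma_algebra.
by exists i => //; exists B.
Qed.

HB.instance Definition _ (I : Type) (R : realType) (i : I) :=
  isMeasurableFun.Build _ _ _ _ (@coord I R i) (@measurable_coord I R i).

(* A [probability] also assigns (meaningless) values to non-measurable sets, so
   equality of measures and of laws is always tested on measurable sets only,
   with [measure_eq] (written ≡μ) for measures. *)
Definition same_law (R : realType) (d1 d2 d : measure_display)
    (O1 : measurableType d1) (P1 : probability O1 R)
    (O2 : measurableType d2) (P2 : probability O2 R)
    (T : measurableType d) (X : O1 -> T) (Y : O2 -> T) : Prop :=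
  forall B : set T, measurable B -> P1 (X @^-1` B) = P2 (Y @^-1` B).

Definition trajectory (R : realType) (I : Type) (d : measure_display)
    (O : measurableType d) (X : I -> {mfun O >-> R}) : O -> prod_space I R :=
  fun w i => X i w.

Definition is_iid_power (R : realType) (theta : probability R R)
    (Q : probability (prod_space nat R) R) : Prop :=
  forall (n : nat) (B : nat -> set R), (forall j, measurable (B j)) ->
    Q [set x | forall j, (j < n)%N -> B j (x j)] =
    (\prod_(j < n) theta (B j))%E.

(* The product measure theta^nat: the probability on R^nat, which exists and is
   unique on measurable sets, satisfying the product rule. *)
Definition iid_power (R : realType) (theta : probability R R) :
    probability (prod_space nat R) R :=
  xget point [set Q | is_iid_power theta Q].

Definition iid_mixture (R : realType) (Th : probability (pprobability R R) R)
    (d : measure_display) (O : measurableType d) (P : probability O R)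
    (X : nat -> {RV P >-> R}) : Prop :=
  forall B : set (prod_space nat R), measurable B ->
    P (trajectory X @^-1` B) = (\int[Th]_theta iid_power theta B)%E.
Arguments iid_mixture {R} Th {d O} P X.

(* Goodness is a property of measurable sets, hence the first conjunct; the
   sequence is indexed from 0, so [X j] is the (j+1)-st variable. *)
Definition good_discrete (R : realType) (L : set (pprobability R R)) : Prop :=
  measurable L /\
  forall (Th1 Th2 : probability (pprobability R R) R)
    (d1 d2 : measure_display)
    (O1 : measurableType d1) (P1 : probability O1 R)
    (O2 : measurableType d2) (P2 : probability O2 R)
    (X : nat -> {RV P1 >-> R}) (Y : nat -> {RV P2 >-> R}),
    Th1 L = 1%E -> Th2 L = 1%E ->
    iid_mixture Th1 P1 X -> iid_mixture Th2 P2 Y ->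
    (forall n : nat, (1 <= n)%N ->
      same_law P1 P2 (fun w => \sum_(j < n) X j w)
                     (fun w => \sum_(j < n) Y j w)) ->
    Th1 ≡μ Th2.

Definition levy_process (R : realType) (d : measure_display)
    (O : measurableType d) (P : probability O R)
    (Z : {nonneg R} -> {RV P >-> R}) : Prop :=
  [/\ {ae P, forall w, Z 0%:nng w = 0},
      forall s t : {nonneg R},
        same_law P P (fun w => Z (s%:num + t%:num)%:nng w - Z s w)
                     (fun w => Z t w - Z 0%:nng w),
      forall (n : nat) (t : nat -> {nonneg R}) (B : nat -> set R),
        (forall i j, (i <= j)%N -> (t i)%:num <= (t j)%:num) ->
        (forall j, measurable (B j)) ->
        P [set w | forall j, (j < n)%N -> B j (Z (t j.+1) w - Z (t j) w)] =
        (\prod_(j < n) P [set w | B j (Z (t j.+1) w - Z (t j) w)%R])%E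
    & forall (t : {nonneg R}) (e : R), 0 < e ->
        forall eta : R, 0 < eta -> exists2 delta : R, 0 < delta &
          forall s : {nonneg R}, `|s%:num - t%:num| < delta ->
            (P [set w | (e < `|Z s w - Z t w|)%R] < eta%:E)%E].
Arguments levy_process {R d O} P Z.

Definition has_law (R : realType) (I : Type) (d : measure_display)
    (O : measurableType d) (P : probability O R) (X : I -> {RV P >-> R})
    (gamma : probability (prod_space I R) R) : Prop :=
  forall B : set (prod_space I R), measurable B ->
    P (trajectory X @^-1` B) = gamma B.
Arguments has_law {R I d O} P X gamma.

Record levy_law (R : realType) : Type := LevyLaw {
  levy_prob :> probability (path_space R) R;
  levy_probP : exists (d : measure_display) (O : measurableType d)
    (P : probability O R) (Z : {nonneg R} -> {RV P >-> R}),
    levy_process P Z /\ has_law P Z levy_prob }.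

Lemma zero_levy (R : realType) :
  exists (d : measure_display) (O : measurableType d)
    (P : probability O R) (Z : {nonneg R} -> {RV P >-> R}),
    levy_process P Z /\
    has_law P Z (dirac ((fun=> 0) : path_space R) : probability (path_space R) R).
Proof.
pose P : probability (path_space R) R := dirac ((fun=> 0) : path_space R).
exists _, (path_space R), P, (fun=> cst 0); split; last by move=> B mB.
split.
- by apply: aeW => w.
- by move=> s t B mB /=; congr (P _); apply/seteqP; split => w /=; rewrite subrr.
- move=> n t B _ mB /=.
  have PE (Q : Prop) : P [set w : path_space R | Q] = (`[< Q >]%:R : R)%:E.
    rewrite /P /= diracE; congr (_%:R%:E); rewrite /in_mem /=; congr asbool.
  under eq_bigr do rewrite PE.
  rewrite PE; case: asboolP => [Bn|nB].
    by rewrite big1// => j _; rewrite asboolT//; exact: Bn.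
  have [j nBj] : exists j : 'I_n, ~ B j (0 - 0).
    apply: contrapT => h; apply: nB => j jn; apply: contrapT => nBj.
    by apply: h; exists (Ordinal jn).
  by rewrite (bigD1 j)//= asboolF// mul0e.
- move=> t e e0 eta eta0; exists 1 => // s _ /=.
  rewrite [X in P X](_ : _ = set0) ?measure0 ?lte_fin//.
  by apply/seteqP; split => w //=; rewrite subrr normr0 ltNge (ltW e0).
Qed.

HB.instance Definition _ (R : realType) := gen_eqMixin (levy_law R).
HB.instance Definition _ (R : realType) := gen_choiceMixin (levy_law R).
HB.instance Definition _ (R : realType) :=
  isPointed.Build (levy_law R) (LevyLaw (zero_levy R)).

Definition marginal (R : realType) (t : {nonneg R}) (gamma : levy_law R) :
    pprobability R R :=
  distribution gamma (@coord {nonneg R} R t).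

Definition marginal_sets (R : realType) : set (set (levy_law R)) :=
  \bigcup_(t in [set: {nonneg R}])
    preimage_set_system setT (@marginal R t) measurable.

Definition levy_laws (R : realType) :
    measurableType (@marginal_sets R).-sigma :=
  g_sigma_algebraType (@marginal_sets R).

Definition levy_mixture (R : realType) (Th : probability (levy_laws R) R)
    (d : measure_display) (O : measurableType d) (P : probability O R)
    (S : {nonneg R} -> {RV P >-> R}) : Prop :=
  forall B : set (path_space R), measurable B ->
    P (trajectory S @^-1` B) =
    (\int[Th]_gamma levy_prob gamma B)%E.
Arguments levy_mixture {R} Th {d O} P S.

Definition good_continuous (R : realType) (L : set (levy_laws R)) : Prop :=
  measurable L /\
  forall (Th1 Th2 : probability (levy_laws R) R)
    (d1 d2 : measure_display)
    (O1 : measurableType d1) (P1 : probability O1 R)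
    (O2 : measurableType d2) (P2 : probability O2 R)
    (S : {nonneg R} -> {RV P1 >-> R}) (T : {nonneg R} -> {RV P2 >-> R}),
    Th1 L = 1%E -> Th2 L = 1%E ->
    levy_mixture Th1 P1 S -> levy_mixture Th2 P2 T ->
    (forall t : {nonneg R}, same_law P1 P2 (S t) (T t)) ->
    same_law P1 P2 (trajectory S) (trajectory T).

Local Open Scope complex_scope.

Definition cexp (R : realType) (z : R[i]) : R[i] :=
  (expR (complex.Re z) * cos (complex.Im z))
    +i* (expR (complex.Re z) * sin (complex.Im z)).

Definition cintegral (R : realType) (d : measure_display)
    (O : measurableType d) (mu : {measure set O -> \bar R}) (f : O -> R[i]) :
    R[i] :=
  (\int[mu]_x complex.Re (f x)) +i* (\int[mu]_x complex.Im (f x)).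

Definition LISPP (R : realType) (A : set (pprobability R R)) :
    set (levy_laws R) :=
  [set gamma : levy_law R |
    exists (d : measure_display) (O : measurableType d) (P : probability O R)
      (X : {nonneg R} -> {RV P >-> R}),
      [/\ levy_process P X, has_law P X gamma &
        exists2 mu : pprobability R R, A mu &
          forall u : R,
            cintegral P (fun w => cexp (0 +i* (u * X 1%:nng w))) =
            cexp (cintegral mu (fun x : R => cexp (0 +i* (u * x)) - 1))]].

Definition time_one_laws (R : realType) (L : set (levy_laws R)) :
    set (pprobability R R) :=
  [set nu : pprobability R R |
    exists2 gamma : levy_law R, L gamma & nu ≡μ marginal 1%:nng gamma].

Definition nonneg_supported (R : realType) (mu : probability R R) : Prop :=
  mu (~` `[0, +oo[) = 0%E.

Definition compactly_supported (R : realType) (mu : probability R R) : Prop :=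
  exists2 K : set R, compact K & mu (~` K) = 0%E.

(* Main.v *)
(* Write L_mu for the Laplace transform of mu, restricted to the integers. The three
   properties all say that a mixing measure Th on A is determined by the moments
   int L_mu(k)^n dTh(mu), which is [laplace_identifiable A].

   In discrete time this is immediate: int L_mu(k)^n dTh(mu) is the Laplace transform
   of the sum of n variables. The compound Poisson process with jump law mu has
   one-time Laplace transforms exp(t (L_mu - 1)), and a law on [0, 1] is determined by
   its moments; hence the one-time marginals of a mixture determine the moments of
   exp(L_mu(k) - 1), thus those of L_mu(k), and conversely.

   Mixing measures are transported along mu |-> law of X_1, which has a measurable
   left inverse defined for all laws: 1 + ln L_nu(k) gives the moments of exp(- x)
   under mu, explicit polynomials turn these into the tails of mu, and mu is the image
   of the uniform law under the quantile function. Lastly, the joint law of a mixture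
   determines the mixing measure because the increments over the unit grid are a
   mixture of i.i.d. sequences (uniqueness in de Finetti's theorem). *)
Require Import Defs.
From HB Require Import structures.
From mathcomp Require Import all_boot all_order all_algebra.
From mathcomp Require Import archimedean complex.
From mathcomp Require Import all_classical all_reals all_analysis.
From mathcomp Require Import measurable_realfun giry.
From mathcomp Require Import ring lra.
Set Implicit Arguments.
Unset Strict Implicit.
Unset Printing Implicit Defensive.
Import Order.TTheory GRing.Theory Num.Theory.
Import numFieldNormedType.Exports.
Local Open Scope classical_set_scope.
Local Open Scope ring_scope.

(** * Laws and mixtures *)

(** Everything is reduced to random variables in [0, 1], whose laws are determined by their moments:
    exp(- x) under a law on the half-line, L_mu(k) under a mixing measure, the values of a random
    law on given sets. This is why integer arguments of the Laplace transform suffice.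

    Two features of the setting shape the proof. Laws that agree on measurable sets may differ as
    records, so identities between laws hold up to [≡μ]; they enter membership statements because a
    measurable set of laws cannot separate such records. And the sigma-algebra on [levy_laws] is
    generated by one-time marginals only: instead of evaluating a random Lévy law on a path event,
    the proof replaces it, on the set [LISPP A] of full measure, by the compound Poisson law rebuilt
    from its time-one marginal, which is a measurable kernel.

    Goodness includes measurability, and an image of a measurable set need not be measurable. Thanks
    to the left inverse, the image of A consists of the laws on the half-line whose recovered jump
    law lies in A and reproduces them, which are countably many measurable conditions. *)

Lemma preimage_measurable d d' (T : measurableType d) (S : measurableType d')
    (f : T -> S) (B : set S) :
  measurable_fun setT f -> measurable B -> measurable (f @^-1` B).
Proof. by move=> mf mB; rewrite -[X in measurable X]setTI; exact: mf. Qed.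

Lemma measurable_forall_lt d (T : measurableType d) n (A : nat -> set T) :
  (forall j, measurable (A j)) -> measurable [set x | forall j, (j < n)%N -> A j x].
Proof.
move=> mA; rewrite (_ : [set _ | _] = \bigcap_j (if (j < n)%N then A j else setT)).
  by apply: bigcapT_measurable => j; case: ifP.
apply/seteqP; split => [x H j _|x H j jn]; first by case: ifPn => //; exact: H.
by have := H j I; rewrite jn.
Qed.

Lemma probability_eq_setI d (T : measurableType d) (R : realType) (P : probability T R)
    (S A B : set T) : measurable S -> measurable A -> measurable B -> P (~` S) = 0%E ->
  A `&` S = B `&` S -> P A = P B.
Proof.
move=> mS mA mB PS AB.
have H C : measurable C -> P C = P (C `&` S).
  move=> mC; rewrite -{1}(setIT C) -(setUv S) setIUr measureU//.
  - rewrite [X in (_ + X)%E](_ : _ = 0%E) ?adde0//.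
    apply: (@subset_measure0 _ _ _ P _ (~` S)) => //.
      by apply: measurableI => //; exact: measurableC.
    exact: measurableC.
  - exact: measurableI.
  - by apply: measurableI => //; exact: measurableC.
  - by rewrite setIACA setICr setI0.
by rewrite H// [RHS]H// AB.
Qed.

Section kernels.
Context d d' (E : measurableType d) (T : measurableType d') (R : realType).
Implicit Types K : E -> pprobability T R.

Lemma measurable_pprobability_ev (B : set T) : measurable B ->
  measurable_fun [set: pprobability T R] (fun mu : probability T R => mu B).
Proof.
move=> mB; exact: (measurable_kernel (kprobability (@measurable_id _ (pprobability T R) setT))).
Qed.

Lemma measurable_pprobability K :
  (forall B, measurable B -> measurable_fun setT (fun e => (K e : probability T R) B)) ->
  measurable_fun setT K.
Proof.
move=> mK; apply: (@measurability _ _ _ (pprobability T R) setT K (@pset _ T R)) => // _ [_ [r _ [B mB <-]] <-].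
rewrite setTI [X in measurable X](_ : _ = [set e | ((K e : probability T R) B < r%:E)%E]) //.
have -> : [set e | ((K e : probability T R) B < r%:E)%E] =
   setT `&` (fun e => (K e : probability T R) B) @^-1` `]-oo, r%:E[%classic.
  by rewrite setTI; apply/seteqP; split => e /=; rewrite in_itv.
by apply: (mK _ mB measurableT); exact: emeasurable_itv.
Qed.

Lemma measurable_kernel_ev K (B : set T) : measurable_fun setT K -> measurable B ->
  measurable_fun setT (fun e => (K e : probability T R) B).
Proof.
by move=> mK mB; apply: (measurableT_comp (measurable_pprobability_ev mB)).
Qed.

(** The sets on which the evaluation of K is measurable form a Dynkin system; on product spaces this
    leaves only rectangles to check. *)
Lemma measurable_kernel_pi K (G : set (set T)) :
  @measurable _ T = <<s G >> -> setI_closed G ->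
  (forall B, G B -> measurable_fun setT (fun e => (K e : probability T R) B)) ->
  measurable_fun setT K.
Proof.
move=> GE GI KG; apply: measurable_pprobability; rewrite GE.
apply: (dynkin_induction GE GI) => //.
- by apply: (eq_measurable_fun (cst 1%E)) => // e _; rewrite probability_setT.
- move=> S mS KS.
  apply: (eq_measurable_fun (fun e => 1 - (K e : probability T R) S)%E).
    by move=> e _; rewrite probability_setC.
  exact: emeasurable_funB.
- move=> F mF tF KF.
  apply: (eq_measurable_fun (fun e => \sum_(0 <= k <oo) (K e : probability T R) (F k))%E).
    by move=> e _; rewrite measure_semi_bigcup//; exact: bigcup_measurable.
  exact: ge0_emeasurable_sum.
Qed.

End kernels.

Lemma probability_eq_pi d (T : measurableType d) (R : realType)
  (P Q : probability T R) (G : set (set T)) :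
  @measurable _ T = <<s G >> -> setI_closed G ->
  (forall B, G B -> P B = Q B) -> P ≡μ Q.
Proof.
move=> GE GI PQ S; rewrite GE; move: S.
apply: (@dynkin_induction _ _ G (fun S => P S = Q S) GE GI) => //.
- by rewrite !probability_setT.
- by move=> S mS PQS; rewrite !probability_setC// PQS.
- move=> F mF tF PQF; rewrite !measure_semi_bigcup//;
    try exact: bigcup_measurable.
  by apply: eq_eseriesr => n _; exact: PQF.
Qed.

Section law.
Context d d' (O : measurableType d) (T : measurableType d') (R : realType).

Definition law (P : probability O R) (f : O -> T) (mf : measurable_fun setT f) :
  probability T R := distribution P (mfun_Sub (mem_set mf)).

Lemma lawE P f mf (B : set T) : @law P f mf B = P (f @^-1` B).
Proof. by []. Qed.

Lemma integral_law P f mf (g : T -> \bar R) : measurable_fun setT g ->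
  (forall x, 0 <= g x)%E -> (\int[@law P f mf]_x g x = \int[P]_x g (f x))%E.
Proof. by move=> mg g0; rewrite ge0_integral_distribution. Qed.

Lemma measurable_law f (mf : measurable_fun setT f) :
  measurable_fun setT
    (fun P : pprobability O R => law P mf : pprobability T R).
Proof.
apply: measurable_pprobability => B mB.
apply: measurable_pprobability_ev; exact: preimage_measurable.
Qed.

End law.

Section mixture.
Context d d' (E : measurableType d) (T : measurableType d') (R : realType).
Variables (Th : probability E R) (K : E -> pprobability T R).
Hypothesis mK : measurable_fun setT K.

Definition mixture (B : set T) : \bar R := (\int[Th]_e (K e : probability T R) B)%E.

Let mixture0 : mixture set0 = 0%E.
Proof. by apply: integral0_eq => e _; rewrite measure0. Qed.

Let mixture_ge0 B : (0 <= mixture B)%E.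
Proof. exact: integral_ge0. Qed.

Let mixture_sigma_additive : semi_sigma_additive mixture.
Proof.
move=> F mF tF mUF.
rewrite [X in _ --> X](_ : _ = \sum_(0 <= k <oo) mixture (F k))%E.
  exact: is_cvg_nneseries.
rewrite /mixture -integral_nneseries//; last by move=> n; exact: measurable_kernel_ev.
by apply: eq_integral => e _; rewrite measure_semi_bigcup.
Qed.

HB.instance Definition _ :=
  isMeasure.Build _ _ _ mixture mixture0 mixture_ge0 mixture_sigma_additive.

Let mixture_setT : mixture setT = 1%E.
Proof.
transitivity (\int[Th]_e (cst 1%E e))%E.
  by apply: eq_integral => e _; exact: probability_setT.
by rewrite integral_cst// mul1e; exact: probability_setT.
Qed.

HB.instance Definition _ := Measure_isProbability.Build _ _ _ mixture mixture_setT.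

Definition mixture_prob : probability T R := mixture.

Let giry_K : E -> giry T R := fun e => (K e : probability T R).

Let mgiry_K : measurable_fun setT giry_K.
Proof. by apply: measurable_giry_codensity => // B; exact: measurable_kernel_ev. Qed.

(** The mixture is the Giry bind of [Th] and [K], for which the iterated integral formula holds. *)
Lemma integral_mixture (f : T -> \bar R) : measurable_fun setT f ->
  (forall x, 0 <= f x)%E ->
  (\int[mixture_prob]_x f x = \int[Th]_e \int[(K e : probability T R)]_x f x)%E.
Proof.
move=> mf f0; transitivity (giry_int (giry_bind (Th : giry E R) mgiry_K) f); last first.
  exact: giry_int_bind.
apply: eq_measure_integral => B mB _.
by rewrite /giry_bind/= giry_int_map//; exact: measurable_giry_ev.
Qed.

End mixture.

(** * Product spaces and infinite products of probability measures *)

Section product_space.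
Context (I : Type) d (T : measurableType d).

(** Same generators as [coord_sets], but with values in any measurable space: the compound Poisson
    process is built on sequences of blocks. For T = R the two families coincide, so sets pass to
    [prod_space] by the identity. *)
Definition gcoord : set (set (I -> T)) :=
  [set [set x | B (x i)] | i in [set: I] & B in @measurable _ T].

Definition gprod : measurableType gcoord.-sigma := g_sigma_algebraType gcoord.

Lemma measurable_gcoord i : measurable_fun setT (fun x : gprod => x i).
Proof.
move=> _ B mB; rewrite setTI; apply: sub_sigma_algebra; exists i => //; exists B => //.
Qed.

Lemma measurable_gprod d' (E : measurableType d') (f : E -> gprod) :
  (forall i, measurable_fun setT (fun e => f e i)) -> measurable_fun setT f.
Proof.
move=> mf; apply: (@measurability _ _ E gprod setT f gcoord) => //.
move=> _ [_ [i _ [B mB <-]] <-].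
exact: (mf i measurableT B mB).
Qed.

(** The index map [t] need not be injective, so that the intersection of two rectangles is given by
    concatenation. *)
Definition rects : set (set (I -> T)) :=
  [set A | exists n (t : nat -> I) (B : nat -> set T),
    (forall j, measurable (B j)) /\
    A = [set x | forall j, (j < n)%N -> B j (x (t j))]].

Lemma rects_setI : setI_closed rects.
Proof.
move=> _ _ [n [t [B [mB ->]]]] [m [s [C [mC ->]]]].
exists (n + m)%N, (fun j => if (j < n)%N then t j else s (j - n)%N),
  (fun j => if (j < n)%N then B j else C (j - n)%N); split.
  by move=> j; case: ifP.
apply/seteqP; split => [x [xB xC] j jnm|x xBC].
  case: ifPn => [/xB//|]; rewrite -leqNgt => nj.
  by apply: xC; rewrite ltn_subLR.
split=> j jn; first by have := xBC j; rewrite jn; apply; rewrite ltn_addr.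
have nj : (n + j < n)%N = false by rewrite ltnNge leq_addr.
by have := xBC (n + j)%N; rewrite nj addKn; apply; rewrite ltn_add2l.
Qed.

Lemma rects_measurable : rects `<=` (@measurable _ gprod).
Proof.
move=> _ [n [t [B [mB ->]]]].
apply: measurable_forall_lt => j.
exact: (preimage_measurable (measurable_gcoord (t j))).
Qed.

Lemma measurable_rects : @measurable _ gprod = <<s rects >>.
Proof.
apply/seteqP; split.
  apply: smallest_sub; first exact: smallest_sigma_algebra.
  move=> _ [i _ [B mB <-]]; apply: sub_sigma_algebra.
  exists 1%N, (fun=> i), (fun=> B); split => //.
  by apply/seteqP; split => [x Bx j _//|x /(_ 0%N erefl)].
apply: smallest_sub; first exact: sigma_algebra_measurable.
exact: rects_measurable.
Qed.

End product_space.
Arguments gcoord : clear implicits.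
Arguments gcoord I {d} T.
Arguments gprod : clear implicits.
Arguments gprod I {d} T.
Arguments rects : clear implicits.
Arguments rects I {d} T.

Section sequence_space.
Context d (T : measurableType d).
Local Notation Om := (gprod nat T).

(** These are the sets in the product rule of [is_iid_power]. They form a generating pi-system by
    themselves, so the rule determines the law on measurable sets. *)
Definition irects : set (set (nat -> T)) :=
  [set A | exists n (B : nat -> set T), (forall j, measurable (B j)) /\
    A = [set x | forall j, (j < n)%N -> B j (x j)]].

Lemma irects_rects : irects `<=` rects nat T.
Proof. by move=> _ [n [B [mB ->]]]; exists n, id, B. Qed.

Lemma irects_setI : setI_closed irects.
Proof.
move=> _ _ [n [B [mB ->]]] [m [C [mC ->]]].
exists (maxn n m), (fun j => (if (j < n)%N then B j else setT) `&`
    (if (j < m)%N then C j else setT)); split.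
  by move=> j; apply: measurableI; case: ifP.
apply/seteqP; split => [x [xB xC] j _|x xBC].
  by split; case: ifPn => // /[dup]; [move=> _ /xB|move=> _ /xC].
split=> j jn.
  have := xBC j; rewrite leq_max jn => /(_ isT) [+ _]; exact.
have := xBC j; rewrite leq_max jn orbT => /(_ isT) [_ +]; exact.
Qed.

Lemma measurable_irects : @measurable _ Om = <<s irects >>.
Proof.
apply/seteqP; split.
  apply: smallest_sub; first exact: smallest_sigma_algebra.
  move=> _ [i _ [B mB <-]]; apply: sub_sigma_algebra.
  exists i.+1, (fun j => if j == i then B else setT); split.
    by move=> j; case: ifP.
  apply/seteqP; split => [x Bx j _//|x /(_ i (ltnSn i))]; last by rewrite eqxx.
  by case: eqP => [->|].
apply: smallest_sub; first exact: sigma_algebra_measurable.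
by move=> A /irects_rects; exact: rects_measurable.
Qed.

Definition scons (a : T) (x : nat -> T) : nat -> T :=
  fun n => if n is n'.+1 then x n' else a.

Lemma measurable_scons :
  measurable_fun setT ((fun p => scons p.1 p.2) : T * Om -> Om).
Proof.
apply: measurable_gprod => -[|i] /=; first exact: measurable_fst.
by apply: (measurableT_comp (measurable_gcoord i)); exact: measurable_snd.
Qed.

Lemma scons_pair_measurable (A : set Om) (a : T) : measurable A ->
  measurable [set x : Om | A (scons a x)].
Proof.
move=> mA.
have := measurable_scons measurableT mA; rewrite setTI => /(measurable_xsection a).
by rewrite /xsection; congr measurable; apply/seteqP; split => x /=; rewrite inE.
Qed.

Definition determined n (A : set (nat -> T)) :=
  forall x y, (forall i, (i < n)%N -> x i = y i) -> A x -> A y.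

Definition cylinder (A : set (nat -> T)) :=
  (@measurable _ Om) A /\ exists n, determined n A.

Lemma determinedS n m A : (n <= m)%N -> determined n A -> determined m A.
Proof. by move=> nm dA x y xy; apply: dA => i /leq_trans/(_ nm)/xy. Qed.

Lemma determined_section n A a : determined n.+1 A ->
  determined n [set x | A (scons a x)].
Proof. by move=> dA x y xy; apply: dA => -[//|i] /xy. Qed.

Lemma cylinder0 : cylinder set0.
Proof. by split; [exact: measurable0|exists 0%N]. Qed.

Lemma cylinderC : setC_closed cylinder.
Proof.
move=> A [mA [n dA]]; split; first exact: measurableC.
by exists n => x y xy nAx Ay; apply: nAx; apply: (dA y) => // i /xy.
Qed.

Lemma cylinderU : setU_closed cylinder.
Proof.
move=> A B [mA [n dA]] [mB [m dB]]; split; first exact: measurableU.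
exists (maxn n m) => x y xy [Ax|Bx]; [left|right].
  by apply: (dA x) => // i ni; apply: xy; rewrite leq_max ni.
by apply: (dB x) => // i ni; apply: xy; rewrite leq_max ni orbT.
Qed.

Lemma cylinder_section A a : cylinder A -> cylinder [set x | A (scons a x)].
Proof.
move=> [mA [n dA]]; split; first exact: scons_pair_measurable.
by exists n; apply: determined_section; exact: determinedS dA.
Qed.

(** A copy of [nat -> T] that carries only the algebra of cylinders, on which the measure to be
    extended is given. *)
Definition cylinder_type : Type := nat -> T.

HB.instance Definition _ := Pointed.on cylinder_type.

Definition cylinder_display : measure_display.
Proof. by constructor. Qed.

HB.instance Definition _ := @isAlgebraOfSets.Build cylinder_display cylinder_type
  cylinder cylinder0 cylinderU cylinderC.

End sequence_space.

Lemma integral_cst_probability d (T : measurableType d) (R : realType)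
  (P : probability T R) (c : \bar R) : (\int[P]_x c = c)%E.
Proof.
by rewrite integral_cst//= probability_setT mule1.
Qed.

(** * Infinite product measures, by extension from cylinders *)

Section infinite_product.
Context d (T : measurableType d) (R : realType) (P : probability T R).
Local Notation Om := (gprod nat T).
Local Open Scope ereal_scope.

Definition pprod d1 d2 (T1 : measurableType d1) (T2 : measurableType d2)
  (P1 : probability T1 R) (P2 : probability T2 R) : probability (T1 * T2)%type R :=
  P1 \x P2.

(** The first n coordinates are independent with law P and the others are frozen at [point], which
    does not matter for sets determined by the first n. *)
Fixpoint finite_power (n : nat) : probability Om R :=
  if n is n'.+1 then law (pprod P (finite_power n')) (@measurable_scons _ T)
  else dirac (point : Om).

Lemma finite_powerS n (A : set Om) :
  finite_power n.+1 A = \int[P]_a finite_power n [set x | A (scons a x)].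
Proof.
transitivity (\int[P]_a (finite_power n \o
  xsection ((fun p => scons p.1 p.2) @^-1` A)) a) => //.
apply: eq_integral => a _ /=; congr (finite_power n _).
by rewrite /xsection; apply/seteqP; split => x /=; rewrite inE.
Qed.

Lemma finite_power_determined n m (A : set Om) : measurable A ->
  determined n A -> (n <= m)%N -> finite_power m A = finite_power n A.
Proof.
elim: n m A => [m A mA dA _|n IH [//|m] A mA dA nm].
  (* A set determined by no coordinate at all is empty or everything. *)
  have [[x Ax]|A0] := pselect (A !=set0).
    rewrite (_ : A = setT) ?probability_setT//.
    by apply/seteqP; split => // y _; exact: (dA x).
  rewrite (_ : A = set0) ?measure0//.
  by apply/seteqP; split => // y Ay; apply: A0; exists y.
rewrite !finite_powerS; apply: eq_integral => a _.
by apply: IH => //; [exact: scons_pair_measurable|exact: determined_section].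
Qed.

(** The choice of n is immaterial by [finite_power_determined]; the value 0 is a default off the
    cylinders. *)
Definition cylinder_measure (A : set (cylinder_type T)) : \bar R :=
  if pselect (exists n, determined n A) is left H
  then finite_power (projT1 (cid H)) A else 0.

Lemma cylinder_measureE n (A : set Om) : measurable A -> determined n A ->
  cylinder_measure A = finite_power n A.
Proof.
move=> mA dA; rewrite /cylinder_measure; case: pselect => [H|]; last first.
  by move=> []; exists n.
case: cid => m /= dmA.
by rewrite -(finite_power_determined mA dmA (leq_maxr n m))
  (finite_power_determined mA dA (leq_maxl n m)).
Qed.

Let cmu_ge0 A : 0 <= cylinder_measure A.
Proof. by rewrite /cylinder_measure; case: pselect. Qed.

Let cmu0 : cylinder_measure set0 = 0.
Proof. by rewrite (@cylinder_measureE 0)// measure0. Qed.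

Let cmu_additive : measure_function.semi_additive cylinder_measure.
Proof.
apply/(additive2P cmu0) => A B [mA [n dA]] [mB [m dB]] AB.
have dA' := determinedS (leq_maxl n m) dA.
have dB' := determinedS (leq_maxr n m) dB.
rewrite (cylinder_measureE mA dA') (cylinder_measureE mB dB').
rewrite (@cylinder_measureE (maxn n m)) ?measureU//; first exact: measurableU.
by move=> x y xy [/(dA' _ _ xy)|/(dB' _ _ xy)]; [left|right].
Qed.

HB.instance Definition _ := isContent.Build cylinder_display (cylinder_type T) R
  cylinder_measure cmu_ge0 cmu_additive.

Lemma cylinder_measure_section (A : set Om) : cylinder A ->
  measurable_fun setT (fun a => cylinder_measure [set x | A (scons a x)]) /\
  cylinder_measure A = \int[P]_a cylinder_measure [set x | A (scons a x)].
Proof.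
move=> [mA [n dA]]; have dA' := determinedS (leqnSn n) dA.
have E a : cylinder_measure [set x | A (scons a x)] =
    finite_power n [set x | A (scons a x)].
  rewrite (@cylinder_measureE n)//; first exact: scons_pair_measurable.
  exact: determined_section.
split; last first.
  by rewrite (cylinder_measureE mA dA') finite_powerS; exact: eq_integral.
have := measurable_fun_xsection (finite_power n)
  (let: H := @measurable_scons _ T measurableT _ mA in eq_rect _ _ H _ (setTI _)).
apply: eq_measurable_fun => a _; rewrite E/=; congr (finite_power n _).
by rewrite /xsection; apply/seteqP; split => x /=; rewrite inE.
Qed.

Lemma cylinder_measure_le1 (A : set Om) : cylinder A -> cylinder_measure A <= 1.
Proof.
by move=> [mA [n dA]]; rewrite (cylinder_measureE mA dA) probability_le1.
Qed.

Definition non_vanishing (C : nat -> set Om) :=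
  [/\ forall k, cylinder (C k), forall k, C k.+1 `<=` C k &
      exists2 e : R, (0 < e)%R & forall k, e%:E <= cylinder_measure (C k)].

(** By averaging: if every C k has mass at least e, the first coordinates whose section of C k keeps
    mass at least e/2 have P-mass at least e/2. These sets of coordinates decrease with k, so
    continuity from above yields one coordinate good for all k. This takes the place of the
    compactness argument in Kolmogorov's extension theorem. *)
Lemma non_vanishing_section C : non_vanishing C ->
  exists a, non_vanishing (fun k => [set x | C k (scons a x)]).
Proof.
move=> [cC dC [e e0 eC]].
pose f k a := cylinder_measure [set x | C k (scons a x)].
have mf k : measurable_fun setT (f k) by have [] := cylinder_measure_section (cC k).
have f1 k a : f k a <= 1 by apply/cylinder_measure_le1/cylinder_section.
pose D k := [set a | (e / 2)%:E <= f k a].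
have mD k : measurable (D k).
  rewrite (_ : D k = setT `&` f k @^-1` `[(e / 2)%:E, +oo[); last first.
    by rewrite setTI; apply/seteqP; split => a /=; rewrite in_itv/= andbT.
  by apply: mf => //; exact: emeasurable_itv.
have PD k : (e / 2)%:E <= P (D k).
  have : e%:E <= P (D k) + (e / 2)%:E.
    apply: (le_trans (eC k)); rewrite (cylinder_measure_section (cC k)).2.
    rewrite -/(f k) -[P (D k)]mul1e -[X in P X]setIT -integral_indic//.
    rewrite -[X in _ + X](integral_cst_probability P).
    rewrite mul1e -ge0_integralD//; last 2 first.
    - by apply/measurable_EFinP; exact: measurable_indic.
    - by move=> ? _; rewrite lee_fin divr_ge0// ltW.
    apply: ge0_le_integral => //.
    - exact: mf.
    - apply: emeasurable_funD => //.
      by apply/measurable_EFinP; exact: measurable_indic.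
    - move=> a _; rewrite /= indicE; have [aD|] := boolP (a \in D k).
        by rewrite (le_trans (f1 k a))// leeDl// lee_fin divr_ge0// ltW.
      by rewrite notin_setE/= add0e => /negP; rewrite -ltNge => /ltW.
  have : P (D k) \is a fin_num by exact: fin_num_measure.
  by move=> /fineK <-; rewrite -EFinD !lee_fin; lra.
have decD : nonincreasing_seq D.
  apply/nonincreasing_seqP => k; apply/subsetPset => a /= /le_trans; apply.
  have [mk [nk dk]] := cylinder_section a (cC k.+1).
  have [mk' [nk' dk']] := cylinder_section a (cC k).
  rewrite /f (cylinder_measureE mk (determinedS (leq_maxl nk nk') dk)).
  rewrite (cylinder_measureE mk' (determinedS (leq_maxr nk nk') dk')).
  by apply: le_measure; rewrite ?inE//; move=> x /=; exact: dC.
have PI : P (D k) @[k --> \oo] --> P (\bigcap_k D k).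
  apply: nonincreasing_cvg_mu => //; last exact: bigcapT_measurable.
  by rewrite (le_lt_trans (probability_le1 _ _))// ltry.
have [a Da] : \bigcap_k D k !=set0.
  apply/set0P/eqP => D0; move: PI; rewrite D0 measure0 => PI.
  have : (e / 2)%:E <= 0.
    by apply: (cvge_to_ge PI); apply: nearW => k; exact: PD.
  by rewrite lee_fin; lra.
exists a; split.
- by move=> k; exact: cylinder_section.
- by move=> k x /=; exact: dC.
- by exists (e / 2)%R; [lra|move=> k; exact: Da].
Qed.

(** Coordinates are chosen one after the other, and after n choices the section of each C k is still
    of positive mass, hence nonempty. As C k depends on finitely many coordinates, it contains the
    whole sequence of choices. *)
Lemma non_vanishing_bigcap C : non_vanishing C -> \bigcap_k C k !=set0.
Proof.
move=> nC.
pose S := {C | non_vanishing C}.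
pose next (s : S) : T * S := let h := cid (non_vanishing_section (proj2_sig s)) in
  (projT1 h, exist non_vanishing _ (projT2 h)).
pose st n : S := iter n (fun s => (next s).2) (exist _ C nC).
pose a n := (next (st n)).1.
have stS n k x : sval (st n.+1) k x = sval (st n) k (scons (a n) x) by [].
have stE n k x : sval (st n) k x ->
    C k (fun i => if (i < n)%N then a i else x (i - n)%N).
  elim: n x => [|n IH] x.
    by rewrite [X in _ -> C k X](_ : _ = x)//; apply/funext => i; rewrite subn0.
  rewrite stS => /IH; rewrite [X in C k X -> _](_ : _ =
    (fun i => if (i < n.+1)%N then a i else x (i - n.+1)%N))//.
  apply/funext => i; case: (ltngtP i n) => [in_|ni|->].
  - by rewrite ltnS ltnW.
  - by rewrite ltnNge -ltnS ltnS ni/= -[(i - n)%N](@prednK) ?subn_gt0// subnS.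
  - by rewrite ltnS leqnn subnn.
exists a => k _.
have [cC _ _] := nC; have [_ [n dn]] := cC k.
have [cS _ [e e0 eS]] := proj2_sig (st n).
have [x Sx] : sval (st n) k !=set0.
  apply/set0P/eqP => S0; have := eS k; rewrite S0 measure0 lee_fin; lra.
by apply: (dn _ _ _ (stE _ _ _ Sx)) => i ->.
Qed.

(** If A had more mass than all F j together, the remainders of A after removing the first k of them
    would keep the difference of masses. They would then have a common point, which no F j
    covers. *)
Let cmu_subadditive : measurable_subset_sigma_subadditive cylinder_measure.
Proof.
move=> A F mF mA AF; rewrite leNgt; apply/negP => FA.
pose C k : set Om := A `\` \big[setU/set0]_(j < k) F j.
have cC k : cylinder (C k).
  have /= := @measurableD _ (cylinder_type T) A (\big[setU/set0]_(j < k) F j) mA.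
  by apply; exact: bigsetU_measurable.
have sF k : \sum_(j < k) cylinder_measure (F j) <=
    \sum_(0 <= i <oo) cylinder_measure (F i).
  by have := @nneseries_lim_ge _ (fun j => cylinder_measure (F j)) xpredT 0 k;
    rewrite big_mkord; apply => *; exact: cmu_ge0.
have A1 := cylinder_measure_le1 mA.
have Ffin : \sum_(0 <= i <oo) cylinder_measure (F i) \is a fin_num.
  rewrite ge0_fin_numE; last by apply: nneseries_ge0 => *; exact: cmu_ge0.
  by rewrite (lt_le_trans FA)// (le_trans A1)// leey.
have Afin : cylinder_measure A \is a fin_num.
  by rewrite ge0_fin_numE ?(le_lt_trans A1) ?ltry//; exact: cmu_ge0.
have : non_vanishing C.
  split => //.
    by move=> k x [Ax nFx]; split => // Fx; apply: nFx; rewrite big_ord_recr; left.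
  exists (fine (cylinder_measure A) - fine (\sum_(0 <= i <oo) cylinder_measure (F i)))%R.
    by move: FA; rewrite -(fineK Ffin) -(fineK Afin) lte_fin subr_gt0.
  move=> k; rewrite EFinB !fineK// leeBlDr//.
  (* Finite subadditivity is applied to a single sequence: the first k sets [F j], followed by the
     remainder. *)
  pose G j : set (cylinder_type T) := if (j < k)%N then F j else C k.
  have UE : \big[setU/set0]_(j < k) G j = \big[setU/set0]_(j < k) F j.
    by apply: eq_bigr => j _; rewrite /G ltn_ord.
  have SE : (\sum_(j < k) cylinder_measure (G j) = \sum_(j < k) cylinder_measure (F j))%E.
    by apply: eq_bigr => j _; rewrite /G ltn_ord.
  have := @content_subadditive _ _ _ cylinder_measure A G k.+1.
  rewrite 2!big_ord_recr/= UE SE.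
  have -> : G k = C k by rewrite /G ltnn.
  move=> H; apply: (le_trans (H _ mA _)).
  - by move=> j _; rewrite /G; case: ifP => // _; exact: cC.
  - move=> x Ax; have [?|?] := pselect ((\big[setU/set0]_(j < k) F j) x); first by left.
    by right.
  - by rewrite addeC leeD2l.
move=> /non_vanishing_bigcap[x Cx].
have Ax : A x by have [] := Cx 0%N I.
have [k _ Fkx] := AF _ Ax.
have [_] := Cx k.+1 I; apply.
by rewrite big_ord_recr; right.
Qed.

HB.instance Definition _ := Content_SigmaSubAdditive_isMeasure.Build
  cylinder_display R (cylinder_type T) cylinder_measure cmu_subadditive.

Let ext := measure_extension (cylinder_measure : {measure set (cylinder_type T) -> \bar R}).

Let ext_measurable : measurable_fun setT
  (id : g_sigma_algebraType (@measurable _ (cylinder_type T)) -> Om).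
Proof.
apply: measurable_gprod => i _ B mB; rewrite setTI.
apply: sub_sigma_algebra; split.
  by rewrite -[X in measurable X]setTI; exact: (measurable_gcoord i).
by exists i.+1 => x y /(_ i (ltnSn i)) /= ->.
Qed.

Let ext_prob : ext setT = 1.
Proof.
rewrite /ext /measure_extension measurable_mu_extE; last exact: (@measurableT _ (cylinder_type T)).
by transitivity (finite_power 0 setT); [exact: cylinder_measureE|exact: probability_setT].
Qed.

HB.instance Definition _ := Measure.on ext.
HB.instance Definition _ := Measure_isProbability.Build _ _ _ ext ext_prob.

Definition power_prob : probability Om R := law ext ext_measurable.

Lemma power_prob_determined n (A : set Om) : measurable A -> determined n A ->
  power_prob A = finite_power n A.
Proof.
move=> mA dA; rewrite lawE /= /ext /measure_extension measurable_mu_extE/=.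
  exact: cylinder_measureE.
by split => //; exists n.
Qed.

End infinite_product.

Section infinite_product_theory.
Context d (T : measurableType d) (R : realType).
Local Notation Om := (gprod nat T).
Local Open Scope ereal_scope.
Implicit Types (P : probability T R).

Lemma integral_pprod d1 d2 (T1 : measurableType d1) (T2 : measurableType d2)
    (P1 : probability T1 R) (P2 : probability T2 R) (f : T1 * T2 -> \bar R) :
  measurable_fun setT f -> (forall x, 0 <= f x) ->
  \int[pprod P1 P2]_x f x = \int[P1]_x \int[P2]_y f (x, y).
Proof. by move=> mf f0; exact: fubini_tonelli1. Qed.

Lemma measurable_pprod d1 d2 (T1 : measurableType d1) (T2 : measurableType d2)
    (P1 : probability T1 R) :
  measurable_fun setT
    (fun P2 : pprobability T2 R => pprod P1 P2 : pprobability (T1 * T2)%type R).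
Proof.
apply: (@measurable_kernel_pi _ _ (pprobability T2 R) (T1 * T2)%type R
  (fun Q : pprobability T2 R => pprod P1 Q) _ (measurable_prod_measurableType T1 T2)).
  move=> _ _ [A1 mA1 [A2 mA2 <-]] [B1 mB1 [B2 mB2 <-]].
  exists (A1 `&` B1); first exact: measurableI.
  by exists (A2 `&` B2); [exact: measurableI|rewrite setXI].
move=> _ [A mA [B mB <-]].
apply: (eq_measurable_fun (fun P2 : pprobability T2 R => P1 A * (P2 : probability T2 R) B)).
  by move=> Q _; apply/esym; exact: product_measure1E.
by apply: emeasurable_funM => //; exact: measurable_pprobability_ev.
Qed.

(** The right-hand side is the law of an independent first coordinate put in front of the sequence;
    two laws are compared, so rectangles suffice. *)
Lemma power_prob_section P (A : set Om) : measurable A ->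
  power_prob P A = \int[P]_a power_prob P [set x | A (scons a x)].
Proof.
pose Q := law (pprod P (power_prob P)) (@measurable_scons _ T).
have QE B : Q B = \int[P]_a power_prob P [set x | B (scons a x)].
  apply: eq_integral => a _; congr (power_prob P _).
  by rewrite /xsection; apply/seteqP; split => x /=; rewrite inE.
move=> mA; rewrite -QE.
apply: (probability_eq_pi (@measurable_irects _ T) (@irects_setI _ T) _ mA).
move=> _ [n [B [mB ->]]]; rewrite QE.
set C := [set x | _].
have mC : measurable (C : set Om).
  by apply: rects_measurable; apply: irects_rects; exists n, B.
have dC : determined n.+1 C.
  by move=> x y xy Bx j jn; rewrite -xy 1?ltnW//; exact: Bx.
rewrite (power_prob_determined P mC dC) finite_powerS.
apply: eq_integral => a _; rewrite (@power_prob_determined _ _ _ _ n)//.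
  exact: scons_pair_measurable.
exact: determined_section.
Qed.

Lemma integral_power_scons P (f : Om -> \bar R) : measurable_fun setT f ->
  (forall x, 0 <= f x) ->
  \int[power_prob P]_x f x = \int[P]_a \int[power_prob P]_x f (scons a x).
Proof.
move=> mf f0.
rewrite -(@integral_pprod _ _ T Om P (power_prob P)
  (fun p : T * Om => f (scons p.1 p.2)))//.
  rewrite -(integral_law _ (@measurable_scons _ T))//.
  apply: eq_measure_integral => B mB _; rewrite [LHS]power_prob_section//.
  apply: eq_integral => a _; congr (power_prob P _).
  by rewrite /xsection; apply/seteqP; split => x /=; rewrite inE.
exact: (measurableT_comp mf (@measurable_scons _ T)).
Qed.

Lemma integral_power_prod P n (g : nat -> T -> \bar R) :
  (forall i, measurable_fun setT (g i)) -> (forall i x, 0 <= g i x) ->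
  \int[power_prob P]_x (\prod_(i < n) g i (x i)) = \prod_(i < n) \int[P]_a g i a.
Proof.
have mprod m (h : nat -> T -> \bar R) : (forall i, measurable_fun setT (h i)) ->
    measurable_fun setT ((fun x => \prod_(i < m) h i (x i)) : Om -> \bar R).
  move=> mh; elim: m => [|m IH].
    by apply: (eq_measurable_fun (cst 1)) => // x _; rewrite big_ord0.
  apply: (eq_measurable_fun (fun x : Om => (\prod_(i < m) h i (x i)) * h m (x m))).
    by move=> x _; rewrite big_ord_recr.
  apply: emeasurable_funM => //.
  by apply: (measurableT_comp (mh m)); exact: measurable_gcoord.
elim: n g => [|n IH] g mg g0.
  transitivity (\int[power_prob P]_x (cst 1 x)).
    by apply: eq_integral => x _; rewrite big_ord0.
  by rewrite big_ord0 integral_cst_probability.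
rewrite integral_power_scons//; last 2 first.
  exact: mprod.
  by move=> x; rewrite prode_ge0.
rewrite big_ord_recl /=.
have g1 i : measurable_fun setT (g i.+1) by [].
transitivity (\int[P]_a (g 0%N a * \prod_(i < n) \int[P]_a g i.+1 a)).
  apply: eq_integral => a _.
  under eq_integral do rewrite big_ord_recl /=.
  rewrite ge0_integralZl//; first by rewrite (IH (fun i => g i.+1)).
    exact: (mprod n (fun i => g i.+1)).
  by move=> x _; rewrite prode_ge0.
rewrite ge0_integralZr//.
by apply: prode_ge0 => i _; exact: integral_ge0.
Qed.

Lemma power_prob_rect P n (B : nat -> set T) : (forall j, measurable (B j)) ->
  power_prob P [set x | forall j, (j < n)%N -> B j (x j)] = \prod_(j < n) P (B j).
Proof.
move=> mB.
have mC : measurable ([set x | forall j, (j < n)%N -> B j (x j)] : set Om).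
  by apply: rects_measurable; apply: irects_rects; exists n, B.
rewrite -[LHS]mul1e -[X in _ * _ X]setIT -integral_indic// mul1e.
transitivity (\int[power_prob P]_x (\prod_(j < n) (\1_(B j) (x j))%:E)).
  apply: eq_integral => x _; rewrite prodEFin; congr EFin; rewrite indicE.
  case: (boolP (x \in _)) => [|].
    by rewrite inE => /= Bx; rewrite big1// => j _; rewrite indicE mem_set//; exact: Bx.
  rewrite notin_setE/= => nB.
  have [j nBj] : exists j : 'I_n, ~ B j (x j).
    apply: contrapT => h; apply: nB => j jn; apply: contrapT => nBj.
    by apply: h; exists (Ordinal jn).
  by rewrite (bigD1 j)//= indicE memNset// mul0r.
rewrite (integral_power_prod _ _ (g := fun j y => (\1_(B j) y)%:E)).
- by apply: eq_bigr => j _; rewrite integral_indic// setIT.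
- by move=> j; apply/measurable_EFinP; exact: measurable_indic.
- by move=> j x; rewrite lee_fin.
Qed.

Lemma power_prob_unique P (Q : probability Om R) :
  (forall n (B : nat -> set T), (forall j, measurable (B j)) ->
    Q [set x | forall j, (j < n)%N -> B j (x j)] = \prod_(j < n) P (B j)) ->
  Q ≡μ power_prob P.
Proof.
move=> QP; apply: (probability_eq_pi (@measurable_irects _ T) (@irects_setI _ T)).
by move=> _ [n [B [mB ->]]]; rewrite QP// power_prob_rect.
Qed.

Lemma measurable_power_prob :
  measurable_fun setT (fun P : pprobability T R => power_prob P : pprobability Om R).
Proof.
apply: (@measurable_kernel_pi _ _ (pprobability T R) Om R
  (fun Q : pprobability T R => power_prob Q) _ (@measurable_irects _ T) (@irects_setI _ T)).
move=> _ [n [B [mB ->]]].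
apply: (eq_measurable_fun
    (fun P : pprobability T R => \prod_(j < n) (P : probability T R) (B j))).
  by move=> P _; rewrite power_prob_rect.
elim: n => [|n IH].
  by apply: (eq_measurable_fun (cst 1)) => // x _; rewrite big_ord0.
apply: (eq_measurable_fun (fun P : pprobability T R =>
   (\prod_(j < n) (P : probability T R) (B j)) * (P : probability T R) (B n))).
  by move=> x _; rewrite big_ord_recr.
by apply: emeasurable_funM => //; exact: measurable_pprobability_ev.
Qed.

End infinite_product_theory.

Section iid_power.
Variable R : realType.
Implicit Type theta : probability R R.

Lemma measurable_gprod_prod_space :
  measurable_fun setT (id : gprod nat R -> prod_space nat R).
Proof.
by move=> _ B mB; rewrite setTI.
Qed.

(** [xget] returns some law obeying the product rule: one exists by the construction above, and the
    rule fixes its values on measurable sets. *)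
Lemma iid_powerE theta (B : set (prod_space nat R)) : measurable B ->
  iid_power theta B = power_prob theta B.
Proof.
have H : is_iid_power theta (iid_power theta).
  rewrite /iid_power; case: xgetP => [_ -> //|].
  move=> /(_ (law (power_prob theta) measurable_gprod_prod_space)) []//.
  by move=> n C mC; rewrite lawE -power_prob_rect.
move=> mB.
apply: (@probability_eq_pi _ (prod_space nat R) _ _ (law (power_prob theta) measurable_gprod_prod_space)
  _ (@measurable_irects _ R) (@irects_setI _ R) _ _ mB).
by move=> _ [n [C [mC ->]]]; rewrite H// lawE -power_prob_rect.
Qed.

End iid_power.

(** * Expectations of bounded measurable functions *)

(** Such functions are integrable for all probabilities at once and closed under the operations
    below, so real-valued integrals can be computed with no further integrability condition. *)
Definition bmf d (T : measurableType d) (R : realType) (f : T -> R) :=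
  measurable_fun setT f /\ exists M, forall x, `|f x| <= M.

Section bounded_functions.
Context d (T : measurableType d) (R : realType).
Implicit Types f g : T -> R.

Lemma bmf_cst (c : R) : bmf (fun _ : T => c).
Proof. by split => //; exists `|c|. Qed.

Lemma bmfD f g : bmf f -> bmf g -> bmf (fun x => f x + g x).
Proof.
move=> [mf [M fM]] [mg [N gN]]; split; first exact: measurable_funD.
by exists (M + N) => x; rewrite (le_trans (ler_normD _ _))// lerD.
Qed.

Lemma bmfM f g : bmf f -> bmf g -> bmf (fun x => f x * g x).
Proof.
move=> [mf [M fM]] [mg [N gN]]; split; first exact: measurable_funM.
by exists (M * N) => x; rewrite normrM ler_pM.
Qed.

Lemma bmfN f : bmf f -> bmf (fun x => - f x).
Proof.
move=> [mf [M fM]]; split; first exact: measurableT_comp.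
by exists M => x; rewrite normrN.
Qed.

Lemma bmfB f g : bmf f -> bmf g -> bmf (fun x => f x - g x).
Proof. by move=> bf bg; apply: bmfD => //; exact: bmfN. Qed.

Lemma bmfX f n : bmf f -> bmf (fun x => f x ^+ n).
Proof.
move=> [mf [M fM]]; split; first exact: measurable_funX.
by exists (M ^+ n) => x; rewrite normrX lerXn2r// nnegrE (le_trans _ (fM x)).
Qed.

Lemma bmf_sum n (h : nat -> T -> R) : (forall i, bmf (h i)) ->
  bmf (fun x => \sum_(i < n) h i x).
Proof.
move=> bh; elim: n => [|n IH].
  by under eq_fun do rewrite big_ord0; exact: bmf_cst.
by under eq_fun do rewrite big_ord_recr; exact: bmfD.
Qed.

Lemma bmf_prod n (h : nat -> T -> R) : (forall i, bmf (h i)) ->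
  bmf (fun x => \prod_(i < n) h i x).
Proof.
move=> bh; elim: n => [|n IH].
  by under eq_fun do rewrite big_ord0; exact: bmf_cst.
by under eq_fun do rewrite big_ord_recr; exact: bmfM.
Qed.

Lemma bmf01 f : measurable_fun setT f -> (forall x, 0 <= f x <= 1) -> bmf f.
Proof.
by move=> mf f01; split => //; exists 1 => x; have /andP[? ?] := f01 x; rewrite ger0_norm.
Qed.

Lemma bmf_indic (B : set T) : measurable B -> bmf (fun x => \1_B x : R).
Proof.
move=> mB; apply: bmf01; first exact: measurable_indic.
by move=> x; rewrite indicE; case: (x \in B); rewrite ?lexx ?ler01.
Qed.

Lemma bmf_horner f (p : {poly R}) : bmf f -> bmf (fun x => p.[f x]).
Proof.
move=> bf; under eq_fun do rewrite horner_coef.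
apply: (bmf_sum _ (h := fun i x => p`_i * f x ^+ i)) => i.
by apply: bmfM; [exact: bmf_cst|exact: bmfX].
Qed.

End bounded_functions.

Lemma bmf_comp d d' (T : measurableType d) (S : measurableType d') (R : realType)
    (f : S -> R) (g : T -> S) : bmf f -> measurable_fun setT g -> bmf (f \o g).
Proof.
move=> [mf [M fM]] mg; split; first exact: measurableT_comp.
by exists M => x; exact: fM.
Qed.

Section expectation.
Context d (T : measurableType d) (R : realType) (P : probability T R).
Implicit Types f g : T -> R.

Lemma bmf_integrable f : bmf f -> P.-integrable setT (EFin \o f).
Proof.
move=> [mf [M fM]]; apply: measurable_bounded_integrable => //.
  by rewrite -ge0_fin_numE// fin_num_measure.
exists M; split; first exact: num_real.
by move=> N /ltW MN x _ /=; rewrite (le_trans (fM x)).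
Qed.

Lemma eq_Rexp f g : (forall x, f x = g x) -> \int[P]_x f x = \int[P]_x g x.
Proof. by move=> fg; apply: eq_Rintegral => x _. Qed.

Lemma Rexp_fin f : bmf f -> (\int[P]_x f x)%:E = (\int[P]_x (f x)%:E)%E.
Proof.
by move=> bf; rewrite fineK//; exact: (integrable_fin_num measurableT (bmf_integrable bf)).
Qed.

Lemma Rexp_cst (c : R) : \int[P]_x c = c.
Proof. by rewrite /Rintegral integral_cst_probability. Qed.

Lemma RexpD f g : bmf f -> bmf g ->
  \int[P]_x (f x + g x) = \int[P]_x f x + \int[P]_x g x.
Proof. by move=> bf bg; rewrite RintegralD//; exact: bmf_integrable. Qed.

Lemma RexpB f g : bmf f -> bmf g ->
  \int[P]_x (f x - g x) = \int[P]_x f x - \int[P]_x g x.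
Proof. by move=> bf bg; rewrite RintegralB//; exact: bmf_integrable. Qed.

Lemma RexpZl c f : bmf f -> \int[P]_x (c * f x) = c * \int[P]_x f x.
Proof. by move=> bf; rewrite RintegralZl//; exact: bmf_integrable. Qed.

Lemma RexpZr c f : bmf f -> \int[P]_x (f x * c) = (\int[P]_x f x) * c.
Proof. by move=> bf; rewrite RintegralZr//; exact: bmf_integrable. Qed.

Lemma Rexp_sum n (h : nat -> T -> R) : (forall i, bmf (h i)) ->
  \int[P]_x (\sum_(i < n) h i x) = \sum_(i < n) \int[P]_x h i x.
Proof.
move=> bh; elim: n => [|n IH].
  rewrite big_ord0 -[RHS](Rexp_cst 0); apply: eq_Rexp => x.
  by rewrite big_ord0.
rewrite big_ord_recr/= -IH -RexpD//; last exact: bmf_sum.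
by apply: eq_Rexp => x; rewrite big_ord_recr.
Qed.

Lemma le_Rexp f g : bmf f -> bmf g -> (forall x, f x <= g x) ->
  \int[P]_x f x <= \int[P]_x g x.
Proof.
by move=> bf bg fg; apply: le_Rintegral => //; exact: bmf_integrable.
Qed.

Lemma Rexp_ge0 f : (forall x, 0 <= f x) -> 0 <= \int[P]_x f x.
Proof. by move=> f0; apply: Rintegral_ge0. Qed.

Lemma Rexp01 f : measurable_fun setT f -> (forall x, 0 <= f x <= 1) ->
  0 <= \int[P]_x f x <= 1.
Proof.
move=> mf f01; rewrite Rexp_ge0/=; last by move=> x; have /andP[] := f01 x.
rewrite -[leRHS]Rexp_cst le_Rexp//; [exact: bmf01|exact: bmf_cst|].
by move=> x; have /andP[] := f01 x.
Qed.

Lemma Rexp_indic (B : set T) : measurable B -> \int[P]_x \1_B x = fine (P B).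
Proof. by move=> mB; rewrite /Rintegral integral_indic// setIT. Qed.

Lemma Rexp_horner f (p : {poly R}) g : bmf g -> bmf f ->
  \int[P]_x (g x * p.[f x]) = \sum_(i < size p) p`_i * \int[P]_x (g x * f x ^+ i).
Proof.
move=> bg bf.
rewrite (@eq_Rexp _ (fun x => \sum_(i < size p) p`_i * (g x * f x ^+ i))); last first.
  move=> x; rewrite horner_coef mulr_sumr; apply: eq_bigr => i _.
  by rewrite mulrCA.
have b i : bmf (fun x => g x * f x ^+ i) by apply: bmfM => //; exact: bmfX.
rewrite (@Rexp_sum _ (fun i x => p`_i * (g x * f x ^+ i))).
  by apply: eq_bigr => i _; rewrite RexpZl.
by move=> i; apply: bmfM => //; exact: bmf_cst.
Qed.

Lemma Rexp_cvg (M : R) (f_ : nat -> T -> R) f :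
  (forall n, measurable_fun setT (f_ n)) -> (forall n x, `|f_ n x| <= M) ->
  (forall x, f_ n x @[n --> \oo] --> f x) ->
  \int[P]_x f_ n x @[n --> \oo] --> \int[P]_x f x.
Proof.
move=> mf fM ff.
have mg : measurable_fun setT f by apply: (measurable_fun_cvg mf) => x _; exact: ff.
have bf : bmf f.
  split => //; exists M => x.
  by apply: (cvgr_to_le (cvg_norm (ff x))); exact: nearW.
suff H : (\int[P]_x (f_ n x)%:E @[n --> \oo] --> \int[P]_x (f x)%:E)%E.
  by apply: fine_cvg; rewrite Rexp_fin.
have [//| | |//| |] := @dominated_convergence _ _ _ P setT measurableT
  (fun n x => (f_ n x)%:E) (fun x => (f x)%:E) (fun=> M%:E).
- by move=> n; exact/measurable_EFinP.
- exact/measurable_EFinP.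
- by apply: aeW => x _; apply/cvg_EFin; [exact: nearW|exact: ff].
- exact: (bmf_integrable (bmf_cst _ M)).
- by apply: aeW => x n _; rewrite lee_fin.
- by [].
Qed.

End expectation.

(** Transfer formulas for image laws, mixtures and products are first available for nonnegative
    integrands. Adding the bound M and subtracting it afterwards extends them to bounded ones. *)
Lemma bounded_shift (T : Type) (R : realType) (f : T -> R) M :
  (forall x, `|f x| <= M) -> forall x, 0 <= f x + M.
Proof. by move=> fM x; rewrite -lerBlDr sub0r; have := fM x; rewrite ler_norml => /andP[]. Qed.

Section expectation_transfer.
Context d d' (T : measurableType d) (S : measurableType d') (R : realType).
Local Open Scope ring_scope.

Lemma Rexp_law (P : probability T R) (f : T -> S) (mf : measurable_fun setT f)
  (g : S -> R) : bmf g -> \int[law P mf]_y g y = \int[P]_x g (f x).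
Proof.
move=> bg; have [mg [M gM]] := bg.
have bgf : bmf (fun x => g (f x)) by exact: (bmf_comp bg mf).
suff : \int[law P mf]_y (g y + M) = \int[P]_x (g (f x) + M).
  rewrite !RexpD//; try exact: bmf_cst.
  by rewrite !Rexp_cst => /addIr.
congr fine; rewrite integral_law//.
  by apply/measurable_EFinP; exact: measurable_funD.
by move=> x; rewrite lee_fin; exact: bounded_shift.
Qed.

Lemma Rexp_eq (P Q : probability T R) (f : T -> R) : P ≡μ Q ->
  \int[P]_x f x = \int[Q]_x f x.
Proof.
by move=> PQ; congr fine; apply: eq_measure_integral => B mB _; exact: PQ.
Qed.

Lemma measurable_kernel_Rexp (K : T -> pprobability S R) (f : S -> R) :
  measurable_fun setT K -> bmf f ->
  bmf (fun e => \int[(K e : probability S R)]_x f x).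
Proof.
move=> mK bf; have [mf [M fM]] := bf.
pose giry_K : T -> giry S R := fun e => (K e : probability S R).
have mgiry_K : measurable_fun setT giry_K.
  by apply: measurable_giry_codensity => // B; exact: measurable_kernel_ev.
split.
  have fE e : \int[(K e : probability S R)]_x f x =
      fine (giry_int (giry_K e) (fun x => (f x + M)%:E)) - M.
    rewrite -[fine _]/(\int[(K e : probability S R)]_x (f x + M)) RexpD//; last exact: bmf_cst.
    by rewrite Rexp_cst addrK.
  under eq_fun do rewrite fE.
  apply: measurable_funB => //; apply: measurableT_comp => //.
  apply: (@measurableT_comp _ _ _ _ _ _
    (giry_int ^~ (fun x => (f x + M)%:E)) setT giry_K) => //.
  apply: measurable_giry_int.
    by apply/measurable_EFinP; exact: measurable_funD.
  by move=> x; rewrite lee_fin; exact: bounded_shift.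
exists M => e; rewrite ler_norml; apply/andP; split.
- rewrite -[leLHS](Rexp_cst (K e : probability S R)) le_Rexp//; first exact: bmf_cst.
  by move=> x; have := fM x; rewrite ler_norml => /andP[].
- rewrite -[leRHS](Rexp_cst (K e : probability S R)) le_Rexp//; first exact: bmf_cst.
  by move=> x; have := fM x; rewrite ler_norml => /andP[].
Qed.

Lemma Rexp_mixture (Th : probability T R) (K : T -> pprobability S R)
  (mK : measurable_fun setT K) (f : S -> R) : bmf f ->
  \int[mixture_prob Th mK]_x f x =
  \int[Th]_e \int[(K e : probability S R)]_x f x.
Proof.
move=> bf; have [mf [M fM]] := bf.
suff : \int[mixture_prob Th mK]_x (f x + M) =
    \int[Th]_e (\int[(K e : probability S R)]_x f x + M).
  rewrite !RexpD//; try exact: bmf_cst; last exact: measurable_kernel_Rexp.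
  by rewrite !Rexp_cst => /addIr.
congr fine; rewrite integral_mixture//; last 2 first.
- by apply/measurable_EFinP; exact: measurable_funD.
- by move=> x; rewrite lee_fin; exact: bounded_shift.
apply: eq_integral => e _.
rewrite -[in RHS](Rexp_cst (K e : probability S R) M) -RexpD//; last exact: bmf_cst.
by rewrite Rexp_fin//; apply: bmfD => //; exact: bmf_cst.
Qed.

End expectation_transfer.

Section expectation_pprod.
Context d d' (T : measurableType d) (S : measurableType d') (R : realType).

Lemma bmf_section (f : T * S -> R) (x : T) : bmf f -> bmf (fun y => f (x, y)).
Proof. by move=> bf; apply: (bmf_comp bf); exact: pair1_measurable. Qed.

Lemma bmf_pprod_section (Q : probability S R) (f : T * S -> R) : bmf f ->
  bmf (fun x => \int[Q]_y f (x, y)).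
Proof.
move=> bf.
have mK : measurable_fun setT
    (fun x => law Q (pair1_measurable x) : pprobability (T * S)%type R).
  apply: measurable_pprobability => B mB.
  apply: (eq_measurable_fun (fun x => Q (xsection B x))).
    move=> x _; transitivity (Q (pair x @^-1` B)) => //; congr (Q _).
    by apply/seteqP; split => y; rewrite /xsection/= inE.
  exact: measurable_fun_xsection.
have := measurable_kernel_Rexp mK bf; congr bmf; apply/funext => x.
by rewrite Rexp_law.
Qed.

Lemma Rexp_pprod (P : probability T R) (Q : probability S R) (f : T * S -> R) :
  bmf f -> \int[pprod P Q]_z f z = \int[P]_x \int[Q]_y f (x, y).
Proof.
move=> bf; have [mf [M fM]] := bf.
suff : \int[pprod P Q]_z (f z + M) = \int[P]_x (\int[Q]_y f (x, y) + M).
  rewrite !RexpD//; try exact: bmf_cst; last exact: bmf_pprod_section.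
  by rewrite !Rexp_cst => /addIr.
congr fine; rewrite integral_pprod//; last 2 first.
- by apply/measurable_EFinP; exact: measurable_funD.
- by move=> x; rewrite lee_fin; exact: bounded_shift.
apply: eq_integral => x _; have bfx := bmf_section x bf.
rewrite -[in RHS](Rexp_cst Q M) -RexpD//; last exact: bmf_cst.
by rewrite Rexp_fin//; apply: bmfD => //; exact: bmf_cst.
Qed.

End expectation_pprod.

Section expectation_power.
Context d (T : measurableType d) (R : realType) (P : probability T R).
Local Notation Om := (gprod nat T).

Lemma Rexp_power_scons (f : Om -> R) : bmf f ->
  \int[power_prob P]_x f x = \int[P]_a \int[power_prob P]_x f (scons a x).
Proof.
move=> bf.
transitivity (\int[law (pprod P (power_prob P)) (@measurable_scons _ T)]_x f x).
  apply: Rexp_eq => B mB; rewrite [LHS]power_prob_section//.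
  apply: eq_integral => a _; congr (power_prob P _).
  by rewrite /xsection; apply/seteqP; split => x /=; rewrite inE.
rewrite Rexp_law// (@Rexp_pprod _ _ T Om _ _ _ (fun p : T * Om => f (scons p.1 p.2)))//.
exact: (bmf_comp bf (@measurable_scons _ T)).
Qed.

Lemma bmf_gcoord (f : T -> R) i : bmf f -> bmf (fun x : Om => f (x i)).
Proof. by move=> bf; apply: (bmf_comp bf); exact: measurable_gcoord. Qed.

Lemma Rexp_power_prod n (g : nat -> T -> R) : (forall i, bmf (g i)) ->
  \int[power_prob P]_x (\prod_(i < n) g i (x i)) = \prod_(i < n) \int[P]_a g i a.
Proof.
have bprod m (h : nat -> T -> R) : (forall i, bmf (h i)) ->
    bmf ((fun x => \prod_(i < m) h i (x i)) : Om -> R).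
  by move=> bh; apply: (@bmf_prod _ Om R m (fun i x => h i (x i))) => i; exact: bmf_gcoord.
elim: n g => [|n IH] g bg.
  by rewrite big_ord0 -[RHS](Rexp_cst (power_prob P)); apply: eq_Rexp => x; rewrite big_ord0.
rewrite Rexp_power_scons; last exact: bprod.
rewrite big_ord_recl /= -RexpZr//; apply: eq_Rexp => a.
rewrite -(IH (fun i => g i.+1))// -RexpZl; last exact: (bprod n (fun i => g i.+1)).
by apply: eq_Rexp => x; rewrite big_ord_recl.
Qed.

End expectation_power.

(** * Moments and Laplace transforms determine laws *)

Section indicator_polynomials.
Variable R : realType.
Implicit Types c y r : R.

(** With a = - ln r, r^n = exp(- n a), and exp(x) >= x^2 / 2 gives n r^n <= (2 / a^2) / n. *)
Lemma cvg_natM_expr r : 0 <= r < 1 -> n%:R * r ^+ n @[n --> \oo] --> (0 : R).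
Proof.
move=> /andP[]; rewrite le_eqVlt => /predU1P[<- _|r0 r1].
  apply: cvg_near_cst; near=> n.
  by rewrite expr0n gtn_eqF ?mulr0//; near: n; exists 1%N.
have a0 : 0 < - ln r by rewrite oppr_gt0 ln_lt0// r0.
pose a := - ln r.
have rE n : r ^+ n = expR (- (n%:R * a)).
  by rewrite /a mulrN opprK expRM_natl lnK.
apply: (@squeeze_cvgr _ _ _ _ (fun=> 0) (fun n => 2 / a ^+ 2 * n%:R^-1)); last 2 first.
- exact: cvg_cst.
- rewrite -[X in _ --> X](mulr0 (2 / a ^+ 2)); apply: cvgM; first exact: cvg_cst.
  apply/gtr0_cvgV0; last exact: cvgr_idn.
  by near=> n; rewrite ltr0n; near: n; exists 1%N.
near=> n; have n0 : 0 < n%:R :> R by rewrite ltr0n; near: n; exists 1%N.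
have -> /= : 0 <= n%:R * r ^+ n by rewrite mulr_ge0// exprn_ge0// ltW.
rewrite rE expRN.
have x0 : 0 < n%:R * a by rewrite mulr_gt0.
have H : (n%:R * a) ^+ 2 / 2 <= expR (n%:R * a).
  by apply: le_trans (@expR_ge1Dxn R (n%:R * a) 1 (ltW x0)); rewrite lerDr ler01.
have H' : (expR (n%:R * a))^-1 <= ((n%:R * a) ^+ 2 / 2)^-1.
  by rewrite lef_pV2 ?posrE ?expR_gt0// divr_gt0// exprn_gt0.
apply: (@le_trans _ _ (n%:R * ((n%:R * a) ^+ 2 / 2)^-1)).
  by rewrite ler_wpM2l// ltW.
rewrite le_eqVlt; apply/orP; left; apply/eqP.
by field; rewrite !gt_eqF.
Unshelve. all: by end_near. Qed.

(* On [0, 1] these polynomials tend to the indicator of [y < c]: the exponent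
   [k] satisfies [k * c^n >= n], whereas [k * y^n -> 0] when [y < c]. *)
Definition indicator_exponent c n : nat := (n * (Num.truncn (c^-1 ^+ n)).+1)%N.

Definition indicator_poly c n : {poly R} :=
  (1 - 'X^n) ^+ indicator_exponent c n.

Lemma indicator_polyE c n y :
  (indicator_poly c n).[y] = (1 - y ^+ n) ^+ indicator_exponent c n.
Proof. by rewrite /indicator_poly horner_exp !hornerE. Qed.

Lemma indicator_poly01 c n y : 0 <= y <= 1 -> 0 <= (indicator_poly c n).[y] <= 1.
Proof.
move=> /andP[y0 y1]; rewrite indicator_polyE.
have yn1 : y ^+ n <= 1 by rewrite exprn_ile1.
have yn0 : 0 <= y ^+ n by rewrite exprn_ge0.
by rewrite exprn_ge0 ?subr_ge0//= exprn_ile1 ?subr_ge0// lerBlDr lerDl.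
Qed.

Lemma bernoulli_ineq y k : 0 <= y <= 1 -> 1 - k%:R * y <= (1 - y) ^+ k.
Proof.
move=> /andP[y0 y1]; elim: k => [|k IH]; first by rewrite mul0r subr0 expr0.
rewrite exprS; apply: (@le_trans _ _ ((1 - y) * (1 - k%:R * y))).
  rewrite -natr1; have : 0 <= k%:R * y ^+ 2 by rewrite mulr_ge0// sqr_ge0.
  by rewrite expr2; nra.
by rewrite ler_wpM2l// subr_ge0.
Qed.

(** For y < c, Bernoulli's inequality gives the lower bound 1 - 2 n (y / c)^n, where c <= 1 absorbs
    the rounding of the exponent. For y >= c, (1 - y^n)^k <= exp(- k y^n) <= exp(- n); the factor n
    in the exponent is what settles the case y = c. *)
Lemma cvg_indicator_poly c y : 0 < c <= 1 -> 0 <= y <= 1 ->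
  (indicator_poly c n).[y] @[n --> \oo] --> ((y < c)%R%:R : R).
Proof.
move=> /andP[c0 c1] y01; have /andP[y0 y1] := y01.
have cn n : 0 < c^-1 ^+ n by rewrite exprn_gt0// invr_gt0.
have ck n : n%:R * c^-1 ^+ n <= (indicator_exponent c n)%:R.
  by rewrite natrM ler_wpM2l// ltW// truncnS_gt.
have kc n : (indicator_exponent c n)%:R <= n%:R * c^-1 ^+ n + n%:R.
  rewrite natrM -{3}[n%:R]mulr1 -mulrDr ler_wpM2l// -natr1 lerD2r.
  by rewrite truncn_le// ltW.
have [yc|cy] := ltP y c.
  apply: (@squeeze_cvgr _ _ _ _ (fun n => 1 - 2 * (n%:R * (y / c) ^+ n)) (fun=> 1)).
  - near=> n; have /andP[_ ->] := @indicator_poly01 c n y y01; rewrite andbT.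
    rewrite indicator_polyE.
    have yn : 0 <= y ^+ n <= 1 by rewrite exprn_ge0// exprn_ile1.
    apply: le_trans (bernoulli_ineq _ yn); rewrite lerD2l lerN2.
    apply: (@le_trans _ _ ((n%:R * c^-1 ^+ n + n%:R) * y ^+ n)).
      by rewrite ler_wpM2r// exprn_ge0.
    rewrite mulrDl -[n%:R * c^-1 ^+ n * _]mulrA -exprMn [c^-1 * y]mulrC.
    rewrite [leRHS](_ : _ = n%:R * (y / c) ^+ n + n%:R * (y / c) ^+ n); last by ring.
    have yc' : y <= y / c by rewrite ler_pdivlMr// ler_piMr.
    by rewrite lerD2l ler_wpM2l// lerXn2r// nnegrE (le_trans y0).
  - rewrite [X in _ --> X](_ : _ = 1 - 2 * 0); last by rewrite mulr0 subr0.
    apply: cvgB; first exact: cvg_cst.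
    apply: cvgM; first exact: cvg_cst.
    by apply: cvg_natM_expr; rewrite divr_ge0 ?(ltW c0)//= ltr_pdivrMr// mul1r.
  - exact: cvg_cst.
apply: (@squeeze_cvgr _ _ _ _ (fun=> 0) (fun n => expR (- 1) ^+ n)); last 2 first.
- exact: cvg_cst.
- by apply: cvg_expr; rewrite ger0_norm ?expR_ge0// expR_lt1.
near=> n; have /andP[-> _] /= := @indicator_poly01 c n y y01.
rewrite indicator_polyE.
have yn : 0 <= y ^+ n <= 1 by rewrite exprn_ge0// exprn_ile1.
apply: (@le_trans _ _ (expR (- y ^+ n) ^+ indicator_exponent c n)).
  rewrite lerXn2r// ?nnegrE ?expR_ge0//; first by have /andP[_] := yn; rewrite subr_ge0.
  exact: expR_ge1Dx.
rewrite -!expRM_natl ler_expR !mulrN mulr1 lerN2.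
apply: (@le_trans _ _ (n%:R * c^-1 ^+ n * y ^+ n)); last first.
  by rewrite ler_wpM2r//; have /andP[] := yn.
rewrite -mulrA -exprMn ler_peMr// exprn_ege1//.
by rewrite mulrC ler_pdivlMr// mul1r.
Unshelve. all: by end_near. Qed.

End indicator_polynomials.

(** * Moment problem on [0, 1], in one and in several variables *)

Section moments.
Context d1 d2 (T1 : measurableType d1) (T2 : measurableType d2) (R : realType).
Variables (P1 : probability T1 R) (P2 : probability T2 R).

(** By linearity powers may be replaced by polynomials, in the limit by indicators of half-lines,
    and by a Dynkin argument by all measurable sets. The weights may change sign, so neither side is
    a measure in B, and countable additivity is obtained by dominated convergence. *)
Lemma moment_unique_weighted (W1 Y1 : T1 -> R) (W2 Y2 : T2 -> R) :
  bmf W1 -> bmf W2 -> measurable_fun setT Y1 -> measurable_fun setT Y2 ->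
  (forall x, 0 <= Y1 x <= 1) -> (forall x, 0 <= Y2 x <= 1) ->
  (forall k : nat, \int[P1]_x (W1 x * Y1 x ^+ k) = \int[P2]_x (W2 x * Y2 x ^+ k)) ->
  forall B : set R, measurable B ->
  \int[P1]_x (W1 x * \1_B (Y1 x)) = \int[P2]_x (W2 x * \1_B (Y2 x)).
Proof.
move=> bW1 bW2 mY1 mY2 Y101 Y201 WY.
have bY1 := bmf01 mY1 Y101; have bY2 := bmf01 mY2 Y201.
have bI1 (B : set R) : measurable B -> bmf (fun x => W1 x * \1_B (Y1 x)).
  by move=> mB; apply: bmfM => //; apply: (bmf_comp (bmf_indic _ mB)).
have bI2 (B : set R) : measurable B -> bmf (fun x => W2 x * \1_B (Y2 x)).
  by move=> mB; apply: bmfM => //; apply: (bmf_comp (bmf_indic _ mB)).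
have WYp (p : {poly R}) : \int[P1]_x (W1 x * p.[Y1 x]) = \int[P2]_x (W2 x * p.[Y2 x]).
  by rewrite !Rexp_horner//; apply: eq_bigr => i _; rewrite WY.
have WY1 : \int[P1]_x W1 x = \int[P2]_x W2 x.
  transitivity (\int[P1]_x (W1 x * Y1 x ^+ 0)).
    by apply: eq_Rexp => x; rewrite expr0 mulr1.
  by rewrite WY; apply: eq_Rexp => x; rewrite expr0 mulr1.
have cvgI d (T : measurableType d) (P : probability T R) (W Y : T -> R) c :
    bmf W -> measurable_fun setT Y -> (forall x, 0 <= Y x <= 1) -> 0 < c <= 1 ->
    \int[P]_x (W x * (indicator_poly c n).[Y x]) @[n --> \oo] -->
    \int[P]_x (W x * \1_(`]-oo, c[) (Y x)).
  move=> bW mY Y01 c01; have [mW [M WM]] := bW.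
  apply: (@Rexp_cvg _ _ _ _ M).
  - move=> n; suff [] : bmf (fun x => W x * (indicator_poly c n).[Y x]) by [].
    by apply: bmfM => //; apply: bmf_horner; exact: bmf01.
  - move=> n x; have /andP[? ?] := indicator_poly01 c n (Y01 x).
    by rewrite normrM [`|_.[_]|]ger0_norm// (le_trans _ (WM x))// ler_piMr.
  - move=> x; apply: cvgM; first exact: cvg_cst.
    rewrite indicE (_ : (Y x \in _) = (Y x < c)) ?in_setE; first exact: cvg_indicator_poly.
    by apply/idP/idP; rewrite inE/= in_itv.
suff : forall B : set R, (@RGenInftyO.G R).-sigma.-measurable B ->
    \int[P1]_x (W1 x * \1_B (Y1 x)) = \int[P2]_x (W2 x * \1_B (Y2 x)).
  by move=> H B mB; apply: H; rewrite -RGenInftyO.measurableE.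
apply: (@dynkin_induction _ R (@RGenInftyO.G R) (fun B =>
    \int[P1]_x (W1 x * \1_B (Y1 x)) = \int[P2]_x (W2 x * \1_B (Y2 x)))).
- exact: RGenInftyO.measurableE.
- move=> _ _ [a ->] [b ->]; exists (Num.min a b).
  by apply/seteqP; split => x /=; rewrite !in_itv/= lt_min => /andP.
- by under eq_Rexp do rewrite indicE in_setT mulr1;
    under [RHS]eq_Rexp do rewrite indicE in_setT mulr1.
- move=> _ [c ->].
  (* [indicator_poly] covers 0 < c <= 1. For other c the half-line misses or contains all values of
     Y1 and Y2. *)
  have [c0|c0] := leP c 0.
    transitivity (\int[P1]_x (0 : R)).
      apply: eq_Rexp => x; rewrite indicE memNset ?mulr0//= in_itv/=.
      by apply/negP; rewrite -leNgt (le_trans c0)//; have /andP[] := Y101 x.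
    rewrite Rexp_cst -[LHS](Rexp_cst P2); apply: eq_Rexp => x.
    rewrite indicE memNset ?mulr0//= in_itv/=.
    by apply/negP; rewrite -leNgt (le_trans c0)//; have /andP[] := Y201 x.
  have [c1|c1] := leP c 1; last first.
    transitivity (\int[P1]_x W1 x).
      apply: eq_Rexp => x; rewrite indicE mem_set ?mulr1//= in_itv/=.
      by rewrite (le_lt_trans _ c1)//; have /andP[] := Y101 x.
    rewrite WY1; apply: eq_Rexp => x.
    rewrite indicE mem_set ?mulr1//= in_itv/=.
    by rewrite (le_lt_trans _ c1)//; have /andP[] := Y201 x.
  have c01 : 0 < c <= 1 by rewrite c0.
  have H1 := cvgI _ _ P1 _ _ _ bW1 mY1 Y101 c01.
  have H2 := cvgI _ _ P2 _ _ _ bW2 mY2 Y201 c01.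
  rewrite (funext (fun n => WYp (indicator_poly c n))) in H1.
  exact: (cvg_unique _ H1 H2).
- move=> S mS IS.
  have IC d (T : measurableType d) (P : probability T R) (W Y : T -> R) :
      bmf W -> measurable_fun setT Y ->
      \int[P]_x (W x * \1_(~` S) (Y x)) =
      \int[P]_x W x - \int[P]_x (W x * \1_S (Y x)).
    move=> bW mY; rewrite -RexpB//.
      apply: eq_Rexp => x; rewrite !indicE in_setC.
      by case: (Y x \in S); rewrite /= ?mulr0 ?mulr1 ?subrr ?subr0.
    by apply: bmfM => //; apply: (bmf_comp (bmf_indic _ mS)).
  by rewrite !IC// WY1 IS.
- move=> F mF tF IF.
  have IU d (T : measurableType d) (P : probability T R) (W Y : T -> R) :
      bmf W -> measurable_fun setT Y ->
      \sum_(i < n) \int[P]_x (W x * \1_(F i) (Y x)) @[n --> \oo] -->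
      \int[P]_x (W x * \1_(\bigcup_k F k) (Y x)).
    move=> bW mY; have [mW [M WM]] := bW.
    have bF i : bmf (fun x => W x * \1_(F i) (Y x)).
      by apply: bmfM => //; apply: (bmf_comp (bmf_indic _ (mF i))).
    have sE y n : \sum_(i < n) \1_(F i) y =
        (y \in \bigcup_(i < n) F i)%:R :> R.
      elim: n => [|n IHn].
        by rewrite big_ord0 memNset// => -[].
      rewrite big_ord_recr/= IHn indicE.
      have [yn|yn] := boolP (y \in F n).
        have -> : (y \in \bigcup_(i < n.+1) F i) = true.
          by apply/mem_set; exists n => //=; exact: set_mem yn.
        rewrite memNset ?add0r// => -[i /= in_ Fi].
        have := tF i n I I (ex_intro _ y (conj Fi (set_mem yn))).
        by move=> iE; rewrite iE ltnn in in_.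
      rewrite addr0; congr ((nat_of_bool _)%:R); apply/idP/idP; rewrite !inE.
        by move=> [i /= in_ Fi]; exists i => //=; rewrite ltnW.
      move=> [i /=]; rewrite ltnS leq_eqVlt => /predU1P[->|in_ Fi]; last by exists i.
      by move=> Fn; rewrite notin_setE in yn.
    under eq_fun do rewrite -(Rexp_sum P _ bF).
    apply: (@Rexp_cvg _ _ _ _ M).
    - by move=> n; have [] := bmf_sum n bF.
    - move=> n x; rewrite -mulr_sumr sE normrM (le_trans _ (WM x))// ler_piMr//.
      by case: (_ \in _); rewrite ?normr1 ?normr0.
    - move=> x; under eq_fun do rewrite -mulr_sumr sE.
      apply: cvgM; first exact: cvg_cst.
      rewrite indicE; have [|nF] := boolP (Y x \in \bigcup_k F k).
        rewrite inE => -[k _ Fk]; apply: cvg_near_cst; near=> n.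
        by rewrite mem_set//; exists k => //=; near: n; exists k.+1.
      apply: cvg_near_cst; near=> n; rewrite memNset// => -[k _ Fk].
      by move: nF; rewrite notin_setE; apply; exists k.
  have H1 := IU _ _ P1 _ _ bW1 mY1.
  have H2 := IU _ _ P2 _ _ bW2 mY2.
  rewrite (funext (fun n => eq_bigr _ (fun (i : 'I_n) _ => IF i))) in H1.
  exact: (cvg_unique _ H1 H2).
Unshelve. all: by end_near. Qed.

End moments.

Lemma prod_indic (T : Type) (R : realType) n (B : nat -> set T) (y : nat -> T) :
  \prod_(i < n) \1_(B i) (y i) = `[< forall i, (i < n)%N -> B i (y i) >]%:R :> R.
Proof.
case: asboolP => [By|nB].
  by rewrite big1// => j _; rewrite indicE mem_set//; exact: By.
have [j nBj] : exists j : 'I_n, ~ B j (y j).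
  apply: contrapT => h; apply: nB => j jn; apply: contrapT => nBj.
  by apply: h; exists (Ordinal jn).
by rewrite (bigD1 j)//= indicE memNset// mul0r.
Qed.

Section joint_moments.
Context d1 d2 (T1 : measurableType d1) (T2 : measurableType d2) (R : realType).
Variables (P1 : probability T1 R) (P2 : probability T2 R).
Variables (Y1 : nat -> T1 -> R) (Y2 : nat -> T2 -> R).
Hypothesis mY1 : forall i, measurable_fun setT (Y1 i).
Hypothesis mY2 : forall i, measurable_fun setT (Y2 i).
Hypothesis Y101 : forall i x, 0 <= Y1 i x <= 1.
Hypothesis Y201 : forall i x, 0 <= Y2 i x <= 1.

Let bY1 i : bmf (Y1 i). Proof. exact: bmf01. Qed.
Let bY2 i : bmf (Y2 i). Proof. exact: bmf01. Qed.

(* The weights let the induction convert one power after the other into an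
   indicator. *)
Let joint_moments_weighted n (W1 : T1 -> R) (W2 : T2 -> R) : bmf W1 -> bmf W2 ->
  (forall k : nat -> nat, \int[P1]_x (W1 x * \prod_(i < n) Y1 i x ^+ k i) =
                          \int[P2]_x (W2 x * \prod_(i < n) Y2 i x ^+ k i)) ->
  forall B : nat -> set R, (forall i, measurable (B i)) ->
  \int[P1]_x (W1 x * \prod_(i < n) \1_(B i) (Y1 i x)) =
  \int[P2]_x (W2 x * \prod_(i < n) \1_(B i) (Y2 i x)).
Proof.
elim: n W1 W2 => [|n IH] W1 W2 bW1 bW2 WY B mB.
  have := WY (fun=> 0%N).
  under eq_Rexp do rewrite big_ord0.
  under [in X in _ = X -> _]eq_Rexp do rewrite big_ord0.
  under [in X in _ -> X = _]eq_Rexp do rewrite big_ord0.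
  by under [in X in _ -> _ = X]eq_Rexp do rewrite big_ord0.
have bI1 : bmf (fun x => \1_(B n) (Y1 n x) : R) by apply: (bmf_comp (bmf_indic _ (mB n))).
have bI2 : bmf (fun x => \1_(B n) (Y2 n x) : R) by apply: (bmf_comp (bmf_indic _ (mB n))).
transitivity (\int[P1]_x ((W1 x * \1_(B n) (Y1 n x)) * \prod_(i < n) \1_(B i) (Y1 i x))).
  by apply: eq_Rexp => x; rewrite big_ord_recr/= mulrAC mulrA.
transitivity (\int[P2]_x ((W2 x * \1_(B n) (Y2 n x)) * \prod_(i < n) \1_(B i) (Y2 i x))); last first.
  by apply: eq_Rexp => x; rewrite big_ord_recr/= mulrAC mulrA.
apply: IH => //; [exact: bmfM|exact: bmfM|move=> k].
transitivity (\int[P1]_x ((W1 x * \prod_(i < n) Y1 i x ^+ k i) * \1_(B n) (Y1 n x))).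
  by apply: eq_Rexp => x; rewrite mulrAC.
transitivity (\int[P2]_x ((W2 x * \prod_(i < n) Y2 i x ^+ k i) * \1_(B n) (Y2 n x))); last first.
  by apply: eq_Rexp => x; rewrite mulrAC.
apply: moment_unique_weighted => //.
- apply: bmfM => //; apply: (bmf_prod _ (h := fun i x => Y1 i x ^+ k i)) => i.
  exact: bmfX.
- apply: bmfM => //; apply: (bmf_prod _ (h := fun i x => Y2 i x ^+ k i)) => i.
  exact: bmfX.
move=> m; have := WY (fun i => if (i < n)%N then k i else m) => H.
transitivity (\int[P1]_x (W1 x * \prod_(i < n.+1) Y1 i x ^+ (if (i < n)%N then k i else m))).
  apply: eq_Rexp => x; rewrite big_ord_recr/= ltnn mulrA; congr (_ * _ * _).
  by apply: eq_bigr => i _; rewrite ltn_ord.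
rewrite H; apply: eq_Rexp => x; rewrite big_ord_recr/= ltnn mulrA; congr (_ * _ * _).
by apply: eq_bigr => i _; rewrite ltn_ord.
Qed.

Lemma joint_moments_unique n :
  (forall k : nat -> nat, \int[P1]_x (\prod_(i < n) Y1 i x ^+ k i) =
                          \int[P2]_x (\prod_(i < n) Y2 i x ^+ k i)) ->
  forall B : nat -> set R, (forall i, measurable (B i)) ->
  P1 [set x | forall i, (i < n)%N -> B i (Y1 i x)] =
  P2 [set x | forall i, (i < n)%N -> B i (Y2 i x)].
Proof.
move=> YY B mB.
have H d (T : measurableType d) (P : probability T R) (Y : nat -> T -> R) :
    (forall i, measurable_fun setT (Y i)) ->
    P [set x | forall i, (i < n)%N -> B i (Y i x)] =
    (\int[P]_x (1 * \prod_(i < n) \1_(B i) (Y i x)))%:E.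
  move=> mY; set A := [set x | _].
  have mA : measurable A.
    rewrite (_ : A = \bigcap_(i in [set i | (i < n)%N]) (Y i @^-1` B i))//.
    apply: bigcap_measurableType => // i _.
    by rewrite -[X in measurable X]setTI; exact: mY.
  rewrite (@eq_Rexp _ _ _ _ _ (\1_A : T -> R)); last first.
    move=> x; rewrite mul1r (prod_indic R n B (fun i => Y i x)) indicE.
    by congr ((nat_of_bool _)%:R); apply/asboolP/idP; rewrite inE.
  by rewrite Rexp_indic// fineK// fin_num_measure.
rewrite !H//; congr EFin.
apply: joint_moments_weighted => //; try exact: bmf_cst.
move=> k; under eq_Rexp do rewrite mul1r.
by under [RHS]eq_Rexp do rewrite mul1r.
Qed.

End joint_moments.

Section moments_unique.
Context d1 d2 (T1 : measurableType d1) (T2 : measurableType d2) (R : realType).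
Variables (P1 : probability T1 R) (P2 : probability T2 R).
Variables (Y1 : T1 -> R) (Y2 : T2 -> R).
Hypothesis mY1 : measurable_fun setT Y1.
Hypothesis mY2 : measurable_fun setT Y2.
Hypothesis Y101 : forall x, 0 <= Y1 x <= 1.
Hypothesis Y201 : forall x, 0 <= Y2 x <= 1.
Hypothesis YY : forall k : nat, \int[P1]_x Y1 x ^+ k = \int[P2]_x Y2 x ^+ k.

Lemma moments_unique : law P1 mY1 ≡μ law P2 mY2.
Proof.
move=> B mB; suff : P1 (Y1 @^-1` B) = P2 (Y2 @^-1` B) by [].
have := @joint_moments_unique _ _ _ _ _ P1 P2 (fun=> Y1) (fun=> Y2) (fun=> mY1)
  (fun=> mY2) (fun=> Y101) (fun=> Y201) 1 _ (fun=> B) (fun=> mB).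
have E T (Y : T -> R) : [set x | forall i, (i < 1)%N -> B (Y x)] = Y @^-1` B.
  by apply/seteqP; split => [x /(_ 0%N erefl)//|x /= Bx i _].
rewrite !E; apply => k.
under eq_Rexp do rewrite big_ord1.
by under [RHS]eq_Rexp do rewrite big_ord1.
Qed.

Lemma moments_unique_Rexp (f : R -> R) : bmf f ->
  \int[P1]_x f (Y1 x) = \int[P2]_x f (Y2 x).
Proof.
move=> bf; rewrite -(Rexp_law P1 mY1 bf) -(Rexp_law P2 mY2 bf).
exact: Rexp_eq moments_unique.
Qed.

End moments_unique.

(** * Laplace transforms at the integers *)

Section laplace.
Variable R : realType.
Implicit Types mu nu : probability R R.

(** The truncation at 0 bounds the kernel by 1 when s >= 0, so the transform is defined for every
    law; for laws on the half-line it is the usual one. *)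
Definition laplace_kernel (s x : R) : R := expR (- (s * Num.max x 0)).

Definition laplace mu (s : R) : R := \int[mu]_x laplace_kernel s x.

Lemma measurable_laplace_kernel s : measurable_fun setT (laplace_kernel s).
Proof.
apply: measurableT_comp => //; apply: measurableT_comp => //.
by apply: measurable_funM => //; exact: measurable_maxr.
Qed.

Lemma laplace_kernel01 s x : 0 <= s -> 0 <= laplace_kernel s x <= 1.
Proof.
by move=> s0; rewrite expR_ge0/= expR_le1 lerNl oppr0 mulr_ge0// le_max lexx orbT.
Qed.

Lemma bmf_laplace_kernel s : 0 <= s -> bmf (laplace_kernel s).
Proof.
move=> s0; apply: bmf01; first exact: measurable_laplace_kernel.
by move=> x; exact: laplace_kernel01.
Qed.

Lemma laplace01 mu s : 0 <= s -> 0 <= laplace mu s <= 1.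
Proof.
move=> s0; apply: Rexp01; first exact: measurable_laplace_kernel.
by move=> x; exact: laplace_kernel01.
Qed.

Lemma laplace_kernelX (s : R) k x : laplace_kernel s x ^+ k = laplace_kernel (k%:R * s) x.
Proof. by rewrite /laplace_kernel -expRM_natl mulrN mulrA. Qed.

Lemma nonneg_supportedI mu (B : set R) : measurable B -> nonneg_supported mu ->
  mu B = mu (B `&` `[0, +oo[).
Proof.
move=> mB mu0; apply: (probability_eq_setI _ mB _ mu0) => //; first exact: measurableI.
by rewrite -setIA setIid.
Qed.

(** The values at the integers are the moments of the variable exp(- x) in [0, 1], from which x is
    read off by - ln when x >= 0. *)
Lemma laplace_unique mu nu : nonneg_supported mu -> nonneg_supported nu ->
  (forall k : nat, laplace mu k%:R = laplace nu k%:R) -> mu ≡μ nu.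
Proof.
move=> mu0 nu0 munu B mB /=.
have mk := measurable_laplace_kernel 1.
have k01 x := @laplace_kernel01 1 x ler01.
have H : law mu mk ≡μ law nu mk.
  apply: moments_unique => // k; have := munu k; rewrite /laplace.
  under eq_Rexp do rewrite -[k%:R]mulr1 -laplace_kernelX.
  by under [in X in _ = X -> _]eq_Rexp do rewrite -[k%:R]mulr1 -laplace_kernelX.
(* Stands for the image of B under x |-> exp(- x), written as a preimage to be measurable. *)
pose D := `]0, +oo[ `&` (fun y => - ln y) @^-1` B : set R.
have mD : measurable D.
  have mln : measurable_fun setT (fun y : R => - ln y) by exact: measurableT_comp.
  by apply: measurableI => //; exact: preimage_measurable.
have DB : laplace_kernel 1 @^-1` D `&` `[0, +oo[ = B `&` `[0, +oo[.
  have DE x : 0 <= x -> D (laplace_kernel 1 x) <-> B x.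
    move=> x0; rewrite /D /= in_itv/= expR_gt0/= /laplace_kernel expRK opprK mul1r.
    by rewrite max_l//; split => [[]|].
  by apply/seteqP; split => x /=; rewrite !in_itv/= !andbT => -[] /[swap] x0 /(DE _ x0).
have mkD : measurable (laplace_kernel 1 @^-1` D).
  exact: (preimage_measurable mk mD).
rewrite (nonneg_supportedI mB mu0) (nonneg_supportedI mB nu0) -DB.
rewrite -(nonneg_supportedI mkD mu0) -(nonneg_supportedI mkD nu0).
exact: H.
Qed.

End laplace.

(** * Uniqueness for characteristic functions *)

Section characteristic_function.
Variable R : realType.
Implicit Types mu nu : probability R R.

Lemma measurable_sin : measurable_fun setT (@sin R).
Proof. by apply: continuous_measurable_fun; exact: continuous_sin. Qed.

Lemma measurable_cos : measurable_fun setT (@cos R).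
Proof. by apply: continuous_measurable_fun; exact: continuous_cos. Qed.

Lemma bmf_sin u : bmf (fun x : R => sin (u * x)).
Proof.
split; last by exists 1 => x; exact: sin_max.
by apply: (measurableT_comp measurable_sin); exact: measurable_funM.
Qed.

Lemma bmf_cos u : bmf (fun x : R => cos (u * x)).
Proof.
split; last by exists 1 => x; exact: cos_max.
by apply: (measurableT_comp measurable_cos); exact: measurable_funM.
Qed.

(** This is the derivative of the sine at 0, taken along x / (n + 1). The case x = 0 is apart
    because difference quotients need nonzero steps. *)
Lemma cvg_sin_harmonic (x : R) : n.+1%:R * sin (n.+1%:R^-1 * x) @[n --> \oo] --> x.
Proof.
have [->|x0] := eqVneq x 0.
  by under eq_fun do rewrite mulr0 sin0 mulr0; exact: cvg_cst.
have [/= H1 H2] := is_derive_sin (0 : R).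
have /cvgr_dnbhsP H3 : (h^-1 *: (sin (h *: 1 + 0) - sin 0) @[h --> (0:R)^']) --> (1 : R).
  by rewrite -[X in _ --> X](@cos0 R) -H2; exact: H1.
have u0 : n.+1%:R^-1 * x @[n --> \oo] --> 0.
  by rewrite -[X in _ --> X](mul0r x); apply: cvgM; [exact: cvg_harmonic|exact: cvg_cst].
have un0 n : n.+1%:R^-1 * x != 0 by rewrite mulf_neq0// invr_neq0// pnatr_eq0.
have H4 := H3 (fun n => n.+1%:R^-1 * x) (conj un0 u0).
rewrite -[X in _ --> X]mul1r.
rewrite [X in X @ _ --> _](_ : _ = fun n : nat => (n.+1%:R^-1 * x)^-1 *:
    (sin ((n.+1%:R^-1 * x) *: 1 + 0) - sin 0) * x); last first.
  apply/funext => n; rewrite sin0 subr0 addr0 /GRing.scale/= mulr1; field.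
  by rewrite x0 addrC natr1 pnatr_eq0.
by apply: cvgM; [exact: H4|exact: cvg_cst].
Qed.

(* By the product formulas, the moments of [sin (v * x)] are determined; then let
   [v] tend to 0 in [sin (v * x) / v]. *)
Lemma char_unique mu nu :
  (forall u : R, \int[mu]_x cos (u * x) = \int[nu]_x cos (u * x)) ->
  (forall u : R, \int[mu]_x sin (u * x) = \int[nu]_x sin (u * x)) ->
  mu ≡μ nu.
Proof.
move=> mucos musin.
have sinX v k u :
    \int[mu]_x (sin (v * x) ^+ k * cos (u * x)) = \int[nu]_x (sin (v * x) ^+ k * cos (u * x)) /\
    \int[mu]_x (sin (v * x) ^+ k * sin (u * x)) = \int[nu]_x (sin (v * x) ^+ k * sin (u * x)).
  elim: k u => [|k IH] u.
    split.
      under eq_Rexp do rewrite expr0 mul1r.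
      by under [RHS]eq_Rexp do rewrite expr0 mul1r.
    under eq_Rexp do rewrite expr0 mul1r.
    by under [RHS]eq_Rexp do rewrite expr0 mul1r.
  have bs w : bmf (fun x => sin (v * x) ^+ k * sin (w * x)).
    by apply: bmfM; [apply: bmfX; exact: bmf_sin|exact: bmf_sin].
  have bc w : bmf (fun x => sin (v * x) ^+ k * cos (w * x)).
    by apply: bmfM; [apply: bmfX; exact: bmf_sin|exact: bmf_cos].
  have Ec (m : probability R R) : \int[m]_x (sin (v * x) ^+ k.+1 * cos (u * x)) =
      2^-1 * (\int[m]_x (sin (v * x) ^+ k * sin ((u + v) * x)) -
              \int[m]_x (sin (v * x) ^+ k * sin ((u - v) * x))).
    rewrite -RexpB// -RexpZl; last exact: bmfB.
    by apply: eq_Rexp => x; rewrite exprS [(u + v) * x]mulrDl [(u - v) * x]mulrBl sinD sinB; field.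
  have Es (m : probability R R) : \int[m]_x (sin (v * x) ^+ k.+1 * sin (u * x)) =
      2^-1 * (\int[m]_x (sin (v * x) ^+ k * cos ((u - v) * x)) -
              \int[m]_x (sin (v * x) ^+ k * cos ((u + v) * x))).
    rewrite -RexpB// -RexpZl; last exact: bmfB.
    by apply: eq_Rexp => x; rewrite exprS [(u + v) * x]mulrDl [(u - v) * x]mulrBl cosB cosD; field.
  by rewrite !Ec !Es !(IH _).1 !(IH _).2.
(* The moment problem is solved for values in [0, 1], hence the affine rescaling of the sine. *)
have sin01 (v x : R) : 0 <= (1 + sin (v * x)) / 2 <= 1.
  by have := sin_geN1 (v * x); have := sin_le1 (v * x); lra.
have bsin01 v : bmf (fun x : R => (1 + sin (v * x)) / 2).
  by apply: bmfM; [apply: bmfD; [exact: bmf_cst|exact: bmf_sin]|exact: bmf_cst].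
have munu v (f : R -> R) : bmf f ->
    \int[mu]_x f (v^-1 * sin (v * x)) = \int[nu]_x f (v^-1 * sin (v * x)).
  move=> bf.
  have mom k : \int[mu]_x ((1 + sin (v * x)) / 2) ^+ k = \int[nu]_x ((1 + sin (v * x)) / 2) ^+ k.
    pose p : {poly R} := ((1 + 'X) * (2^-1)%:P) ^+ k.
    have pE y : p.[y] = ((1 + y) / 2) ^+ k by rewrite /p horner_exp !hornerE.
    have H (m : probability R R) : \int[m]_x ((1 + sin (v * x)) / 2) ^+ k =
        \sum_(i < size p) p`_i * \int[m]_x (sin (v * x) ^+ i * cos (0 * x)).
      transitivity (\int[m]_x (cos (0 * x) * p.[sin (v * x)])).
        by apply: eq_Rexp => x; rewrite mul0r cos0 mul1r pE.
      rewrite Rexp_horner; [|exact: bmf_cos|exact: bmf_sin].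
      by apply: eq_bigr => i _; congr (_ * _); apply: eq_Rexp => x; rewrite mulrC.
    by rewrite !H; apply: eq_bigr => i _; rewrite (sinX _ _ _).1.
  pose g (y : R) := f (v^-1 * (2 * y - 1)).
  have bg : bmf g.
    apply: (bmf_comp bf); apply: measurable_funM => //; exact: measurable_funB.
  have := @moments_unique_Rexp _ _ _ _ _ mu nu _ _ (bsin01 v).1 (bsin01 v).1
    (sin01 v) (sin01 v) mom _ bg.
  have gE x : g ((1 + sin (v * x)) / 2) = f (v^-1 * sin (v * x)).
    by rewrite /g; congr (f (_ * _)); field.
  under eq_Rexp do rewrite gE.
  by under [in X in _ = X -> _]eq_Rexp do rewrite gE.
(* [g c m] is continuous, piecewise linear, and increases with m to the indicator of x < c.
   Continuity allows v to tend to 0 in sin (v x) / v for fixed m; only afterwards does m tend to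
   infinity. *)
pose g (c : R) (m : nat) (y : R) := Num.min 1 (Num.max 0 (m%:R * (c - y))) : R.
have mg c m : measurable_fun setT (g c m).
  apply: measurable_minr => //; apply: measurable_maxr => //.
  by apply: measurable_funM => //; exact: measurable_funB.
have g01 c m y : 0 <= g c m y <= 1.
  by rewrite /g ge_min lexx le_min ler01 le_max lexx.
have bg c m : bmf (g c m) by exact: bmf01.
have cg c m : continuous (g c m).
  move=> y; apply: (@continuous_min _ _ (fun=> 1) (fun y => Num.max 0 (m%:R * (c - y)))).
    exact: cvg_cst.
  apply: (@continuous_max _ _ (fun=> 0) (fun y => m%:R * (c - y))); first exact: cvg_cst.
  by apply: cvgM; [exact: cvg_cst|apply: cvgB; [exact: cvg_cst|exact: cvg_id]].
have gmunu c m : \int[mu]_x g c m x = \int[nu]_x g c m x.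
  have H (la : probability R R) :
      \int[la]_x g c m ((n.+1%:R^-1)^-1 * sin (n.+1%:R^-1 * x)) @[n --> \oo] --> \int[la]_x g c m x.
    apply: (@Rexp_cvg _ _ _ _ 1).
    - move=> n; apply: (measurableT_comp (mg c m)); apply: measurable_funM => //.
      by have [] := bmf_sin (n.+1%:R^-1).
    - by move=> n x; have /andP[? ?] := g01 c m (n.+1%:R^-1^-1 * sin (n.+1%:R^-1 * x)); rewrite ger0_norm.
    - move=> x; apply: (@cvg_comp _ _ _ (fun n : nat => n.+1%:R^-1^-1 * sin (n.+1%:R^-1 * x))
        (g c m) _ (nbhs x)); last exact: cg.
      by under eq_fun do rewrite invrK; exact: cvg_sin_harmonic.
  have Hmu := H mu; have Hnu := H nu.
  rewrite (funext (fun n => munu (n.+1%:R^-1) _ (bg c m))) in Hmu.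
  exact: (cvg_unique _ Hmu Hnu).
suff E c : mu `]-oo, c[%classic = nu `]-oo, c[%classic.
  apply: (@probability_eq_pi _ _ _ _ _ (@RGenInftyO.G R)).
  - exact: RGenInftyO.measurableE.
  - move=> _ _ [a ->] [b ->]; exists (Num.min a b).
    by apply/seteqP; split => x /=; rewrite !in_itv/= lt_min => /andP.
  - by move=> _ [c ->].
have H (la : probability R R) : \int[la]_x g c m x @[m --> \oo] --> \int[la]_x \1_(`]-oo, c[) x.
  apply: (@Rexp_cvg _ _ _ _ 1) => //.
    by move=> n x; have /andP[? ?] := g01 c n x; rewrite ger0_norm.
  move=> x; rewrite indicE; have [xc|cx] := ltP x c.
    rewrite mem_set/= ?in_itv//=; apply: cvg_near_cst; near=> n.
    have cx : 0 < c - x by rewrite subr_gt0.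
    have : (c - x)^-1 <= n%:R by near: n; exact: nbhs_infty_ger.
    rewrite -div1r ler_pdivrMr// => n1.
    by rewrite /g min_l// le_max n1 orbT.
  rewrite memNset/= ?in_itv//=; last by apply/negP; rewrite -leNgt.
  apply: cvg_near_cst; apply: nearW => n; rewrite /g.
  by rewrite max_l ?min_r ?ler01// mulr_ge0_le0// subr_le0.
have Hmu := H mu; have Hnu := H nu.
rewrite (funext (gmunu c)) in Hmu.
have : \int[mu]_x \1_(`]-oo, c[) x = \int[nu]_x \1_(`]-oo, c[) x.
  exact: (cvg_unique _ Hmu Hnu).
rewrite !Rexp_indic// => munuc.
by rewrite -[LHS]fineK ?fin_num_measure// munuc fineK// fin_num_measure.
Unshelve. all: by end_near. Qed.

End characteristic_function.

(** * The complex exponential series and the Poisson distribution *)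

Section complex_exponential_series.
Variables (R : realType) (a b : R).

(* Real and imaginary parts of the powers of [a + i b]. *)
Fixpoint cpow (n : nat) : R * R :=
  if n is n'.+1 then
    let: (c, s) := cpow n' in (a * c - b * s, b * c + a * s)
  else (1, 0).

Lemma cpow_bound n :
  `|(cpow n).1| <= (`|a| + `|b|) ^+ n /\ `|(cpow n).2| <= (`|a| + `|b|) ^+ n.
Proof.
elim: n => [|n /=]; first by rewrite /= normr1 normr0 expr0.
case: (cpow n) => c s /= [cn sn].
split; rewrite exprS mulrDl; [apply: le_trans (ler_normB _ _) _|
    apply: le_trans (ler_normD _ _) _]; rewrite !normrM.
  by rewrite lerD// ler_wpM2l.
by rewrite addrC lerD// ler_wpM2l.
Qed.

(** [F] and [G] are the real and imaginary parts of the truncated series of exp(z t), z = a + i b,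
    as polynomials in t. *)
Let F n : {poly R} := \sum_(k < n) ((cpow k).1 / k`!%:R) *: 'X^k.
Let G n : {poly R} := \sum_(k < n) ((cpow k).2 / k`!%:R) *: 'X^k.

Let deriv_term (c : nat -> R) n :
  ((c n.+1 / n.+1`!%:R) *: 'X^(n.+1) : {poly R})^`() = (c n.+1 / n`!%:R) *: 'X^n.
Proof.
rewrite derivZ derivXn -[_ *+ n.+1]scaler_nat scalerA factS natrM; congr (_ *: _).
by rewrite invfM [_^-1 * _]mulrC mulrA mulfVK// pnatr_eq0.
Qed.

(** In complex form: the derivative of the truncation at n + 1 is z times the truncation at n. *)
Let deriv_FG n : (F n.+1)^`() = a *: F n - b *: G n /\ (G n.+1)^`() = b *: F n + a *: G n.
Proof.
elim: n => [|n [IHF IHG]].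
  rewrite /F /G !big_ord1 !big_ord0 !derivZ !derivXn.
  by rewrite !mulr0n !scaler0 subr0 addr0.
have FS k : F k.+1 = F k + ((cpow k).1 / k`!%:R) *: 'X^k by rewrite /F big_ord_recr.
have GS k : G k.+1 = G k + ((cpow k).2 / k`!%:R) *: 'X^k by rewrite /G big_ord_recr.
rewrite (FS n.+1) (GS n.+1) !derivD IHF IHG (deriv_term (fun k => (cpow k).1))
  (deriv_term (fun k => (cpow k).2)) (FS n) (GS n) /=.
case: (cpow n) => c s /=.
split; rewrite !scalerDr !scalerA !mulrDl ?scalerDl ?scalerBl ?mulNr ?scaleNr !mulrA.
  by rewrite opprD; rewrite -!addrA; congr (_ + _); rewrite [RHS]addrCA.
by rewrite -!addrA; congr (_ + _); rewrite [RHS]addrCA.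
Qed.

Let hE := expR \o (fun t : R => - a * t).
Let hC := cos \o (fun t : R => b * t).
Let hS := sin \o (fun t : R => b * t).

Let is_derive_lin (c t : R) : is_derive t 1 (fun t : R => c * t) c.
Proof.
have := @is_deriveZ R R R (id : R -> R) c t 1 1 (is_derive_id t 1).
by rewrite /GRing.scale/= mulr1.
Qed.

Let dE (t : R) : is_derive t 1 hE (hE t * - a).
Proof. exact: is_derive1_comp (is_derive_expR _) (is_derive_lin _ _). Qed.

Let dC (t : R) : is_derive t 1 hC (- hS t * b).
Proof. exact: is_derive1_comp (is_derive_cos _) (is_derive_lin _ _). Qed.

Let dS (t : R) : is_derive t 1 hS (hC t * b).
Proof. exact: is_derive1_comp (is_derive_sin _) (is_derive_lin _ _). Qed.

Let dpoly (p : {poly R}) (t : R) : is_derive t 1 (horner p) (p^`()).[t].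
Proof. exact: is_derive_poly. Qed.

(* [U n t + i V n t] is [exp (- z t) * \sum_(k < n) (z t)^k / k!] for [z = a + i b],
   whose derivative [- exp (- z t) * z^n t^(n-1) / (n-1)!] is small on [0, 1]. *)
Let U n : R -> R := hE * (hC * horner (F n) + hS * horner (G n)).
Let V n : R -> R := hE * (hC * horner (G n) - hS * horner (F n)).

Let FGS n (t : R) : (F n.+1).[t] = (F n).[t] + (cpow n).1 / n`!%:R * t ^+ n /\
  (G n.+1).[t] = (G n).[t] + (cpow n).2 / n`!%:R * t ^+ n.
Proof. by rewrite /F /G !big_ord_recr/= !hornerD !hornerZ !hornerXn. Qed.

Let dU n (t : R) : is_derive t 1 (U n.+1)
  (- (hE t * (hC t * (cpow n.+1).1 + hS t * (cpow n.+1).2) * (t ^+ n / n`!%:R))).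
Proof.
apply: is_derive_eq.
rewrite (deriv_FG n).1 (deriv_FG n).2 !hornerD hornerN !hornerZ (FGS n t).1 (FGS n t).2.
rewrite !fctE (FGS n t).1 (FGS n t).2 /GRing.scale/= /hE /hC /hS/=.
by case: (cpow n) => c s /=; ring.
Qed.

Let dV n (t : R) : is_derive t 1 (V n.+1)
  (- (hE t * (hC t * (cpow n.+1).2 - hS t * (cpow n.+1).1) * (t ^+ n / n`!%:R))).
Proof.
apply: is_derive_eq.
rewrite (deriv_FG n).1 (deriv_FG n).2 !hornerD hornerN !hornerZ (FGS n t).1 (FGS n t).2.
rewrite !fctE (FGS n t).1 (FGS n t).2 /GRing.scale/= /hE /hC /hS/=.
by case: (cpow n) => c s /=; ring.
Qed.

(** Bounds the derivatives of [U n.+1] and [V n.+1] on [0, 1]: exp|a| comes from the factor exp(- a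
    t), and each of the two products contributes (|a| + |b|)^(n + 1). *)
Let bound n := expR `|a| * (2 * (`|a| + `|b|) ^+ n.+1) * n`!%:R^-1.

Let cvg_bound : bound n @[n --> \oo] --> 0.
Proof.
rewrite (_ : bound = fun n => expR `|a| * 2 * (`|a| + `|b|) * exp_coeff (`|a| + `|b|) n).
  rewrite -[X in _ --> X](mulr0 (expR `|a| * 2 * (`|a| + `|b|))).
  apply: cvgM; first exact: cvg_cst.
  by apply: cvg_series_cvg_0; exact: is_cvg_series_exp_coeff.
by apply/funext => n; rewrite /bound /exp_coeff/= exprS; ring.
Qed.

Let unit_bound (c s t : R) n : 0 <= t <= 1 -> `|c| <= (`|a| + `|b|) ^+ n.+1 ->
  `|s| <= (`|a| + `|b|) ^+ n.+1 ->
  `|- (hE t * (hC t * c + hS t * s) * (t ^+ n / n`!%:R))| <= bound n.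
Proof.
move=> /andP[t0 t1] cn sn; rewrite normrN normrM.
have tn : `|t ^+ n / n`!%:R| <= n`!%:R^-1.
  rewrite ger0_norm ?divr_ge0 ?exprn_ge0//.
  by rewrite ler_piMl ?invr_ge0// exprn_ile1.
apply: ler_pM => //; rewrite normrM; apply: ler_pM => //.
  rewrite /hE/= ger0_norm ?expR_ge0// ler_expR mulNr.
  by rewrite (le_trans (ler_norm _))// normrN normrM ler_piMr// ger0_norm.
apply: (le_trans (ler_normD _ _)); rewrite mulr_natl mulr2n !normrM lerD//.
  by rewrite (le_trans _ cn)// ler_piMl// cos_max.
by rewrite (le_trans _ sn)// ler_piMl// sin_max.
Qed.

Let mvt (f df : R -> R) M : (forall t : R, is_derive t 1 f (df t)) ->
  (forall t, 0 <= t <= 1 -> `|df t| <= M) -> `|f 0 - f 1| <= M.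
Proof.
move=> fdf dfM.
have [|t] := @MVT_segment R f df 0 1 ler01 (fun t _ => fdf t).
  apply: derivable_within_continuous => t _.
  by have [] := fdf t.
by rewrite in_itv/= subr0 mulr1 distrC => t01 ->; exact: dfM.
Qed.

(** U + i V equals 1 at time 0 and has a derivative that tends to 0 uniformly on [0, 1], so by the
    mean value theorem it tends to 1 at time 1. *)
Lemma cvg_cpow_series :
  \sum_(k < n) (cpow k).1 / k`!%:R @[n --> \oo] --> expR a * cos b /\
  \sum_(k < n) (cpow k).2 / k`!%:R @[n --> \oo] --> expR a * sin b.
Proof.
have F1 n : (F n).[1] = \sum_(k < n) (cpow k).1 / k`!%:R.
  by rewrite /F horner_sum; apply: eq_bigr => i _; rewrite hornerZ hornerXn expr1n mulr1.
have G1 n : (G n).[1] = \sum_(k < n) (cpow k).2 / k`!%:R.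
  by rewrite /G horner_sum; apply: eq_bigr => i _; rewrite hornerZ hornerXn expr1n mulr1.
have FG0 n : (F n.+1).[0] = 1 /\ (G n.+1).[0] = 0.
  elim: n => [|n [IHF IHG]]; rewrite (FGS _ _).1 (FGS _ _).2.
    by rewrite /F /G !big_ord0 !horner0/= !mul0r expr0 fact0 divr1 mulr1 !add0r.
  by rewrite IHF IHG expr0n/= !mulr0 !addr0.
have U0 n : U n.+1 0 = 1.
  by rewrite /U !fctE /hE /hC /hS/= !mulr0 expR0 cos0 sin0 (FG0 n).1 (FG0 n).2 !mul1r mul0r addr0.
have V0 n : V n.+1 0 = 0.
  by rewrite /V !fctE /hE /hC /hS/= !mulr0 expR0 cos0 sin0 (FG0 n).1 (FG0 n).2 !mul1r mul0r subr0.
have cU : U n.+1 1 @[n --> \oo] --> (1 : R).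
  apply/cvgrPdist_le => e e0.
  near=> n; have : `|U n.+1 0 - U n.+1 1| <= bound n.
    apply: (mvt (dU n)) => t t01.
    by apply: unit_bound => //; have [] := cpow_bound n.+1.
  rewrite U0 => /le_trans; apply; rewrite (le_trans (ler_norm _))// -[bound n]subr0 distrC.
  by near: n; move/cvgrPdist_le : cvg_bound; exact.
have cV : V n.+1 1 @[n --> \oo] --> (0 : R).
  apply/cvgrPdist_le => e e0.
  near=> n; have : `|V n.+1 0 - V n.+1 1| <= bound n.
    apply: (mvt (dV n)) => t t01.
    rewrite -(mulrN (hS t)); apply: unit_bound => //.
      by have [] := cpow_bound n.+1.
    by rewrite normrN; have [] := cpow_bound n.+1.
  rewrite V0 => /le_trans; apply; rewrite (le_trans (ler_norm _))// -[bound n]subr0 distrC.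
  by near: n; move/cvgrPdist_le : cvg_bound; exact.
have E1 : expR a * expR (- a) = 1 by rewrite expRN mulfV// gt_eqF// expR_gt0.
(* Multiplying by exp(z) inverts the definition of U and V: F + i G = exp(z) (U + i V) at time 1. *)
have Fn n : (F n).[1] = expR a * (cos b * U n 1 - sin b * V n 1).
  rewrite /U /V !fctE /hE /hC /hS/= !mulr1.
  rewrite [RHS](_ : _ = expR a * expR (- a) * (cos b ^+ 2 + sin b ^+ 2) * (F n).[1]).
    by rewrite E1 cos2Dsin2 !mul1r.
  ring.
have Gn n : (G n).[1] = expR a * (cos b * V n 1 + sin b * U n 1).
  rewrite /U /V !fctE /hE /hC /hS/= !mulr1.
  rewrite [RHS](_ : _ = expR a * expR (- a) * (cos b ^+ 2 + sin b ^+ 2) * (G n).[1]).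
    by rewrite E1 cos2Dsin2 !mul1r.
  ring.
split; rewrite -cvg_shiftS/=.
  under eq_fun do rewrite -F1 Fn.
  apply: cvgM; first exact: cvg_cst.
  rewrite [X in _ --> X](_ : _ = cos b * 1 - sin b * 0); last by rewrite mulr0 subr0 mulr1.
  by apply: cvgB; apply: cvgM => //; exact: cvg_cst.
under eq_fun do rewrite -G1 Gn.
apply: cvgM; first exact: cvg_cst.
rewrite [X in _ --> X](_ : _ = cos b * 0 + sin b * 1); last by rewrite mulr0 add0r mulr1.
by apply: cvgD; apply: cvgM => //; exact: cvg_cst.
Unshelve. all: by end_near. Qed.

End complex_exponential_series.

Section poisson_expectation.
Variable R : realType.

(** The rate is 1 because the Lévy measure in [LISPP] is mu itself, of total mass 1: this is the
    number of jumps in a unit of time. *)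
Definition poisson1 : probability nat R := poisson_prob (1 : R) 0.

Lemma poisson1_set1 (k : nat) : fine (poisson1 [set k]) = expR (- 1) / k`!%:R.
Proof.
rewrite /poisson1/= /poisson_prob ltr01 esum_set1 ?lee_fin ?poisson_pmf_ge0//=.
by rewrite /poisson_pmf ltr01 expr1n mul1r mulrC.
Qed.

Lemma bmf_nat (f : nat -> R) M : (forall n, `|f n| <= M) -> bmf f.
Proof. by move=> fM; split => //; exists M. Qed.

Lemma cvg_poisson1 (f : nat -> R) M : (forall n, `|f n| <= M) ->
  \sum_(k < n) expR (- 1) * (f k / k`!%:R) @[n --> \oo] --> \int[poisson1]_k f k.
Proof.
move=> fM.
have bf := bmf_nat fM.
pose h (k j : nat) : R := f k * \1_[set k] j.
have b1 k : bmf (h k).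
  by apply: bmfM; [exact: bmf_cst|exact: bmf_indic].
have sE n j : \sum_(k < n) h k j = if (j < n)%N then f j else 0.
  elim: n => [|n IH]; first by rewrite big_ord0.
  rewrite big_ord_recr/= IH /h indicE ltnS.
  have [jn|nj|->] := ltngtP j n.
  - by rewrite memNset ?mulr0 ?addr0// => /= jn'; rewrite jn' ltnn in jn.
  - by rewrite memNset ?mulr0 ?addr0// => /= jn'; rewrite jn' ltnn in nj.
  - by rewrite mem_set// mulr1 add0r.
rewrite [X in X @ _ --> _](_ : _ = fun n => \int[poisson1]_j \sum_(k < n) h k j).
  apply: (@Rexp_cvg _ _ _ _ M).
  - by move=> n; have [] := bmf_sum n b1.
  - move=> n j; rewrite sE; case: ifP => // _; rewrite normr0.
    exact: le_trans (fM 0%N).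
  - move=> j; apply: cvg_near_cst; near=> n; rewrite sE ifT//.
    by near: n; exists j.+1.
apply/funext => n; rewrite (Rexp_sum poisson1 n b1); apply: eq_bigr => k _.
rewrite /h RexpZl; last exact: bmf_indic.
by rewrite Rexp_indic// poisson1_set1; ring.
Unshelve. all: by end_near. Qed.

Lemma Rexp_poisson1_expr (x : R) : 0 <= x <= 1 ->
  \int[poisson1]_k x ^+ k = expR (x - 1).
Proof.
move=> /andP[x0 x1].
have xM n : `|x ^+ n| <= 1 by rewrite ger0_norm ?exprn_ge0// exprn_ile1.
suff H : \sum_(k < n) expR (- 1) * (x ^+ k / k`!%:R) @[n --> \oo] --> expR (x - 1).
  exact: (cvg_unique _ (cvg_poisson1 xM) H).
rewrite addrC expRD; under eq_fun do rewrite -mulr_sumr.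
apply: cvgM; first exact: cvg_cst.
rewrite (_ : (fun n => _) = series (exp_coeff x)); last first.
  by apply/funext => n; rewrite /series/= big_mkord.
have := is_cvg_series_exp_coeff x.
by rewrite expRE /pseries -exp_coeffE.
Qed.

(** The generating function exp(z - 1) of the Poisson law at the complex point z = a + i b. *)
Lemma Rexp_poisson1_cpow (a b M : R) : (forall n, `|(cpow a b n).1| <= M) ->
  (forall n, `|(cpow a b n).2| <= M) ->
  \int[poisson1]_k (cpow a b k).1 = expR (a - 1) * cos b /\
  \int[poisson1]_k (cpow a b k).2 = expR (a - 1) * sin b.
Proof.
move=> c1 c2; have [H1 H2] := cvg_cpow_series a b.
split.
  suff H : \sum_(k < n) expR (- 1) * ((cpow a b k).1 / k`!%:R) @[n --> \oo] -->
      expR (a - 1) * cos b by exact: (cvg_unique _ (cvg_poisson1 c1) H).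
  rewrite addrC expRD -mulrA; under eq_fun do rewrite -mulr_sumr.
  by apply: cvgM; first exact: cvg_cst.
suff H : \sum_(k < n) expR (- 1) * ((cpow a b k).2 / k`!%:R) @[n --> \oo] -->
    expR (a - 1) * sin b by exact: (cvg_unique _ (cvg_poisson1 c2) H).
rewrite addrC expRD -mulrA; under eq_fun do rewrite -mulr_sumr.
by apply: cvgM; first exact: cvg_cst.
Qed.

End poisson_expectation.

(** * The compound Poisson process *)

Section uniform.
Variable R : realType.

Lemma measurable_id_measurableTypeR :
  measurable_fun setT (id : measurableTypeR R -> R).
Proof. by move=> _ B mB; rewrite setTI. Qed.

Definition unif : probability R R :=
  law (uniform_prob (@ltr01 R)) measurable_id_measurableTypeR.

Definition clamp (x : R) : R := Num.max 0 (Num.min 1 x).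

Lemma unif_itv (c : R) : c <= 1 -> fine (unif `[0, c[%classic) = Num.max 0 c.
Proof.
move=> c1; rewrite [unif _](_ : _ =
  (\int[lebesgue_measure]_(x in `[0%R, c[) (uniform_pdf 0 1 x)%:E)%E)//.
have -> : (\int[lebesgue_measure]_(x in `[0%R, c[) (uniform_pdf 0 1 x)%:E =
    \int[lebesgue_measure]_(x in `[0%R, c[) (cst 1%:E x))%E.
  apply: eq_integral => x; rewrite inE/= in_itv/= => /andP[x0 xc].
  by rewrite /uniform_pdf x0 (le_trans (ltW xc))// subr0 invr1.
rewrite integral_cst//= mul1e lebesgue_measure_itv/= lte_fin.
by case: ltP => c0 //=; rewrite oppr0 addr0.
Qed.

End uniform.

Section blocks.
Context d (T : measurableType d) (R : realType).
Local Notation Om := (gprod nat T).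

Lemma measurable_nat_prod d' (S : measurableType d') d'' (S' : measurableType d'')
    (f : nat * S -> S') :
  (forall n, measurable_fun setT (fun x => f (n, x))) -> measurable_fun setT f.
Proof.
move=> mf _ B mB; rewrite setTI.
rewrite (_ : f @^-1` B = \bigcup_n ([set n] `*` ((fun x => f (n, x)) @^-1` B))).
  apply: bigcupT_measurable => n; apply: measurableX => //.
  by rewrite -[X in measurable X]setTI; exact: mf.
apply/seteqP; split => [[n x] /= Bx|[m x] /= [n _ /= [-> //]]].
by exists n.
Qed.

(** A block describes the jumps in one unit of time: their number and an infinite supply of marks,
    of which only that many are used. Count and marks can thus be independent under a plain product
    law. *)
Definition block_sum (phi : T -> R) (w : nat * Om) : R := \sum_(i < w.1) phi (w.2 i).

Lemma measurable_block_sum (phi : T -> R) : measurable_fun setT phi ->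
  measurable_fun setT (block_sum phi).
Proof.
move=> mphi; apply: measurable_nat_prod => n; rewrite /block_sum/=.
elim: n => [|n IH]; first by under eq_fun do rewrite big_ord0; exact: measurable_cst.
under eq_fun do rewrite big_ord_recr/=; apply: measurable_funD => //.
by apply: (measurableT_comp mphi); exact: measurable_gcoord.
Qed.

Definition block_prob (P : probability T R) : probability (nat * Om)%type R :=
  pprod (poisson1 R) (power_prob P).

Lemma Rexp_block (P : probability T R) (f : nat * Om -> R) : bmf f ->
  \int[block_prob P]_w f w = \int[poisson1 R]_n \int[power_prob P]_x f (n, x).
Proof. by move=> bf; rewrite Rexp_pprod. Qed.

(** Given the count n the expectation is q^n, where q is the integral of exp(- phi); averaging over
    n gives the Poisson generating function at q. *)
Lemma Rexp_block_laplace (P : probability T R) (phi : T -> R) : measurable_fun setT phi ->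
  (forall x, 0 <= phi x) ->
  \int[block_prob P]_w expR (- block_sum phi w) = expR (\int[P]_x expR (- phi x) - 1).
Proof.
move=> mphi phi0.
have b1 : bmf (fun x => expR (- phi x)).
  apply: bmf01; first by apply: measurableT_comp => //; exact: measurableT_comp.
  by move=> x; rewrite expR_ge0/= expR_le1 oppr_le0.
rewrite Rexp_block.
  rewrite -Rexp_poisson1_expr.
    apply: eq_Rexp => n.
    rewrite -[n in RHS]card_ord -prodr_const -(Rexp_power_prod P n (fun=> b1)).
    by apply: eq_Rexp => x; rewrite /block_sum/= -sumrN expR_sum.
  by apply: Rexp01 => [|x]; [exact: b1.1|rewrite expR_ge0/= expR_le1 oppr_le0].
apply: bmf01.
  apply: measurableT_comp => //; apply: measurableT_comp => //.
  exact: measurable_block_sum.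
by move=> w; rewrite expR_ge0/= expR_le1 oppr_le0 sumr_ge0.
Qed.

(** The same conditioning with exp(i phi): given the count n the expectation is z^n for z = a + i b,
    computed by the addition formulas. *)
Lemma Rexp_block_trig (P : probability T R) (phi : T -> R) : measurable_fun setT phi ->
  let a := \int[P]_x cos (phi x) in let b := \int[P]_x sin (phi x) in
  \int[block_prob P]_w cos (block_sum phi w) = expR (a - 1) * cos b /\
  \int[block_prob P]_w sin (block_sum phi w) = expR (a - 1) * sin b.
Proof.
move=> mphi a b.
have bcos d' (S : measurableType d') (f : S -> R) : measurable_fun setT f -> bmf (fun x => cos (f x)).
  move=> mf; split; last by exists 1 => x; exact: cos_max.
  exact: (measurableT_comp (@measurable_cos R)).
have bsin d' (S : measurableType d') (f : S -> R) : measurable_fun setT f -> bmf (fun x => sin (f x)).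
  move=> mf; split; last by exists 1 => x; exact: sin_max.
  exact: (measurableT_comp (@measurable_sin R)).
have mblock n : measurable_fun setT ((fun x => block_sum phi (n, x)) : Om -> R).
  apply: (measurableT_comp (measurable_block_sum mphi)); exact: pair1_measurable.
have blockS n y x : block_sum phi (n.+1, scons y x) = phi y + block_sum phi (n, x).
  by rewrite /block_sum/= big_ord_recl.
have E n : \int[power_prob P]_x cos (block_sum phi (n, x)) = (cpow a b n).1 /\
    \int[power_prob P]_x sin (block_sum phi (n, x)) = (cpow a b n).2.
  elim: n => [|n [IHc IHs]].
    have b0 x : block_sum phi (0%N, x) = 0 by rewrite /block_sum big_ord0.
    under eq_Rexp do rewrite b0 cos0.
    under [X in _ /\ X = _]eq_Rexp do rewrite b0 sin0.
    by rewrite !Rexp_cst.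
  rewrite Rexp_power_scons; last exact: bcos.
  rewrite [X in _ /\ X = _]Rexp_power_scons; last exact: bsin.
  rewrite /=; move: IHc IHs; case: (cpow a b n) => c s /= IHc IHs; split.
    transitivity (\int[P]_y (cos (phi y) * c - sin (phi y) * s)).
      apply: eq_Rexp => y; under eq_Rexp do rewrite blockS cosD.
      rewrite RexpB; try (by apply: bmfM; [exact: bmf_cst|by [exact: bcos|exact: bsin]]).
      by rewrite !RexpZl ?IHc ?IHs//; [exact: bsin|exact: bcos].
    rewrite RexpB; try (by apply: bmfM; [by [exact: bcos|exact: bsin]|exact: bmf_cst]).
    by rewrite !RexpZr//; [exact: bsin|exact: bcos].
  transitivity (\int[P]_y (sin (phi y) * c + cos (phi y) * s)).
    apply: eq_Rexp => y; under eq_Rexp do rewrite blockS sinD.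
    rewrite RexpD; try (by apply: bmfM; [exact: bmf_cst|by [exact: bcos|exact: bsin]]).
    by rewrite !RexpZl ?IHc ?IHs//; [exact: bsin|exact: bcos].
  rewrite RexpD; try (by apply: bmfM; [by [exact: bcos|exact: bsin]|exact: bmf_cst]).
  by rewrite !RexpZr//; [exact: bcos|exact: bsin].
have Rexp_le1 (f : Om -> R) : bmf f -> (forall x, `|f x| <= 1) -> `|\int[power_prob P]_x f x| <= 1.
  move=> bf f1; rewrite ler_norml -[X in X <= _ <= _](Rexp_cst (power_prob P)).
  rewrite -[X in _ <= _ <= X](Rexp_cst (power_prob P)) !le_Rexp//; try exact: bmf_cst.
    by move=> x; have := f1 x; rewrite ler_norml => /andP[].
  by move=> x; have := f1 x; rewrite ler_norml => /andP[].
(* The real and imaginary parts of z^n are bounded by 1, being expectations of cosines and sines. *)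
have [Hc Hs] : \int[poisson1 R]_k (cpow a b k).1 = expR (a - 1) * cos b /\
    \int[poisson1 R]_k (cpow a b k).2 = expR (a - 1) * sin b.
  apply: (@Rexp_poisson1_cpow _ _ _ 1) => n.
    by rewrite -(E n).1; apply: Rexp_le1 => [|x]; [exact: bcos|exact: cos_max].
  by rewrite -(E n).2; apply: Rexp_le1 => [|x]; [exact: bsin|exact: sin_max].
rewrite -Hc -Hs; split.
  rewrite Rexp_block; first by apply: eq_Rexp => n; rewrite (E n).1.
  exact: bcos (measurable_block_sum mphi).
rewrite Rexp_block; first by apply: eq_Rexp => n; rewrite (E n).2.
exact: bsin (measurable_block_sum mphi).
Qed.

Lemma measurable_block_prob : measurable_fun setT
  (fun P : pprobability T R => block_prob P : pprobability (nat * Om)%type R).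
Proof.
apply: (@measurableT_comp _ _ _ (pprobability T R) (pprobability Om R)
  (pprobability (nat * Om)%type R)
  (fun Q : pprobability Om R => pprod (poisson1 R) Q) setT
  (fun Q : pprobability T R => power_prob Q)).
  exact: measurable_pprod.
exact: measurable_power_prob.
Qed.

End blocks.

(** * The process on the half-line and the Laplace transform of its increments *)

Section compound_poisson.
Variable R : realType.
Implicit Types (mu : probability R R) (s t : R) (k : nat).

(* The points of the process in the time interval [k, k + 1[ sit at the times
   [k + v] for uniform [v]. *)
Definition window k t : set R := `[0, Num.min 1 (t - k%:R)[%classic.

Lemma windowP k t v : (v \in window k t) = (0 <= v) && (v < 1) && (k%:R + v < t).
Proof.
rewrite /window; apply/idP/idP; rewrite inE/= in_itv/= lt_min ltrBrDl.
  by move=> /andP[-> /andP[-> ->]].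
by move=> /andP[/andP[-> ->] ->].
Qed.

Lemma window_sub k s t v : s <= t -> v \in window k s -> v \in window k t.
Proof. by rewrite !windowP => st /andP[-> /= /lt_le_trans]; exact. Qed.

Lemma Rexp_window k t : \int[unif R]_v \1_(window k t) v = clamp (t - k%:R).
Proof.
rewrite Rexp_indic ?/window//.
transitivity (fine (unif R `[0, Num.min 1 (t - k%:R)[%classic)) => //.
by rewrite unif_itv ?ge_min ?lexx.
Qed.

(** A point of block k with position [p.1] contributes its jump [p.2] once k + [p.1] < t. Truncating
    jumps at 0 makes every path nondecreasing, whatever mu is. *)
Definition mark k t (p : R * R) : R := \1_(window k t) p.1 * Num.max p.2 0.

Lemma measurable_mark k t : measurable_fun setT (mark k t).
Proof.
apply: measurable_funM; last by apply: measurable_maxr => //; exact: measurable_snd.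
have mw : measurable_fun setT (fun v : R => \1_(window k t) v : R).
  by apply: measurable_indic; rewrite /window.
exact: (measurableT_comp mw).
Qed.

Lemma mark_le k s t p : s <= t -> mark k s p <= mark k t p.
Proof.
move=> st; rewrite /mark ler_wpM2r ?le_max ?lexx ?orbT// !indicE ler_nat.
by case: (boolP (p.1 \in window k s)) => // /(window_sub st) ->.
Qed.

Local Notation blockT := (nat * gprod nat (R * R)%type)%type.
Local Notation Om := (gprod nat blockT).

Definition cp t (w : Om) : R :=
  \sum_(k < (Num.truncn t).+1) block_sum (mark k t) (w k).

Definition cp_prob mu : probability Om R :=
  power_prob (block_prob (pprod (unif R) mu)).

Lemma measurable_cp t : measurable_fun setT (cp t).
Proof.
rewrite /cp; elim: (Num.truncn t).+1 => [|n IH].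
  by under eq_fun do rewrite big_ord0; exact: measurable_cst.
under eq_fun do rewrite big_ord_recr/=; apply: measurable_funD => //.
apply: (measurableT_comp (measurable_block_sum (measurable_mark n t))).
exact: measurable_gcoord.
Qed.

Lemma block_sum_out k t (w : blockT) : t <= k%:R -> block_sum (mark k t) w = 0.
Proof.
move=> tk; rewrite /block_sum big1// => i _; rewrite /mark indicE windowP.
case: (boolP (_ && _)) => [|_]; last by rewrite mul0r.
by move=> /andP[/andP[v0 _]]; rewrite ltNge (le_trans tk)// lerDl.
Qed.

(** Blocks with k >= t contribute nothing, so several times can be treated with one common number of
    blocks. *)
Lemma cpE K t w : t <= K%:R -> cp t w = \sum_(k < K) block_sum (mark k t) (w k).
Proof.
move=> tK; rewrite /cp.
have [n nK] : exists n, (maxn (Num.truncn t).+1 K = n)%N by eexists.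
have H m : (m <= n)%N -> t <= m%:R -> \sum_(k < m) block_sum (mark k t) (w k) =
    \sum_(k < n) block_sum (mark k t) (w k).
  move=> mn tm; rewrite -!(big_mkord xpredT (fun k => block_sum (mark k t) (w k))).
  rewrite [RHS](big_cat_nat (n := m))//= [X in _ + X]big_nat_cond [X in _ + X]big1 ?addr0//.
  move=> k /andP[/andP[mk _] _].
  by rewrite block_sum_out// (le_trans tm)// ler_nat.
rewrite (H (Num.truncn t).+1) ?(H K)// -?nK ?leq_maxl ?leq_maxr//.
by rewrite ltW// truncnS_gt.
Qed.

Lemma cp_le s t w : s <= t -> cp s w <= cp t w.
Proof.
move=> st; have [K tK] : exists K, t <= K%:R.
  by exists (Num.truncn t).+1; rewrite ltW// truncnS_gt.
rewrite !(@cpE K)// ?(le_trans st)//; apply: ler_sum => k _.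
by apply: ler_sum => i _; exact: mark_le.
Qed.

Lemma cp0 w : cp 0 w = 0.
Proof. by rewrite (@cpE 0)// big_ord0. Qed.

(** [clamp (t - k)] is the length of the part of [k, k + 1] below t. *)
Lemma sum_clamp K t : 0 <= t <= K%:R -> \sum_(k < K) clamp (t - k%:R) = t.
Proof.
elim: K t => [|K IH] t /andP[t0 tK].
  by rewrite big_ord0; apply/eqP; rewrite eq_le t0.
rewrite big_ord_recl/= subr0.
have [t1|t1] := leP t 1.
  rewrite big1 ?addr0 /clamp ?min_r ?max_r// => i _.
  rewrite min_r ?max_l// ?lerBlDr; last by rewrite (le_trans t1)// lerDl.
  by rewrite add0r (le_trans t1)// ler1n.
rewrite -[RHS](subrK 1) addrC; congr (_ + _).
  rewrite -[RHS]IH; last by rewrite subr_ge0 (ltW t1) lerBlDr natr1.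
  by apply: eq_bigr => i _; rewrite -addrA -opprD nat1r.
by rewrite /clamp min_l ?(ltW t1)// max_r.
Qed.

Section increments.
Variables (mu : probability R R) (t : nat -> R).
Hypothesis t0 : forall i, 0 <= t i.
Hypothesis tle : forall i j, (i <= j)%N -> t i <= t j.

Definition incr i (w : Om) : R := cp (t i.+1) w - cp (t i) w.

Variables (n : nat) (lam : nat -> R).
Hypothesis lam0 : forall i, 0 <= lam i.

(** The contribution of one point of block k to the sum of the [lam i * incr i]. *)
Let phi k (p : R * R) : R :=
  \sum_(i < n) lam i * (mark k (t i.+1) p - mark k (t i) p).

Let measurable_phi k : measurable_fun setT (phi k).
Proof.
rewrite /phi; elim: n => [|m IH].
  by under eq_fun do rewrite big_ord0; exact: measurable_cst.
under eq_fun do rewrite big_ord_recr/=; apply: measurable_funD => //.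
by apply: measurable_funM => //; apply: measurable_funB; exact: measurable_mark.
Qed.

Let phi_ge0 k p : 0 <= phi k p.
Proof.
by apply: sumr_ge0 => i _; rewrite mulr_ge0// subr_ge0 mark_le// tle.
Qed.

(* At most one term of the sum defining [phi k (v, x)] is nonzero. *)
Let expR_phi k v x : expR (- phi k (v, x)) = 1 + \sum_(i < n)
  (\1_(window k (t i.+1)) v - \1_(window k (t i)) v) * (laplace_kernel (lam i) x - 1).
Proof.
rewrite /phi.
(* The second conjunct keeps track of a point that has not arrived by time [t m]: it has contributed
   nothing so far, so the next term may be added on both sides. *)
have H m : expR (- \sum_(i < m) lam i * (mark k (t i.+1) (v, x) - mark k (t i) (v, x))) =
   1 + \sum_(i < m) (\1_(window k (t i.+1)) v - \1_(window k (t i)) v) *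
     (laplace_kernel (lam i) x - 1) /\ (v \notin window k (t m) ->
   \sum_(i < m) lam i * (mark k (t i.+1) (v, x) - mark k (t i) (v, x)) = 0 /\
   \sum_(i < m) (\1_(window k (t i.+1)) v - \1_(window k (t i)) v) *
     (laplace_kernel (lam i) x - 1) = 0).
  elim: m => [|m [IH1 IH2]]; first by rewrite !big_ord0 oppr0 expR0 addr0.
  rewrite !big_ord_recr/= /mark/= !indicE.
  have [vm|vm] := boolP (v \in window k (t m)).
    have -> : v \in window k (t m.+1) by apply: window_sub vm; exact: tle.
    by rewrite !mul1r !subrr mulr0 mul0r !addr0.
  have [S1 S2] := IH2 vm; rewrite {1}S1 {1}S2 !add0r.
  have [vm1|vm1] := boolP (v \in window k (t m.+1)).
    by rewrite !mul1r !mul0r !subr0 !mul1r [1 + _]addrC subrK.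
  by rewrite !mul0r !subrr mulr0 mul0r oppr0 expR0 !addr0.
exact: (H n).1.
Qed.

Let Rexp_phi k : \int[pprod (unif R) mu]_p expR (- phi k p) - 1 =
  \sum_(i < n) (clamp (t i.+1 - k%:R) - clamp (t i - k%:R)) * (laplace mu (lam i) - 1).
Proof.
have bw i : bmf (fun v : R => \1_(window k (t i)) v : R).
  by apply: bmf_indic; rewrite /window.
have bl i : bmf (fun x => laplace_kernel (lam i) x - 1).
  by apply: bmfB; [exact: bmf_laplace_kernel|exact: bmf_cst].
rewrite Rexp_pprod; last first.
  apply: bmf01 => [|p]; last by rewrite expR_ge0/= expR_le1 oppr_le0.
  by apply: measurableT_comp => //; exact: measurableT_comp.
transitivity (\int[unif R]_v (1 + \sum_(i < n)
    (\1_(window k (t i.+1)) v - \1_(window k (t i)) v) * (laplace mu (lam i) - 1)) - 1).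
  congr (_ - _); apply: eq_Rexp => v.
  under eq_Rexp do rewrite expR_phi.
  have bi i : bmf (fun x => (\1_(window k (t i.+1)) v - \1_(window k (t i)) v) *
      (laplace_kernel (lam i) x - 1)) by apply: bmfM => //; exact: bmf_cst.
  rewrite RexpD; [|exact: bmf_cst|exact: (bmf_sum n bi)].
  rewrite Rexp_cst (Rexp_sum mu n bi); congr (_ + _); apply: eq_bigr => i _.
  rewrite RexpZl// RexpB; [|exact: bmf_laplace_kernel|exact: bmf_cst].
  by rewrite Rexp_cst.
have bi i : bmf (fun v => (\1_(window k (t i.+1)) v - \1_(window k (t i)) v) *
    (laplace mu (lam i) - 1)) by apply: bmfM; [exact: bmfB|exact: bmf_cst].
rewrite RexpD; [|exact: bmf_cst|exact: (bmf_sum n bi)].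
rewrite Rexp_cst addrAC subrr add0r (Rexp_sum _ n bi); apply: eq_bigr => i _.
by rewrite RexpZr ?RexpB ?Rexp_window//; exact: bmfB.
Qed.

(** The exponent splits into independent block sums of [phi k], each given by [Rexp_block_laplace];
    summed over the blocks, the clamped lengths add up to [t i.+1 - t i]. Stationarity, independence
    and continuity of the increments all follow from this formula. *)
Lemma laplace_increments :
  \int[cp_prob mu]_w (\prod_(i < n) expR (- (lam i * incr i w))) =
  \prod_(i < n) expR ((t i.+1 - t i) * (laplace mu (lam i) - 1)).
Proof.
have [K tK] : exists K, t n <= K%:R.
  by exists (Num.truncn (t n)).+1; rewrite ltW// truncnS_gt.
have tK' i : (i <= n)%N -> t i <= K%:R by move=> /tle /le_trans; exact.
transitivity (\int[cp_prob mu]_w (\prod_(k < K) expR (- block_sum (phi k) (w k)))).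
  apply: eq_Rexp => w; rewrite -!expR_sum; congr expR; rewrite !sumrN; congr (- _).
  transitivity (\sum_(i < n) \sum_(k < K) lam i *
      (block_sum (mark k (t i.+1)) (w k) - block_sum (mark k (t i)) (w k))).
    apply: eq_bigr => i _; rewrite /incr !(@cpE K) ?tK'// 1?ltnW//.
    by rewrite -sumrB mulr_sumr.
  rewrite exchange_big/=; apply: eq_bigr => k _.
  rewrite /block_sum exchange_big/=; apply: eq_bigr => i _.
  by rewrite -sumrB mulr_sumr.
rewrite (Rexp_power_prod _ K (g := fun k b => expR (- block_sum (phi k) b))).
  transitivity (\prod_(k < K) expR (\int[pprod (unif R) mu]_p expR (- phi k p) - 1)).
    by apply: eq_bigr => k _; rewrite Rexp_block_laplace.
  rewrite -!expR_sum; congr expR.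
  under eq_bigr do rewrite Rexp_phi.
  rewrite exchange_big/=; apply: eq_bigr => i _.
  by rewrite -mulr_suml sumrB !sum_clamp// t0/= tK'// ltnW.
move=> k; apply: bmf01 => [|b].
  apply: measurableT_comp => //; apply: measurableT_comp => //.
  exact: measurable_block_sum.
by rewrite expR_ge0/= expR_le1 oppr_le0 sumr_ge0.
Qed.

End increments.

End compound_poisson.

Section independence.
Context d (T : measurableType d) (R : realType) (P : probability T R).

(** The Y i are compared with independent copies of themselves, realised as [Y i (x i)] under the
    infinite power of P; both families have the same joint moments. *)
Lemma independent_of_moments (Y : nat -> T -> R) n :
  (forall i, measurable_fun setT (Y i)) -> (forall i x, 0 <= Y i x <= 1) ->
  (forall k : nat -> nat, \int[P]_x (\prod_(i < n) Y i x ^+ k i) =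
                          \prod_(i < n) \int[P]_x Y i x ^+ k i) ->
  forall B : nat -> set R, (forall i, measurable (B i)) ->
  P [set x | forall i, (i < n)%N -> B i (Y i x)] =
  (\prod_(i < n) P [set x | B i (Y i x)])%E.
Proof.
move=> mY Y01 EY B mB.
have mYi i : measurable_fun setT ((fun x => Y i (x i)) : gprod nat T -> R).
  by apply: (measurableT_comp (mY i)); exact: measurable_gcoord.
have := @joint_moments_unique _ _ _ _ _ P (power_prob P) Y (fun i x => Y i (x i))
  mY mYi Y01 (fun i x => Y01 i (x i)) n _ B mB.
move=> ->.
  rewrite (power_prob_rect P n (B := fun i => Y i @^-1` B i))// => i.
  by rewrite -[X in measurable X]setTI; exact: mY.
move=> k; rewrite EY (Rexp_power_prod P n (g := fun i x => Y i x ^+ k i))// => i.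
by apply: bmfX; exact: bmf01.
Qed.

End independence.

(** * Lévy properties of the compound Poisson process *)

Section levy_compound_poisson.
Variables (R : realType) (mu : probability R R).
Local Notation blockT := (nat * gprod nat (R * R)%type)%type.
Local Notation Om := (gprod nat blockT).
Implicit Types (s t : R) (n : nat).

Lemma laplace_increment s t lam : 0 <= s <= t -> 0 <= lam ->
  \int[cp_prob mu]_w expR (- (lam * (cp t w - cp s w))) =
  expR ((t - s) * (laplace mu lam - 1)).
Proof.
move=> /andP[s0 st] lam0.
pose u i := if i is 0%N then s else t.
have u0 i : 0 <= u i by case: i => //=; rewrite (le_trans s0).
have ule i j : (i <= j)%N -> u i <= u j by case: i j => [|i] [|j].
have := laplace_increments mu u0 ule 1 (lam := fun=> lam) (fun=> lam0).
rewrite big_ord1/= => <-; apply: eq_Rexp => w; by rewrite big_ord1.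
Qed.

Lemma exp_incr01 s t (w : Om) : s <= t -> 0 <= expR (- (cp t w - cp s w)) <= 1.
Proof. by move=> st; rewrite expR_ge0/= expR_le1 oppr_le0 subr_ge0 cp_le. Qed.

Lemma measurable_exp_incr s t :
  measurable_fun setT (fun w : Om => expR (- (cp t w - cp s w))).
Proof.
apply: measurableT_comp => //; apply: measurableT_comp => //.
by apply: measurable_funB; exact: measurable_cp.
Qed.

Lemma expRNX x k : expR (- x) ^+ k = expR (- (k%:R * x)) :> R.
Proof. by rewrite -expRM_natl mulrN. Qed.

Lemma measurable_Nln (B : set R) : measurable B -> measurable [set y : R | B (- ln y)].
Proof.
move=> mB; have mf : measurable_fun setT (fun y : R => - ln y).
  by apply: measurableT_comp => //; exact: measurable_ln.
exact: (preimage_measurable mf mB).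
Qed.

(** Joint moments of the variables exp(- increment) with exponents k i are Laplace transforms at the
    integers lam i = k i, which factor by [laplace_increments]. *)
Lemma cp_independent n (t : nat -> R) (B : nat -> set R) :
  (forall i, 0 <= t i) -> (forall i j, (i <= j)%N -> t i <= t j) ->
  (forall j, measurable (B j)) ->
  cp_prob mu [set w | forall j, (j < n)%N -> B j (cp (t j.+1) w - cp (t j) w)] =
  (\prod_(j < n) cp_prob mu [set w | B j (cp (t j.+1) w - cp (t j) w)%R])%E.
Proof.
move=> t0 tle mB.
pose Y i (w : Om) : R := expR (- (cp (t i.+1) w - cp (t i) w)).
have H := @independent_of_moments _ _ _ (cp_prob mu) Y n (fun i => measurable_exp_incr _ _)
  (fun i w => exp_incr01 w (tle _ _ (leqnSn i))) _
  (fun i => [set y | B i (- ln y)]) (fun i => measurable_Nln (mB i)).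
have E i w : [set y | B i (- ln y)] (Y i w) = B i (cp (t i.+1) w - cp (t i) w).
  by rewrite /= /Y expRK opprK.
transitivity (cp_prob mu [set w | forall i, (i < n)%N -> [set y | B i (- ln y)] (Y i w)]).
  by congr (cp_prob mu _); apply/seteqP; split => w /= H' j /H'; rewrite -E.
rewrite H.
  apply: eq_bigr => i _; congr (cp_prob mu _).
  by apply/seteqP; split => w /=; rewrite -E.
move=> k.
transitivity (\prod_(i < n) expR ((t i.+1 - t i) * (laplace mu (k i)%:R - 1))).
  rewrite -(laplace_increments mu t0 tle n (lam := fun i => (k i)%:R) (fun=> ler0n _ _)).
  apply: eq_Rexp => w; apply: eq_bigr => i _.
  by rewrite /Y expRNX.
apply: eq_bigr => i _; rewrite -laplace_increment ?t0 ?tle//.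
by apply: eq_Rexp => w; rewrite /Y expRNX.
Qed.

Lemma cp_stationary s t (B : set R) : 0 <= s -> 0 <= t -> measurable B ->
  cp_prob mu [set w | B (cp (s + t) w - cp s w)] =
  cp_prob mu [set w | B (cp t w - cp 0 w)].
Proof.
move=> s0 t0 mB.
have st : s <= s + t by rewrite lerDl.
have := @moments_unique _ _ _ _ _ (cp_prob mu) (cp_prob mu) _ _
  (measurable_exp_incr s (s + t)) (measurable_exp_incr 0 t)
  (fun w => exp_incr01 w st) (fun w => exp_incr01 w t0) _ _ (measurable_Nln mB).
have E u v : [set w | B (cp v w - cp u w)] =
    (fun w : Om => expR (- (cp v w - cp u w))) @^-1` [set y | B (- ln y)].
  by apply/seteqP; split => w /=; rewrite expRK opprK.
rewrite (E s) (E 0); apply => k.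
transitivity (expR (t * (laplace mu k%:R - 1))).
  rewrite -[in RHS](addrK s t) [t + s]addrC -laplace_increment ?s0//.
  by apply: eq_Rexp => w; rewrite expRNX.
rewrite -{1}[t]subr0 -laplace_increment ?lexx//.
by apply: eq_Rexp => w; rewrite expRNX.
Qed.

(** Markov's inequality for 1 - exp(- increment), whose expectation 1 - exp((t - s)(L_mu(1) - 1)) is
    at most t - s. *)
Lemma cp_jump s t (e : R) : 0 <= s <= t -> 0 < e ->
  (cp_prob mu [set w | (e < cp t w - cp s w)%R] <= ((t - s) / (1 - expR (- e)))%:E)%E.
Proof.
move=> /andP[s0 st] e0.
have e1 : 0 < 1 - expR (- e) by rewrite subr_gt0 expR_lt1 oppr_lt0.
have mE : measurable ([set w | e < cp t w - cp s w] : set Om).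
  have := @measurable_funB _ _ _ _ _ _ (@measurable_cp R t) (@measurable_cp R s).
  move=> /(_ measurableT `]e, +oo[%classic (measurable_itv _)); rewrite setTI.
  rewrite (_ : _ @^-1` _ = [set w | e < cp t w - cp s w])//.
  by apply/seteqP; split => w /=; rewrite in_itv/= andbT.
rewrite -(@fineK _ (cp_prob mu _)) ?fin_num_measure// lee_fin ler_pdivlMr//.
rewrite -Rexp_indic//.
have bi : bmf (fun w : Om => \1_[set w | e < cp t w - cp s w] w : R) by exact: bmf_indic.
rewrite -RexpZr//.
have bE : bmf (fun w : Om => expR (- (cp t w - cp s w))).
  by apply: bmf01 => [|w]; [exact: measurable_exp_incr|exact: exp_incr01].
apply: (@le_trans _ _ (\int[cp_prob mu]_w (1 - expR (- (cp t w - cp s w))))).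
  apply: le_Rexp => [||w].
  - by apply: bmfM => //; exact: bmf_cst.
  - by apply: bmfB => //; exact: bmf_cst.
  rewrite indicE; case: (boolP (w \in _)) => [|_].
    by rewrite inE/= mul1r lerD2l lerN2 ler_expR lerN2 => /ltW.
  by rewrite mul0r subr_ge0; have /andP[] := exp_incr01 w st.
rewrite RexpB//; last exact: bmf_cst.
rewrite Rexp_cst.
under eq_Rexp do rewrite -[X in - X]mul1r.
rewrite laplace_increment ?s0//.
rewrite lerBlDr -lerBlDl; apply: le_trans (expR_ge1Dx _).
rewrite lerD2l mulrBr mulr1 -[X in X <= _]add0r lerD2r.
by rewrite mulr_ge0 ?subr_ge0//; have /andP[] := @laplace01 R mu 1 ler01.
Qed.

Definition cpZ (t : {nonneg R}) : {RV (cp_prob mu) >-> R} :=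
  mfun_Sub (mem_set (@measurable_cp R t%:num)).

Lemma levy_process_cp : levy_process (cp_prob mu) cpZ.
Proof.
split.
- by apply: aeW => w; exact: cp0.
- move=> s t B mB; exact: cp_stationary.
- move=> n t B tle mB; exact: (cp_independent n (t := fun i => (t i)%:num)).
- move=> t e e0 eta eta0.
  have e1 : 0 < 1 - expR (- e) by rewrite subr_gt0 expR_lt1 oppr_lt0.
  (* With this delta the bound of [cp_jump] falls below eta. *)
  exists (eta * (1 - expR (- e))) => [|s]; first exact: mulr_gt0.
  wlog: s t / s%:num <= t%:num => [wlg|st].
    have [st|/ltW ts] := leP s%:num t%:num; first exact: wlg.
    rewrite distrC => /(wlg t s ts); apply: le_lt_trans.
    rewrite le_eqVlt; apply/orP; left; apply/eqP; congr (cp_prob mu _).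
    by apply/seteqP; split => w /=; rewrite distrC.
  rewrite distrC ger0_norm ?subr_ge0// -ltr_pdivrMr// => H.
  rewrite (_ : [set _ | _] = [set w | e < cp t%:num w - cp s%:num w]); last first.
    apply/seteqP; split => w /=; rewrite distrC ger0_norm// subr_ge0;
      exact: cp_le.
  by apply: le_lt_trans (cp_jump _ e0) _; rewrite ?st ?andbT ?lte_fin//.
Qed.

End levy_compound_poisson.

Lemma Rexp_nonneg (R : realType) (mu : probability R R) (f : R -> R) :
  nonneg_supported mu -> bmf f -> \int[mu]_x f (Num.max x 0) = \int[mu]_x f x.
Proof.
move=> mu0 bf.
have mm : measurable_fun setT (fun x : R => Num.max x 0) by exact: measurable_maxr.
rewrite -(Rexp_law mu mm bf); apply: Rexp_eq => B mB /=.
suff : mu ((fun x => Num.max x 0) @^-1` B) = mu B by [].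
have mmB : measurable ((fun x : R => Num.max x 0) @^-1` B).
  exact: (preimage_measurable mm mB).
rewrite nonneg_supportedI// [RHS]nonneg_supportedI//; congr (mu _).
by apply/seteqP; split => x [/= + x0]; move: (x0); rewrite /= in_itv/= andbT => x0';
  rewrite max_l.
Qed.

Section levy_law_compound_poisson.
Variables (R : realType).
Local Notation blockT := (nat * gprod nat (R * R)%type)%type.
Local Notation Om := (gprod nat blockT).
Implicit Types mu : probability R R.

(** The window of block 0 at time 1 is [0, 1[, which has uniform mass 1, so the mark is the full
    jump almost surely. *)
Lemma Rexp_mark mu (f : R -> R) : nonneg_supported mu -> bmf f ->
  \int[pprod (unif R) mu]_p f (mark 0 1 p) = \int[mu]_x f x.
Proof.
move=> mu0 bf.
have bfm : bmf (fun x : R => f (Num.max x 0)).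
  by apply: (bmf_comp bf); exact: measurable_maxr.
rewrite Rexp_pprod; last exact: (bmf_comp bf (measurable_mark 0 1)).
have bw : bmf (fun v : R => \1_(window 0 1) v : R) by apply: bmf_indic; rewrite /window.
transitivity (\int[unif R]_v (f 0 + \1_(window 0 1) v * (\int[mu]_x f x - f 0))).
  apply: eq_Rexp => v; rewrite -(Rexp_nonneg mu0 bf).
  rewrite -[X in _ - X](Rexp_cst mu) -RexpB//; last exact: bmf_cst.
  rewrite -RexpZl//; last by apply: bmfB => //; exact: bmf_cst.
  rewrite -[X in X + _](Rexp_cst mu) -RexpD//; last 2 first.
  - exact: bmf_cst.
  - by apply: bmfM; [exact: bmf_cst|apply: bmfB => //; exact: bmf_cst].
  apply: eq_Rexp => x; rewrite /mark/= indicE; case: (v \in _).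
    by rewrite !mul1r addrC subrK.
  by rewrite !mul0r addr0.
rewrite RexpD; [|exact: bmf_cst|by apply: bmfM => //; exact: bmf_cst].
rewrite Rexp_cst RexpZr// Rexp_window subr0 /clamp min_l// max_r//.
by rewrite mul1r addrC subrK.
Qed.

(** Only block 0 counts at time 1, and its marks have law mu. *)
Lemma Rexp_cp1_trig mu (u : R) : nonneg_supported mu ->
  let a := \int[mu]_x cos (u * x) in let b := \int[mu]_x sin (u * x) in
  \int[cp_prob mu]_w cos (u * cp 1 w) = expR (a - 1) * cos b /\
  \int[cp_prob mu]_w sin (u * cp 1 w) = expR (a - 1) * sin b.
Proof.
move=> mu0 a b.
have mphi : measurable_fun setT (fun p : R * R => u * mark 0 1 p).
  by apply: measurable_funM => //; exact: measurable_mark.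
have E (w : Om) : u * cp 1 w = block_sum (fun p => u * mark 0 1 p) (w 0%N).
  by rewrite (@cpE _ 1)// big_ord1 /block_sum mulr_sumr.
have H (f : R -> R) : bmf f -> \int[cp_prob mu]_w f (u * cp 1 w) =
    \int[block_prob (pprod (unif R) mu)]_x f (block_sum (fun p => u * mark 0 1 p) x).
  move=> bf; have := Rexp_power_prod (block_prob (pprod (unif R) mu)) 1
    (g := fun=> fun x => f (block_sum (fun p => u * mark 0 1 p) x)).
  rewrite big_ord1 => <-.
    by apply: eq_Rexp => w; rewrite big_ord1 E.
  by move=> _; exact: (bmf_comp bf (measurable_block_sum mphi)).
have bc : bmf (@cos R) by split; [exact: measurable_cos|exists 1 => x; exact: cos_max].
have bs : bmf (@sin R) by split; [exact: measurable_sin|exists 1 => x; exact: sin_max].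
have mu1 : measurable_fun setT (fun x : R => u * x) by exact: measurable_funM.
have aE : \int[pprod (unif R) mu]_p cos (u * mark 0 1 p) = a.
  exact: (Rexp_mark mu0 (bmf_comp bc mu1)).
have bE : \int[pprod (unif R) mu]_p sin (u * mark 0 1 p) = b.
  exact: (Rexp_mark mu0 (bmf_comp bs mu1)).
have := Rexp_block_trig (pprod (unif R) mu) mphi.
by rewrite aE bE !H.
Qed.

Definition cp_path (w : Om) : path_space R := fun t : {nonneg R} => cp t%:num w.

Lemma measurable_cp_path : measurable_fun setT cp_path.
Proof.
have := @measurable_gprod {nonneg R} _ R _ Om cp_path.
by apply => t; exact: measurable_cp.
Qed.

Definition cp_law mu : probability (path_space R) R := law (cp_prob mu) measurable_cp_path.

Lemma cp_lawP mu : exists (d : measure_display) (O : measurableType d)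
    (P : probability O R) (Z : {nonneg R} -> {RV P >-> R}),
    levy_process P Z /\ has_law P Z (cp_law mu).
Proof.
by exists _, Om, (cp_prob mu), (cpZ mu); split; first exact: levy_process_cp.
Qed.

Definition cp_levy (mu : pprobability R R) : levy_laws R := LevyLaw (cp_lawP mu).

Lemma measurable_cp_law :
  measurable_fun setT (fun mu : pprobability R R => cp_law mu : pprobability (path_space R) R).
Proof.
have m1 : measurable_fun setT (fun mu : pprobability R R =>
    block_prob (pprod (unif R) mu) : pprobability blockT R).
  apply: (@measurableT_comp _ _ _ (pprobability R R) (pprobability (R * R)%type R)
    (pprobability blockT R) (fun Q => block_prob Q) setT (fun mu => pprod (unif R) mu)).
    exact: measurable_block_prob.
  exact: measurable_pprod.
have m2 : measurable_fun setT (fun mu : pprobability R R => cp_prob mu : pprobability Om R).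
  apply: (@measurableT_comp _ _ _ (pprobability R R) (pprobability blockT R)
    (pprobability Om R) (fun Q => power_prob Q) setT _ _ m1).
  exact: measurable_power_prob.
apply: (@measurableT_comp _ _ _ (pprobability R R) (pprobability Om R)
  (pprobability (path_space R) R) (fun Q => law Q measurable_cp_path) setT _ _ m2).
exact: measurable_law.
Qed.

Lemma measurable_levy_laws d (E : measurableType d) (f : E -> levy_laws R) :
  (forall t, measurable_fun setT (fun x => marginal t (f x))) -> measurable_fun setT f.
Proof.
move=> mf; apply: (@measurability _ _ E (levy_laws R) setT f (@marginal_sets R)) => //.
move=> _ [_ [t _ [C mC <-]] <-].
have := mf t measurableT C mC.
by rewrite !setTI.
Qed.

Lemma measurable_marginal (t : {nonneg R}) :
  measurable_fun setT (marginal t : levy_laws R -> pprobability R R).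
Proof.
move=> _ C mC; apply: sub_sigma_algebra; exists t => //.
by exists C.
Qed.

Lemma measurable_cp_levy : measurable_fun setT cp_levy.
Proof.
apply: measurable_levy_laws => t; apply: measurable_pprobability => B mB.
have mcB : measurable ((fun x : path_space R => x t) @^-1` B).
  exact: (preimage_measurable (@measurable_coord _ R t) mB).
exact: (measurable_kernel_ev measurable_cp_law mcB).
Qed.

Lemma Rexp_marginal (gamma : levy_law R) t (f : R -> R) : bmf f ->
  \int[(marginal t gamma : probability R R)]_x f x = \int[levy_prob gamma]_x f (x t).
Proof.
move=> bf; have mc := @measurable_coord {nonneg R} R t.
by rewrite -(Rexp_law (levy_prob gamma) mc bf); apply: Rexp_eq => B mB.
Qed.

Lemma laplace_cp_levy (mu : pprobability R R) (t : {nonneg R}) (lam : R) : 0 <= lam ->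
  laplace (marginal t (cp_levy mu)) lam = expR (t%:num * (laplace mu lam - 1)).
Proof.
move=> lam0; rewrite /laplace Rexp_marginal/=; last exact: bmf_laplace_kernel.
have bf : bmf (fun x : path_space R => laplace_kernel lam (x t)).
  apply: (bmf_comp (bmf_laplace_kernel lam0)); exact: measurable_coord.
rewrite (Rexp_law (cp_prob mu) measurable_cp_path bf).
rewrite -{1}[t%:num]subr0 -laplace_increment ?lexx//=; apply: eq_Rexp => w.
rewrite cp0 subr0 /laplace_kernel /cp_path max_l//.
by rewrite -(cp0 w) cp_le.
Qed.

Lemma nonneg_supported_cp_levy (mu : pprobability R R) (t : {nonneg R}) :
  nonneg_supported (marginal t (cp_levy mu)).
Proof.
rewrite /nonneg_supported.
transitivity (cp_prob mu [set w | ~ (0 <= cp t%:num w)]).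
  congr (cp_prob mu _); apply/seteqP; split => w /=;
    by rewrite /coord/cp_path in_itv/= andbT.
rewrite [X in cp_prob mu X](_ : _ = set0) ?measure0//.
by apply/seteqP; split => w //=; rewrite -(cp0 w) cp_le.
Qed.

End levy_law_compound_poisson.

(** * Recovering the jump distribution *)

Section recover.
Variable R : realType.
Implicit Types (mu nu : pprobability R R) (r s u : R) (n : nat).

(* If [nu] is compound Poisson with jump law [mu], then [1 + ln (laplace nu i)] is
   the [i]-th moment of [exp (- x)] under [mu], so that this is the integral of a
   polynomial in [exp (- x)] approximating the indicator of [x > r]. *)
Definition tail_approx nu r n : R :=
  \sum_(i < size (indicator_poly (expR (- r)) n))
    (indicator_poly (expR (- r)) n)`_i * (1 + ln (laplace nu i%:R)).

(* [limsup_n tail_approx nu r n <= u] *)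
Definition tail_le nu r u : Prop :=
  forall m, exists N, forall n, tail_approx nu r (N + n)%N <= u + m.+1%:R^-1.

(** Thresholds are restricted to rationals, folded onto the nonnegative ones, so that the
    measurability of [quantile] is a matter of countable operations. *)
Definition ratp (q : rat) : R := Num.max 0 (ratr q).

Definition quantile_set nu u : set R :=
  [set r | exists2 q, r = ratp q & tail_le nu (ratp q) u].

(** The generalised inverse of the tail r |-> mu ]r, +oo[, as a function of the law and the level
    jointly; the convention that [inf] of the empty set is 0 makes it total. *)
Definition quantile (p : pprobability R R * R) : R := inf (quantile_set p.1 p.2).

Lemma quantile_lb nu u : lbound (quantile_set nu u) 0.
Proof. by move=> _ [q -> _]; rewrite /ratp le_max lexx. Qed.

Lemma measurable_laplace (s : R) : 0 <= s -> measurable_fun setT (fun nu : pprobability R R => laplace nu s).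
Proof.
move=> s0.
have mid : measurable_fun setT (id : pprobability R R -> pprobability R R) by exact: measurable_id.
exact: (measurable_kernel_Rexp mid (bmf_laplace_kernel s0)).1.
Qed.

Lemma measurable_tail_approx r n :
  measurable_fun setT (fun nu : pprobability R R => tail_approx nu r n).
Proof.
rewrite /tail_approx; elim: (size _) => [|m IH].
  by under eq_fun do rewrite big_ord0; exact: measurable_cst.
under eq_fun do rewrite big_ord_recr/=; apply: measurable_funD => //.
apply: measurable_funM => //; apply: measurable_funD => //.
apply: (@measurableT_comp _ _ _ _ _ _ (@ln R)); first exact: measurable_ln.
exact: measurable_laplace.
Qed.

Lemma measurable_tail_le r : measurable [set p : pprobability R R * R | tail_le p.1 r p.2].
Proof.
rewrite (_ : [set _ | _] = \bigcap_m \bigcup_N \bigcap_n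
    [set p : pprobability R R * R | tail_approx p.1 r (N + n)%N <= p.2 + m.+1%:R^-1]); last first.
  apply/seteqP; split => [p /= H m _|p /= H m].
    by have [N HN] := H m; exists N => // n _; exact: HN.
  by have [N _ HN] := H m I; exists N => n; exact: HN.
apply: bigcapT_measurable => m; apply: bigcupT_measurable => N.
apply: bigcapT_measurable => n.
have m1 : measurable_fun setT (fun p : pprobability R R * R => tail_approx p.1 r (N + n)%N).
  exact: (measurableT_comp (measurable_tail_approx r (N + n)) measurable_fst).
have m2 : measurable_fun setT (fun p : pprobability R R * R => p.2 + m.+1%:R^-1).
  by apply: measurable_funD => //; exact: measurable_snd.
have := measurable_fun_ler m1 m2 measurableT (Y := [set true]) I.
by rewrite setTI.
Qed.

Lemma measurable_quantile : measurable_fun setT quantile.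
Proof.
apply: (@measurability _ _ _ R setT _ (@RGenInftyO.G R)).
  exact: RGenInftyO.measurableE.
move=> _ [_ [s ->] <-]; rewrite setTI.
pose TL q := [set p : pprobability R R * R | tail_le p.1 (ratp q) p.2].
have mTL q : measurable (TL q) by exact: measurable_tail_le.
(* The second set collects the pairs for which no threshold qualifies: there [inf] takes its default
   value 0. *)
rewrite (_ : _ @^-1` _ = (\bigcup_q (if ratp q < s then TL q else set0)) `|`
    (if 0 < s then ~` \bigcup_q TL q else set0)).
  apply: measurableU; last first.
    by case: ifP => // _; apply: measurableC; exact: bigcupT_measurable_rat.
  by apply: bigcupT_measurable_rat => q; case: ifP.
apply/seteqP; split => p /=; rewrite in_itv/= /quantile => H.
  have [S0|S0] := pselect (quantile_set p.1 p.2 !=set0).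
    have [_ [q -> qp] qs] := inf_lt S0 H.
    by left; exists q => //; rewrite qs.
  right; move: H; have -> : quantile_set p.1 p.2 = set0.
    by apply: contrapT => /eqP/set0P.
  rewrite inf0 => ->; apply: contra_not S0 => -[q _ qp].
  by exists (ratp q); exists q.
case: H => [[q _]|].
  case: ifPn => // qs qp; apply: le_lt_trans qs; apply: ge_inf.
    by exists 0; exact: quantile_lb.
  by exists q.
case: ifPn => // s0 H; rewrite (_ : quantile_set _ _ = set0) ?inf0//.
by apply/seteqP; split => // _ [q -> qp]; apply: H; exists q.
Qed.

Lemma measurable_quantile_section nu : measurable_fun setT (fun u : R => quantile (nu, u)).
Proof. apply: (measurableT_comp measurable_quantile); exact: pair1_measurable. Qed.

Definition recover nu : pprobability R R := law (unif R) (measurable_quantile_section nu).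

Lemma measurable_recover : measurable_fun setT recover.
Proof.
apply: measurable_pprobability => B mB.
have mQ : measurable (quantile @^-1` B).
  exact: (preimage_measurable measurable_quantile mB).
have := measurable_fun_xsection (unif R) mQ.
congr (measurable_fun _ _); apply/funext => nu /=; congr (unif R _).
by apply/seteqP; split => u /=; rewrite /xsection/= inE.
Qed.

Section recoverE.
Variables mu nu : pprobability R R.
Hypothesis mu0 : nonneg_supported mu.
Hypothesis munu : forall k : nat, laplace nu k%:R = expR (laplace mu k%:R - 1).

Let G r : R := \int[mu]_x \1_(`]r, +oo[) (Num.max x 0).

Let mG r : measurable_fun setT (fun x : R => \1_(`]r, +oo[) (Num.max x 0) : R).
Proof.
have m1 : measurable_fun setT (fun v : R => \1_(`]r, +oo[) v : R) by exact: measurable_indic.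
apply: (measurableT_comp m1); exact: measurable_maxr.
Qed.

Let bG r : bmf (fun x : R => \1_(`]r, +oo[) (Num.max x 0) : R).
Proof. by apply: bmf01 => // x; rewrite indicE; case: (_ \in _); rewrite /= ?lexx ?ler01. Qed.

Let GE r : G r = fine (mu `]r, +oo[%classic).
Proof.
rewrite -Rexp_indic// -Rexp_nonneg//; exact: bmf_indic.
Qed.

Let G_le r s : r <= s -> G s <= G r.
Proof.
move=> rs; apply: le_Rexp => // x; rewrite !indicE ler_nat.
case: (boolP (_ \in `]s, +oo[%classic)) => //; rewrite inE/= in_itv/= andbT => sx.
by rewrite mem_set//= in_itv/= andbT (le_lt_trans rs).
Qed.

(** By [munu], 1 + ln L_nu(i) is the i-th moment of exp(- x) under mu. Hence [tail_approx]
    integrates [indicator_poly] for c = exp(- r), where r >= 0 ensures c <= 1, and the indicator of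
    exp(- x) < c is that of x > r. *)
Let cvg_tail r : 0 <= r -> tail_approx nu r n @[n --> \oo] --> G r.
Proof.
move=> r0.
have c01 : 0 < expR (- r) <= 1 by rewrite expR_gt0/= expR_le1 oppr_le0.
have E n : tail_approx nu r n =
    \int[mu]_x (indicator_poly (expR (- r)) n).[laplace_kernel 1 x].
  transitivity (\int[mu]_x (1 * (indicator_poly (expR (- r)) n).[laplace_kernel 1 x])).
    rewrite Rexp_horner; [|exact: bmf_cst|exact: bmf_laplace_kernel].
    apply: eq_bigr => i _; congr (_ * _); rewrite munu expRK addrC subrK.
    by apply: eq_Rexp => x; rewrite mul1r laplace_kernelX mulr1.
  by apply: eq_Rexp => x; rewrite mul1r.
rewrite (funext E).
have -> : G r = \int[mu]_x (laplace_kernel 1 x < expR (- r))%R%:R.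
  apply: eq_Rexp => x; rewrite indicE /laplace_kernel mul1r ltr_expR ltrN2.
  rewrite (_ : (_ \in _) = (r < Num.max x 0))//; apply/idP/idP; rewrite inE/= in_itv/= andbT//.
apply: (@Rexp_cvg _ _ _ _ 1) => [n|n x|x].
- by have [] := bmf_horner (indicator_poly (expR (- r)) n) (bmf_laplace_kernel (@ler01 R)).
- have /andP[y0 y1] := indicator_poly01 (expR (- r)) n (laplace_kernel01 x (@ler01 R)).
  by rewrite ger0_norm.
- by apply: cvg_indicator_poly => //; exact: laplace_kernel01.
Qed.

Let tail_leE r u : 0 <= r -> tail_le nu r u <-> G r <= u.
Proof.
move=> r0; have cG := cvg_tail r0; split => [H|Gu m].
  apply/ler_addgt0Pr => e e0.
  have [m me] : exists m, m.+1%:R^-1 < e.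
    by exists (Num.truncn e^-1); rewrite invf_plt ?posrE// truncnS_gt.
  have [N HN] := H m.
  apply: le_trans (_ : u + m.+1%:R^-1 <= _); last by rewrite lerD2l ltW.
  rewrite leNgt; apply/negP => HG.
  have [M _ HM] : \forall n \near \oo, u + m.+1%:R^-1 < tail_approx nu r n.
    exact: (cvgr_gt _ cG).
  have /= := HM (N + M)%N (leq_addl _ _).
  by rewrite ltNge HN.
have : \forall n \near \oo, tail_approx nu r n < u + m.+1%:R^-1.
  apply: (cvgr_lt _ cG); apply: le_lt_trans Gu _.
  by rewrite ltrDl invr_gt0.
move=> [N _ HN]; exists N => n; apply: ltW; apply: HN => /=; exact: leq_addr.
Qed.

Let G_cvg0 : G n%:R @[n --> \oo] --> 0.
Proof.
rewrite -[X in _ --> X](Rexp_cst mu 0).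
apply: (@Rexp_cvg _ _ _ _ 1) => [n|n x|x]; first exact: mG.
  by rewrite indicE; case: (_ \in _); rewrite ?normr1 ?normr0.
apply: cvg_near_cst; exists (Num.truncn (Num.max x 0)).+1 => // n /= xn.
rewrite indicE memNset//= in_itv/= andbT; apply/negP; rewrite -leNgt.
by rewrite ltW// (lt_le_trans (truncnS_gt _))// ler_nat.
Qed.

Let G_right s : G (s + n.+1%:R^-1) @[n --> \oo] --> G s.
Proof.
apply: (@Rexp_cvg _ _ _ _ 1) => [n|n x|x]; first exact: mG.
  by rewrite indicE; case: (_ \in _); rewrite ?normr1 ?normr0.
have [xs|sx] := leP (Num.max x 0) s.
  apply: cvg_near_cst; apply: nearW => n; rewrite !indicE !memNset//= in_itv/= andbT.
    by apply/negP; rewrite -leNgt.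
  by apply/negP; rewrite -leNgt (le_trans xs)// lerDl.
apply: cvg_near_cst; exists (Num.truncn (Num.max x 0 - s)^-1).+1 => // n /= xn.
rewrite !indicE !mem_set//= in_itv/= andbT//.
rewrite -ltrBrDl invf_plt ?posrE// ?subr_gt0//.
by rewrite (lt_trans (truncnS_gt _))// ltr_nat.
Qed.

(** If G s <= u, every rational slightly above s qualifies. Conversely, right continuity keeps u < G
    at a point beyond s, below which nothing qualifies. Since G tends to 0, the condition u > 0
    makes some threshold qualify, so that the infimum is a true one. *)
Let quantile_gt s u : 0 <= s -> 0 < u -> s < quantile (nu, u) <-> u < G s.
Proof.
move=> s0 u0; rewrite /quantile/=; split => [H|uG].
  rewrite ltNge; apply/negP => Gu.
  have [q] := rat_in_itvoo H; rewrite in_itv/= => /andP[sq qi].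
  have qE : ratp q = ratr q by rewrite /ratp max_r// (le_trans s0)// ltW.
  move: qi; rewrite ltNge => /negP; apply; apply: ge_inf.
    by exists 0; exact: quantile_lb.
  exists q => //; apply/tail_leE; first by rewrite qE (le_trans s0)// ltW.
  by rewrite qE (le_trans _ Gu)// G_le// ltW.
have [N _ HN] : \forall n \near \oo, u < G (s + n.+1%:R^-1).
  by apply: (@cvgr_gt R nat \oo _ (fun n : nat => G (s + n.+1%:R^-1)) (G s)) => //; exact: G_right.
have {HN}HN := HN N (leqnn N).
apply: (@lt_le_trans _ _ (s + N.+1%:R^-1)); first by rewrite ltrDl.
apply: lb_le_inf; last first.
  move=> _ [q -> /tail_leE]; rewrite /ratp le_max lexx => /(_ isT) qu.
  rewrite leNgt; apply/negP => /ltW/G_le; rewrite leNgt => /negP; apply.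
  exact: le_lt_trans qu _.
have [M _ HM] : \forall n \near \oo, G n%:R < u by apply: (@cvgr_lt R nat \oo _ (fun n : nat => G n%:R) 0).
have qE : ratp M%:R = M%:R by rewrite /ratp rmorph_nat max_r.
exists M%:R; exists M%:R; first by rewrite qE.
apply/tail_leE; rewrite qE//; apply: ltW; exact: HM M (leqnn M).
Qed.

Lemma recoverE : recover nu ≡μ mu.
Proof.
apply: (@probability_eq_pi _ _ _ _ _ (@RGenOInfty.G R)).
- exact: RGenOInfty.measurableE.
- move=> _ _ [s ->] [t ->]; exists (Num.max s t).
  by apply/seteqP; split => x /=; rewrite !in_itv/= !andbT gt_max => /andP.
move=> _ [s ->].
have q0 u : 0 <= quantile (nu, u).
  rewrite /quantile/=; have [S0|S0] := pselect (quantile_set nu u !=set0).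
    by apply: lb_le_inf => //; exact: quantile_lb.
  by rewrite (_ : quantile_set nu u = set0) ?inf0//; apply: contrapT => /eqP/set0P.
have mq := measurable_quantile_section nu.
have mS : measurable ([set u | s < quantile (nu, u)] : set R).
  have := mq measurableT `]s, +oo[%classic (measurable_itv _); rewrite setTI.
  by rewrite (_ : _ @^-1` _ = [set u | s < quantile (nu, u)])//;
    apply/seteqP; split => u /=; rewrite in_itv/= andbT.
transitivity (unif R [set u | (s < quantile (nu, u))%R]).
  by congr (unif R _); apply/seteqP; split => u /=; rewrite in_itv/= andbT.
have [s0|s0] := leP 0 s; last first.
  have -> : [set u | s < quantile (nu, u)] = setT.
    by apply/seteqP; split => u //= _; exact: lt_le_trans (q0 u).
  rewrite probability_setT -(probability_setT mu).
  apply: (@probability_eq_setI _ _ _ mu `[0, +oo[) => //.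
  apply/seteqP; split => x /=; rewrite !in_itv/= !andbT => -[_ x0]; split => //.
  exact: lt_le_trans x0.
(* [quantile_gt] excludes the level 0, so levels are restricted to ]0, 1[, of full uniform
   measure. *)
have unif0 : unif R (~` `]0, 1[%classic) = 0%E.
  rewrite probability_setC// (_ : unif R _ = 1%E) ?subee//.
  rewrite [unif R _](_ : _ =
    (\int[lebesgue_measure]_(x in `]0%R, 1%R[) (uniform_pdf 0 1 x)%:E)%E)//.
  have -> : (\int[lebesgue_measure]_(x in `]0%R, 1%R[) (uniform_pdf 0 1 x)%:E =
      \int[lebesgue_measure]_(x in `]0%R, 1%R[) (cst 1%:E (x : R)))%E.
    apply: eq_integral => x; rewrite inE/= in_itv/= => /andP[x0 x1].
    by rewrite /uniform_pdf !ltW// subr0 invr1.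
  by rewrite integral_cst//= mul1e lebesgue_measure_itv/= lte_fin ltr01 oppr0 adde0.
transitivity (unif R `[0, G s[%classic).
  apply: (@probability_eq_setI _ _ _ (unif R) `]0, 1[%classic) => //.
  apply/seteqP; split => u /=; rewrite !in_itv/= => -[H /andP[u0 u1]]; split => //;
    move: H; rewrite ?u0// ?u1// (ltW u0)/=; move/(quantile_gt s0 u0); apply.
have G1 : G s <= 1 by rewrite GE -lee_fin fineK ?fin_num_measure// probability_le1.
rewrite -[LHS]fineK ?fin_num_measure// unif_itv// max_r.
  by rewrite GE fineK// fin_num_measure.
by apply: Rexp_ge0.
Qed.

End recoverE.

End recover.

(** * Lévy laws *)

Section nngr.
Variable R : realType.
Implicit Types t : R.

Lemma nngr_subproof t : 0 <= Num.max t 0.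
Proof. by rewrite le_max lexx orbT. Qed.

(** Total map from real numbers to times: arithmetic on times can be done in R, with nonnegativity
    proved only where it matters. *)
Definition nngr t : {nonneg R} := NngNum (nngr_subproof t).

Lemma nngrE t : 0 <= t -> (nngr t)%:num = t.
Proof. by move=> t0; rewrite /= max_l. Qed.

Lemma nngr_num (t : {nonneg R}) : nngr t%:num = t.
Proof. by apply: val_inj => /=; rewrite max_l. Qed.

End nngr.

Section levy_law.
Variables (R : realType) (g : levy_law R).
Implicit Types (s t e : R) (B : set R).
Local Notation Om := (path_space R).

Lemma measurable_path t : measurable_fun setT (fun x : Om => x (nngr t)).
Proof. exact: measurable_coord. Qed.

Lemma measurable_path_lt t e : measurable ([set x | x (nngr t) < e] : set Om).
Proof.
rewrite (_ : [set _ | _] = [set x : Om | (`]-oo, e[%classic : set R) (x (nngr t))]).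
  exact: (preimage_measurable (measurable_path _)).
by apply/seteqP; split => x /=; rewrite in_itv.
Qed.

Lemma measurable_path_incr s t : measurable_fun setT (fun x : Om => x (nngr t) - x (nngr s)).
Proof. by apply: measurable_funB; exact: measurable_path. Qed.

(** The defining properties depend on the joint law only, so the auxiliary process in [levy_probP]
    may be replaced by the coordinates of the path space. *)
Lemma levy_coord : levy_process (levy_prob g)
  (fun t : {nonneg R} => Defs.coord t : {RV (levy_prob g) >-> R}).
Proof.
have [d [Om0 [P [Z [ZP gP]]]]] := levy_probP g; have [Z0 Zs Zi Zc] := ZP.
have mc (t : {nonneg R}) B : measurable B -> measurable [set x : Om | B (x t)].
  by move=> mB; have := @measurable_coord _ R t measurableT _ mB; rewrite setTI.
have mcB (s t : {nonneg R}) B : measurable B -> measurable [set x : Om | B (x t - x s)].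
  by move=> mB; apply: preimage_measurable => //; apply: measurable_funB; exact: measurable_coord.
split.
- have [N [mN PN ZN]] := Z0.
  exists [set x : Om | x 0%:nng <> 0]; split => //.
    apply: (mc _ [set y | y <> 0]).
    by rewrite (_ : [set y | y <> 0] = ~` [set 0]) //; exact: measurableC.
  rewrite -gP; last first.
    apply: (mc _ [set y | y <> 0]).
    by rewrite (_ : [set y | y <> 0] = ~` [set 0]) //; exact: measurableC.
  apply: (subset_measure0 _ mN) => //.
  have mZ := (@measurable_funPTI _ _ _ _ (Z 0%:nng) (~` [set 0]) (measurableC (measurable_set1 0))).
  exact: mZ.
- move=> s t B mB; have := Zs s t B mB.
  rewrite -(gP _ (mcB _ _ _ mB)) -(gP _ (mcB _ _ _ mB)); exact.
- move=> n t B tle mB; rewrite -gP; last first.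
    by apply: measurable_forall_lt => j; exact: mcB.
  transitivity (P [set w | forall j, (j < n)%N -> B j (Z (t j.+1) w - Z (t j) w)]) => //.
  rewrite Zi//; apply: eq_bigr => j _; rewrite -gP//; exact: mcB.
- move=> t e e0 eta eta0; have [del del0 H] := Zc t e e0 eta eta0.
  exists del => // s /H; rewrite -gP//.
  apply: (mcB t s [set y | e < `|y|]).
  rewrite (_ : [set _ | _] = (fun y : R => `|y|) @^-1` `]e, +oo[); last first.
    by apply/seteqP; split => y /=; rewrite in_itv/= andbT.
  exact: (preimage_measurable (@normr_measurable R setT) (measurable_itv `]e, +oo[)).
Qed.

Let S0 := [set x : Om | x (nngr 0) = 0].

Lemma measurable_start : measurable S0.
Proof. exact: (preimage_measurable (measurable_path 0) (measurable_set1 0)). Qed.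

Lemma levy_start : levy_prob g (~` S0) = 0%E.
Proof.
have [Z0 _ _ _] := levy_coord; have [N [mN PN ZN]] := Z0.
apply: (subset_measure0 _ mN) => //; first exact: (measurableC measurable_start).
move=> x Sx; apply: ZN => /= x0; apply: Sx; rewrite /S0/= -[RHS]x0.
by congr (x _); rewrite -[RHS]nngr_num.
Qed.

Lemma levy_incr s t B : 0 <= s -> 0 <= t -> measurable B ->
  levy_prob g [set x | B (x (nngr (s + t)) - x (nngr s))] = marginal (nngr t) g B.
Proof.
move=> s0 t0 mB; have [_ Zs _ _] := levy_coord.
transitivity (levy_prob g [set x | B (x (nngr t) - x (nngr 0))]).
  have := Zs (nngr s) (nngr t) B mB.
  rewrite /same_law/=.
  have -> : ((nngr s)%:num + (nngr t)%:num)%:nng = nngr (s + t).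
    by apply: val_inj; rewrite /= !max_l// addr_ge0.
  by rewrite (_ : 0%:nng = nngr 0)//; apply: val_inj; rewrite /= max_l.
apply: (probability_eq_setI measurable_start _ _ levy_start).
- exact: (preimage_measurable (measurable_path_incr _ _)).
- exact: (preimage_measurable (measurable_path t)).
by apply/seteqP; split => x /= [+ x0]; rewrite /Defs.coord x0 subr0.
Qed.

Lemma levy_independent n (t : nat -> R) (B : nat -> set R) :
  (forall i, 0 <= t i) -> (forall i j, (i <= j)%N -> t i <= t j) ->
  (forall j, measurable (B j)) ->
  levy_prob g [set x | forall j, (j < n)%N -> B j (x (nngr (t j.+1)) - x (nngr (t j)))] =
  (\prod_(j < n) marginal (nngr (t j.+1 - t j)%R) g (B j))%E.
Proof.
move=> t0 tle mB; have [_ _ Zi _] := levy_coord.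
have := Zi n (fun j => nngr (t j)) B _ mB => H.
transitivity (\prod_(j < n) levy_prob g [set x | B j (x (nngr (t j.+1)) - x (nngr (t j)))%R])%E.
  by apply: H => i j ij; rewrite !nngrE// tle.
apply: eq_bigr => j _; rewrite -(levy_incr (s := t j))// ?subr_ge0 ?tle//.
by rewrite addrC subrK.
Qed.

Lemma levy_continuous t e eta : 0 <= t -> 0 < e -> 0 < eta ->
  exists2 delta, 0 < delta & forall s, 0 <= s -> `|s - t| < delta ->
    (levy_prob g [set x | (e < `|x (nngr s) - x (nngr t)|)%R] < eta%:E)%E.
Proof.
move=> t0 e0 eta0; have [_ _ _ Zc] := levy_coord.
have [delta d0 H] := Zc (nngr t) e e0 eta eta0.
by exists delta => // s s0 st; apply: H; rewrite !nngrE.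
Qed.

Definition increments (t : nat -> R) (x : Om) : gprod nat R :=
  fun i => x (nngr (t i.+1)) - x (nngr (t i)).

Lemma measurable_increments (t : nat -> R) : measurable_fun setT (increments t).
Proof. apply: measurable_gprod => i; exact: measurable_path_incr. Qed.

Lemma increments_sum (t : nat -> R) x k : t 0%N = 0 -> S0 x ->
  x (nngr (t k)) = \sum_(i < k) increments t x i.
Proof.
move=> t0 x0; rewrite /increments -(big_mkord xpredT (fun i => x (nngr (t i.+1)) - x (nngr (t i)))).
by rewrite (telescope_sumr (fun i => x (nngr (t i))))// t0 x0 subr0.
Qed.

(** The link with i.i.d. sequences. Mesh 1/(n + 1) serves to study one-time marginals, mesh 1 to
    read a mixture of Lévy laws as a mixture of i.i.d. sequences. *)
Lemma grid_increments (h : R) : 0 <= h ->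
  law (levy_prob g) (measurable_increments (fun i => i%:R * h)) ≡μ
  power_prob (marginal (nngr h) g).
Proof.
move=> h0; apply: power_prob_unique => n B mB.
transitivity (levy_prob g [set x | forall j, (j < n)%N ->
    B j (x (nngr (j.+1%:R * h)) - x (nngr (j%:R * h)))]) => //.
rewrite (levy_independent n (t := fun i => i%:R * h)) ?mB//.
- by apply: eq_bigr => j _; rewrite -mulrBl -natrB// subSnn mul1r.
- by move=> i; rewrite mulr_ge0.
- by move=> i j ij; rewrite ler_wpM2r// ler_nat.
Qed.

End levy_law.

Lemma measurable_sum_seq (R : realType) k :
  measurable_fun setT (fun y : gprod nat R => \sum_(i < k) y i).
Proof.
elim: k => [|k IH].
  by under eq_fun do rewrite big_ord0; exact: measurable_cst.
under eq_fun do rewrite big_ord_recr/=; apply: measurable_funD => //.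
exact: measurable_gcoord.
Qed.

Section levy_law_unique.
Variables (R : realType) (g1 g2 : levy_law R).
Hypothesis g12 : forall t, marginal t g1 ≡μ marginal t g2.

(** Values at finitely many times are partial sums of increments along the sorted times, and the
    joint law of these increments is a product of one-time marginals. *)
Lemma levy_law_unique : levy_prob g1 ≡μ levy_prob g2.
Proof.
apply: (probability_eq_pi (@measurable_rects {nonneg R} _ R) (@rects_setI {nonneg R} _ R)).
move=> _ [n [tau [B [mB ->]]]].
(* The time 0 is included so that partial sums of increments start from the value 0. *)
pose s : seq R := sort <=%R (0 :: [seq (tau j)%:num | j <- iota 0 n]).
(* Extends the finite list to a nondecreasing sequence, constant after the last time. *)
pose t i := nth 0 s (minn i (size s).-1).
have s_sorted : sorted <=%R s by exact: (sort_sorted (@le_total _ R)).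
have s_size : (0 < size s)%N by rewrite size_sort.
have s0 x : x \in s -> 0 <= x.
  by rewrite mem_sort inE => /orP[/eqP ->//|/mapP[j _ ->]].
have mins i : (minn i (size s).-1 < size s)%N.
  by rewrite (leq_ltn_trans (geq_minr _ _))// prednK.
have t0 i : 0 <= t i by apply: s0; rewrite mem_nth.
have tle i j : (i <= j)%N -> t i <= t j.
  move=> ij; apply: (sorted_leq_nth (@le_trans _ R) (@lexx _ R) 0 s_sorted).
  - exact: mins.
  - exact: mins.
  by rewrite leq_min geq_minr (leq_trans (geq_minl _ _)).
have tidx x : x \in s -> t (index x s) = x.
  by move=> xs; rewrite /t (minn_idPl _) ?nth_index// -ltnS prednK// index_mem.
have t00 : t 0%N = 0.
  apply/eqP; rewrite eq_le t0 andbT -[X in _ <= X](tidx 0) ?tle//.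
  by rewrite mem_sort inE eqxx.
pose k j := index (tau j)%:num s.
have tk j : (j < n)%N -> t (k j) = (tau j)%:num.
  move=> jn; apply: tidx; rewrite mem_sort inE; apply/orP; right.
  by apply/mapP; exists j => //; rewrite mem_iota.
pose E : set (gprod nat R) :=
  [set y : nat -> R | forall j, (j < n)%N -> B j (\sum_(i < k j) y i)].
have mE : measurable E.
  apply: (measurable_forall_lt n) => j.
  exact: (preimage_measurable (measurable_sum_seq (R := R) (k j)) (mB j)).
have H (g : levy_law R) : levy_prob g [set x | forall j, (j < n)%N -> B j (x (tau j))] =
    law (levy_prob g) (measurable_increments t) E.
  transitivity (levy_prob g [set x | E (increments t x)]) => //.
  apply: (probability_eq_setI (@measurable_start R) _ _ (@levy_start R g)).
  - by apply: measurable_forall_lt => j; exact: (preimage_measurable (@measurable_coord _ R _) (mB j)).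
  - exact: (preimage_measurable (measurable_increments t) mE).
  apply/seteqP; split => x /= [Bx x0]; split => // j jn; move: (Bx j jn);
    by rewrite -(increments_sum _ t00 x0) tk// nngr_num.
transitivity (law (levy_prob g1) (measurable_increments t) E); first exact: H.
transitivity (law (levy_prob g2) (measurable_increments t) E); last by rewrite -H.
apply: (probability_eq_pi (@measurable_irects _ R) (@irects_setI _ R)) => //.
move=> _ [m [C [mC ->]]].
transitivity (levy_prob g1 [set x | forall j, (j < m)%N ->
    C j (x (nngr (t j.+1)) - x (nngr (t j)))]) => //.
transitivity (levy_prob g2 [set x | forall j, (j < m)%N ->
    C j (x (nngr (t j.+1)) - x (nngr (t j)))]) => //.
rewrite !levy_independent//; apply: eq_bigr => j _; exact: g12.
Qed.

End levy_law_unique.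

Section almost_everywhere.
Context d (T : measurableType d) (R : realType) (P : probability T R).

Lemma probability_setU0 (A B : set T) : measurable A -> measurable B ->
  P A = 0%E -> P B = 0%E -> P (A `|` B) = 0%E.
Proof.
move=> mA mB A0 B0; apply/eqP; rewrite -measure_le0.
by rewrite (le_trans (measureU2 P mA mB))// [X in (X + _)%E]A0 [X in (_ + X)%E]B0 adde0.
Qed.

Lemma prob1_setC (S : set T) : measurable S -> P S = 1%E -> P (~` S) = 0%E.
Proof. by move=> mS PS; rewrite probability_setC// PS subee. Qed.

Lemma le_Rexp_on (S : set T) (f h : T -> R) : measurable S -> P (~` S) = 0%E ->
  bmf f -> bmf h -> (forall x, S x -> f x <= h x) -> \int[P]_x f x <= \int[P]_x h x.
Proof.
move=> mS PS bf bh fh; have [[mf [M fM]] [mh [N hN]]] := (bf, bh).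
have mSC := measurableC mS.
(* Off S this function dominates f - h, and its integral vanishes. *)
have bi : bmf (fun x => (M + N) * \1_(~` S) x : R).
  by apply: bmfM; [exact: bmf_cst|exact: bmf_indic].
rewrite -[leRHS]addr0 -[X in _ + X](mulr0 (M + N)) -[X in (M + N) * X]/(fine 0%E) -PS.
rewrite -Rexp_indic// -RexpZl -?RexpD//; last exact: bmf_indic.
apply: le_Rexp => // [|x]; first exact: bmfD.
rewrite indicE; have [Sx|Sx] := pselect (S x).
  by rewrite memNset ?mulr0 ?addr0; [exact: fh|apply].
rewrite mem_set// mulr1 addrC -lerBlDr; apply: le_trans (ler_norm _) _.
by rewrite (le_trans (ler_normB _ _))// lerD.
Qed.

Lemma eq_Rexp_on (S : set T) (f h : T -> R) : measurable S -> P (~` S) = 0%E ->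
  bmf f -> bmf h -> (forall x, S x -> f x = h x) -> \int[P]_x f x = \int[P]_x h x.
Proof.
move=> mS PS bf bh fh; apply/eqP; rewrite eq_le.
by rewrite !(le_Rexp_on mS PS)// => x Sx; rewrite fh.
Qed.

End almost_everywhere.

Section nonneg_supported.
Variable R : realType.
Implicit Types (mu : probability R R) (n : nat).

Lemma nonneg_supported_itv mu : nonneg_supported mu -> mu `[0, +oo[%classic = 1%E.
Proof.
move=> mu0; have : mu (~` ~` `[0, +oo[%classic) = 1%E.
  by rewrite probability_setC ?[X in (1 - X)%E]mu0 ?sube0//; exact: measurableC.
by rewrite setCK.
Qed.

Lemma measurable_first_nonneg n : measurable ([set x | forall j, (j < n)%N ->
    (`[0, +oo[%classic : set R) (x j)] : set (gprod nat R)).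
Proof. by apply: rects_measurable; apply: irects_rects; exists n, (fun=> `[0, +oo[%classic). Qed.

Lemma power_prob_nonneg mu n : nonneg_supported mu ->
  power_prob mu (~` [set x | forall j, (j < n)%N -> (`[0, +oo[%classic : set R) (x j)]) = 0%E.
Proof.
move=> mu0; apply: prob1_setC; first exact: measurable_first_nonneg.
rewrite (power_prob_rect mu n (B := fun=> `[0, +oo[%classic))// big1// => j _.
exact: nonneg_supported_itv.
Qed.

End nonneg_supported.

Section grid.
Variable R : realType.
Implicit Types t : R.

Lemma grid_below t n : 0 <= t -> exists k : nat,
  k%:R * n.+1%:R^-1 <= t <= k.+1%:R * n.+1%:R^-1.
Proof.
move=> t0; exists (Num.truncn (t * n.+1%:R)).
rewrite ler_pdivrMr// ler_pdivlMr// truncn_le ?mulr_ge0//=.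
by rewrite ltW// truncnS_gt.
Qed.

Lemma le_inv_nat_eq0 (a K : R) : (forall n : nat, `|a| <= K * n.+1%:R^-1) -> a = 0.
Proof.
move=> aK; apply/eqP; rewrite -normr_le0 leNgt; apply/negP => a0.
have := aK (Num.truncn (K / `|a|)); rewrite ler_pdivlMr// leNgt => /negP; apply.
by rewrite mulrC -ltr_pdivrMr// truncnS_gt.
Qed.

End grid.

(** * Lévy laws whose time-one marginal lives on the half-line *)

Section nonneg_levy.
Variables (R : realType) (g : levy_law R).
Implicit Types (s t h : R) (k n : nat).
Local Notation P := (levy_prob g).
Local Notation Om := (path_space R).
Local Notation nonneg t := (nonneg_supported (marginal (nngr t) g)).

Definition monotone_on_grid h k : set Om :=
  [set x | x (nngr 0) = 0] `&`
  [set x | forall j, (j < k)%N -> (`[0, +oo[%classic : set R) (increments (fun i => i%:R * h) x j)].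

Lemma measurable_monotone_on_grid h k : measurable (monotone_on_grid h k).
Proof.
apply: measurableI; first exact: measurable_start.
apply: measurable_forall_lt => j.
exact: (preimage_measurable (measurable_path_incr _ _)).
Qed.

Lemma monotone_on_gridP h k : 0 <= h -> nonneg h -> P (~` monotone_on_grid h k) = 0%E.
Proof.
move=> h0 nh; have mE := measurableC (@measurable_first_nonneg R k).
rewrite /monotone_on_grid setCI; apply: probability_setU0.
- by apply: measurableC; exact: measurable_start.
- exact: (preimage_measurable (measurable_increments (fun i => i%:R * h)) mE).
- exact: levy_start.
- exact: etrans (grid_increments g h0 mE) (power_prob_nonneg k nh).
Qed.

Lemma monotone_on_grid_sum h k x : monotone_on_grid h k x ->
  x (nngr (k%:R * h)) = \sum_(i < k) increments (fun i => i%:R * h) x i.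
Proof. by move=> [x0 _]; apply: (increments_sum _ (t := fun i => i%:R * h)) => //; rewrite mul0r. Qed.

Lemma monotone_on_grid_ge0 h k x : monotone_on_grid h k x ->
  0 <= \sum_(i < k) increments (fun i => i%:R * h) x i.
Proof.
move=> [_ H]; apply: sumr_ge0 => i _.
by have := H i (ltn_ord i); rewrite /= in_itv/= andbT.
Qed.

Lemma nonneg_grid h k : 0 <= h -> nonneg h -> nonneg (k%:R * h).
Proof.
move=> h0 nh; have mS := measurable_monotone_on_grid h k.
apply: (subset_measure0 _ (measurableC mS)) (monotone_on_gridP k h0 nh).
  have := preimage_measurable (@measurable_path R (k%:R * h)) (measurableC (measurable_itv `[0, +oo[)).
  exact.
move=> x /= xk Sx; apply: xk; rewrite /Defs.coord/= in_itv/= andbT.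
by rewrite (monotone_on_grid_sum Sx) monotone_on_grid_ge0.
Qed.

(** The truncated kernel is multiplicative only along nonnegative increments, hence the restriction
    to [monotone_on_grid], which has full measure. *)
Lemma laplace_grid h k lam : 0 <= lam -> 0 <= h -> nonneg h ->
  laplace (marginal (nngr (k%:R * h)) g) lam = laplace (marginal (nngr h) g) lam ^+ k.
Proof.
move=> lam0 h0 nh.
have bl : bmf (laplace_kernel lam) by exact: bmf_laplace_kernel.
have bp : bmf (fun y : gprod nat R => \prod_(i < k) laplace_kernel lam (y i)).
  apply: (@bmf_prod _ (gprod nat R) R k (fun i y => laplace_kernel lam (y i))) => i.
  exact: bmf_gcoord.
transitivity (\int[law P (measurable_increments (fun i => i%:R * h))]_y
    \prod_(i < k) laplace_kernel lam (y i)); last first.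
  rewrite (Rexp_eq _ (grid_increments g h0)).
  rewrite (Rexp_power_prod _ k (g := fun=> laplace_kernel lam))//.
  by rewrite prodr_const card_ord.
rewrite (Rexp_law P (measurable_increments _) bp) /laplace Rexp_marginal//.
apply: (eq_Rexp_on (measurable_monotone_on_grid h k) (monotone_on_gridP k h0 nh)).
- exact: (bmf_comp bl (measurable_path _)).
- exact: (bmf_comp bp (measurable_increments _)).
move=> x Sx; have H0 := monotone_on_grid_ge0 Sx.
rewrite (monotone_on_grid_sum Sx) /laplace_kernel max_l// mulr_sumr -sumrN expR_sum.
apply: eq_bigr => i _; rewrite max_l//.
by have [_ /(_ i (ltn_ord i))] := Sx; rewrite /= in_itv/= andbT.
Qed.

Let path_lt0 t : P [set x | (x (nngr t) < 0)%R] = marginal (nngr t) g (~` `[0, +oo[%classic).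
Proof.
congr (P _); apply/seteqP; split => x /=; rewrite /Defs.coord in_itv/= andbT.
  by rewrite ltNge => /negP.
by move/negP; rewrite -ltNge.
Qed.

(** Suppose X_t < - e with probability p > 0. For s close to t with X_s >= 0 almost surely, X_s and
    X_t differ by more than e with probability at least p, against continuity in probability with
    [eta] equal to p. *)
Lemma nonneg_limit t : 0 <= t ->
  (forall e, 0 < e -> exists2 s, 0 <= s & `|s - t| < e /\ nonneg s) -> nonneg t.
Proof.
move=> t0 H.
have mneg s e := @measurable_path_lt R s e.
have E e : 0 < e -> P [set x | (x (nngr t) < - e)%R] = 0%E.
  move=> e0; apply/eqP; rewrite -measure_le0 leNgt; apply/negP => p0.
  pose p := fine (P [set x | (x (nngr t) < - e)%R]).
  have pE : P [set x | (x (nngr t) < - e)%R] = p%:E by rewrite fineK// fin_num_measure.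
  have {}p0 : 0 < p by rewrite -lte_fin -pE.
  have [delta d0 Hd] := levy_continuous g t0 e0 p0.
  have [s s0 [st ns]] := H _ d0; have := Hd s s0 st.
  rewrite -pE ltNge => /negP; apply.
  have mS : measurable ([set x | e < `|x (nngr s) - x (nngr t)|] : set Om).
    have mn : measurable_fun setT (fun x : Om => `|x (nngr s) - x (nngr t)|).
      by apply: (measurableT_comp (@normr_measurable R setT)); exact: measurable_path_incr.
    rewrite (_ : [set _ | _] = [set x : Om |
        (`]e, +oo[%classic : set R) `|x (nngr s) - x (nngr t)|]).
      exact: (preimage_measurable mn).
    by apply/seteqP; split => x /=; rewrite in_itv/= andbT.
  have ns0 : P [set x | (x (nngr s) < 0)%R] = 0%E by rewrite path_lt0.
  apply: (@le_trans _ _ (P ([set x | (e < `|x (nngr s) - x (nngr t)|)%R] `|` [set x | (x (nngr s) < 0)%R]))).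
    apply: le_measure; rewrite ?inE//; first exact: measurableU.
    move=> x /= xt; have [xs|xs] := ltP (x (nngr s)) 0; [by right|left].
    apply: lt_le_trans (ler_norm _).
    by rewrite -[ltLHS]add0r ler_ltD// ltrNr.
  by rewrite (le_trans (measureU2 P mS (mneg _ _)))// [X in (_ + X)%E]ns0 adde0.
apply: (@subset_measure0 _ _ _ P _ (\bigcup_m [set x : Om | x (nngr t) < - m.+1%:R^-1])) => //.
- have := preimage_measurable (@measurable_path R t) (measurableC (measurable_itv `[0, +oo[)).
  exact.
- by apply: bigcupT_measurable => m; exact: mneg.
- move=> x /=; rewrite /Defs.coord/= in_itv/= andbT => /negP; rewrite -ltNge => xt.
  exists (Num.truncn (- x (nngr t))^-1) => //=.
  by rewrite ltrNr invf_plt ?posrE ?oppr_gt0// truncnS_gt.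
- have /negligibleP H0 : P.-negligible (\bigcup_m [set x : Om | x (nngr t) < - m.+1%:R^-1]).
    apply: negligible_bigcup => m; apply/negligibleP => //; apply: E; by rewrite invr_gt0.
  by apply: H0; apply: bigcupT_measurable => m; exact: mneg.
Qed.

Hypothesis nonneg1 : nonneg 1.

(** If all n + 1 increments over the mesh 1/(n + 1) are negative, so is X_1. By independence the (n
    + 1)-st power of the probability of a negative increment is 0. *)
Lemma nonneg_fraction n : nonneg n.+1%:R^-1.
Proof.
have h0 : 0 <= n.+1%:R^-1 :> R by rewrite invr_ge0.
have mneg s := @measurable_path_lt R s 0.
pose p := fine (marginal (nngr n.+1%:R^-1) g (~` `[0%R, +oo[%classic)).
have pE : marginal (nngr n.+1%:R^-1) g (~` `[0%R, +oo[%classic) = p%:E.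
  by rewrite fineK// fin_num_measure//; exact: measurableC.
suff : (\prod_(j < n.+1) p%:E = 0)%E.
  rewrite prodEFin prodr_const card_ord => -[/eqP]; rewrite expf_eq0/= => /eqP p0.
  by rewrite /nonneg_supported pE p0.
have mN : measurable (~` `[0, +oo[%classic : set R) by exact: measurableC.
have mE : measurable ([set y | forall j, (j < n.+1)%N ->
    (~` `[0, +oo[%classic : set R) (y j)] : set (gprod nat R)).
  by apply: rects_measurable; apply: irects_rects; exists n.+1, (fun=> ~` `[0, +oo[%classic).
transitivity (power_prob (marginal (nngr n.+1%:R^-1) g)
    [set y | forall j, (j < n.+1)%N -> (~` `[0, +oo[%classic : set R) (y j)]).
  rewrite (power_prob_rect (marginal (nngr n.+1%:R^-1) g) n.+1
    (B := fun=> ~` `[0, +oo[%classic))//.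
  by apply: eq_bigr => j _; rewrite -pE.
rewrite -(grid_increments g h0 mE).
apply: (@subset_measure0 _ _ _ P _ (~` [set x : Om | x (nngr 0) = 0] `|` [set x : Om | x (nngr 1) < 0])).
- exact: (preimage_measurable (measurable_increments (fun i => i%:R * n.+1%:R^-1)) mE).
- by apply: measurableU => //; apply: measurableC; exact: measurable_start.
- move=> x /= H; have [x0|x0] := pselect (x (nngr 0) = 0); [right|by left].
  have -> : 1 = n.+1%:R * n.+1%:R^-1 :> R by rewrite mulfV.
  rewrite (increments_sum (t := fun i => i%:R * n.+1%:R^-1))//; last by rewrite mul0r.
  have {}H j : (j < n.+1)%N -> increments (fun i => i%:R * n.+1%:R^-1) x j < 0.
    by move=> /H /=; rewrite in_itv/= andbT => /negP; rewrite -ltNge.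
  rewrite big_ord_recl/=; apply: (@lt_le_trans _ _ (0 + 0)); last by rewrite addr0.
  apply: ltr_leD; first exact: H.
  by apply: sumr_le0 => i _; apply: ltW; apply: H; rewrite /= /bump add1n ltnS.
apply: probability_setU0 => //.
- by apply: measurableC; exact: measurable_start.
- exact: levy_start.
- by rewrite path_lt0.
Qed.

(** Nonnegativity passes from 1/(n + 1) to its multiples by summation, and to all times since these
    multiples are dense. *)
Lemma nonneg_levy t : 0 <= t -> nonneg t.
Proof.
move=> t0; apply: nonneg_limit => // e e0.
have [k /andP[kt tk]] := grid_below (Num.truncn e^-1) t0.
exists (k%:R * (Num.truncn e^-1).+1%:R^-1); first by rewrite mulr_ge0// invr_ge0.
split; last by apply: nonneg_grid; [rewrite invr_ge0|exact: nonneg_fraction].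
rewrite distrC ger0_norm ?subr_ge0//.
apply: (@le_lt_trans _ _ (Num.truncn e^-1).+1%:R^-1).
  by rewrite lerBlDl -{2}[_^-1]mul1r -mulrDl natr1.
by rewrite invf_plt ?posrE// truncnS_gt.
Qed.

Lemma laplace_levy_le s t lam : 0 <= lam -> 0 <= s <= t ->
  laplace (marginal (nngr t) g) lam <= laplace (marginal (nngr s) g) lam.
Proof.
move=> lam0 /andP[s0 st]; have bl := bmf_laplace_kernel lam0.
rewrite /laplace !Rexp_marginal//.
have mS : measurable ([set x | (`[0, +oo[%classic : set R) (x (nngr t) - x (nngr s))] : set Om).
  exact: (preimage_measurable (measurable_path_incr _ _)).
apply: (le_Rexp_on mS).
- rewrite probability_setC// [X in (_ - X)%E](_ : _ = 1%E) ?subee//.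
  rewrite -[t](subrK s) addrC levy_incr ?subr_ge0//; apply: nonneg_supported_itv.
  by apply: nonneg_levy; rewrite subr_ge0.
- exact: (bmf_comp bl (measurable_path _)).
- exact: (bmf_comp bl (measurable_path _)).
move=> x /=; rewrite in_itv/= andbT subr_ge0 => xst.
rewrite /laplace_kernel ler_expR lerN2 ler_wpM2l// ge_max !le_max xst/=.
by rewrite lexx orbT.
Qed.

(** The formula is exact at the times k/(n + 1). The transform is nonincreasing in t, so at a
    general t the logarithm is off by at most - c/(n + 1), for every n. *)
Lemma laplace_levy lam c : 0 <= lam -> laplace (marginal (nngr 1) g) lam = expR c ->
  forall t, 0 <= t -> laplace (marginal (nngr t) g) lam = expR (t * c).
Proof.
move=> lam0 lc.
have c0 : c <= 0.
  have /andP[_] := laplace01 (marginal (nngr 1) g) lam0.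
  by rewrite lc -[X in _ <= X]expR0 ler_expR.
have lh n : laplace (marginal (nngr n.+1%:R^-1) g) lam = expR (n.+1%:R^-1 * c).
  apply/eqP; rewrite -(@eqrXn2 _ n.+1)// ?expR_ge0//; last first.
    by have /andP[] := laplace01 (marginal (nngr n.+1%:R^-1) g) lam0.
  rewrite -laplace_grid ?invr_ge0//; last exact: nonneg_fraction.
  by rewrite mulfV// lc -expRM_natl mulrA mulfV// mul1r.
have lk n k : laplace (marginal (nngr (k%:R * n.+1%:R^-1)) g) lam =
    expR (k%:R * n.+1%:R^-1 * c).
  rewrite laplace_grid ?invr_ge0//; last exact: nonneg_fraction.
  by rewrite lh -expRM_natl mulrA.
move=> t t0; pose l := laplace (marginal (nngr t) g) lam.
have H n : exists k : nat, [/\ k%:R * n.+1%:R^-1 <= t <= k.+1%:R * n.+1%:R^-1,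
    expR (k.+1%:R * n.+1%:R^-1 * c) <= l & l <= expR (k%:R * n.+1%:R^-1 * c)].
  have [k kt] := grid_below n t0; exists k; have /andP[k1 k2] := kt.
  by rewrite -!lk; split => //; apply: laplace_levy_le; rewrite ?t0// mulr_ge0// invr_ge0.
have l0 : 0 < l by have [k [_ + _]] := H 0%N; apply: lt_le_trans; exact: expR_gt0.
suff E : ln l - t * c = 0 by rewrite -/l -(lnK l0) -(subrK (t * c) (ln l)) E add0r.
apply: (@le_inv_nat_eq0 _ _ (- c)) => n; have [k [/andP[k1 k2] l1 l2]] := H n.
move: l1 l2; rewrite -(lnK l0) !ler_expR => l1 l2.
have E : k.+1%:R * n.+1%:R^-1 * c = k%:R * n.+1%:R^-1 * c + n.+1%:R^-1 * c.
  by rewrite -mulrDl -[X in _ + X]mul1r -mulrDl natr1.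
have := ler_wnM2r c0 k1; have := ler_wnM2r c0 k2; rewrite E in l1 *.
rewrite ler_norml mulNr [c * _]mulrC opprK expRK => h1 h2.
move: l1 l2 h1 h2; move: (_ / _ * c) (_^-1 * c) (t * c) (ln l) => A B C D *.
by apply/andP; split; lra.
Qed.

End nonneg_levy.

(** * Characterisation of [LISPP] *)

Section lispp.
Variable R : realType.
Implicit Types (mu nu : pprobability R R) (gamma : levy_law R) (u : R).

Lemma char_expP d (T : measurableType d) (P : probability T R) (Y : T -> R) mu u :
  measurable_fun setT Y ->
  let a := \int[mu]_x cos (u * x) in let b := \int[mu]_x sin (u * x) in
  cintegral P (fun w => cexp (Complex 0 (u * Y w))) =
    cexp (cintegral mu (fun x : R => cexp (Complex 0 (u * x)) - 1)) <->
  \int[P]_w cos (u * Y w) = expR (a - 1) * cos b /\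
  \int[P]_w sin (u * Y w) = expR (a - 1) * sin b.
Proof.
move=> mY a b.
have -> : cintegral P (fun w => cexp (Complex 0 (u * Y w))) =
    Complex (\int[P]_w cos (u * Y w)) (\int[P]_w sin (u * Y w)).
  by congr Complex; apply: eq_Rexp => w; rewrite /= expR0 mul1r.
have -> : cintegral mu (fun x : R => cexp (Complex 0 (u * x)) - 1) = Complex (a - 1) b.
  congr Complex.
    rewrite -[X in _ - X](Rexp_cst mu) -RexpB; [|exact: bmf_cos|exact: bmf_cst].
    by apply: eq_Rexp => x; rewrite /= expR0 mul1r.
  by apply: eq_Rexp => x; rewrite /= expR0 mul1r subr0.
rewrite /cexp/=; split => [[-> ->]//|[-> ->]//].
Qed.

Lemma time_one : (1%:nng : {nonneg R}) = nngr 1.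
Proof. by apply: val_inj; rewrite /= max_l. Qed.

(** On the half-line the time-one marginal fixes the Laplace transforms at all times, thus all
    one-time marginals, thus the Lévy law. *)
Lemma lispp_unique gamma mu : nonneg_supported mu ->
  marginal (nngr 1) gamma ≡μ marginal (nngr 1) (cp_levy mu) ->
  levy_prob gamma ≡μ levy_prob (cp_levy mu).
Proof.
move=> mu0 H; apply: levy_law_unique => t.
have n1 : nonneg_supported (marginal (nngr 1) gamma).
  by rewrite /nonneg_supported [LHS]H; [exact: nonneg_supported_cp_levy|exact: measurableC].
apply: laplace_unique => [||k].
- by rewrite -(nngr_num t); exact: nonneg_levy.
- exact: nonneg_supported_cp_levy.
rewrite laplace_cp_levy// -{1}(nngr_num t).
apply: laplace_levy => //; rewrite -[laplace mu _ - 1]mul1r -[X in expR (X * _)](@nngrE R 1)//.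
by rewrite -laplace_cp_levy//; exact: Rexp_eq.
Qed.

Lemma has_law_marginal gamma d (T : measurableType d) (P : probability T R)
    (X : {nonneg R} -> {RV P >-> R}) : has_law P X gamma ->
  forall f, bmf f -> \int[P]_w f (X 1%:nng w) = \int[(marginal (nngr 1) gamma : probability R R)]_x f x.
Proof.
move=> XP f bf; have mX : measurable_fun setT (X 1%:nng) by [].
rewrite -(Rexp_law P mX bf); apply: Rexp_eq => B mB.
transitivity (P (trajectory X @^-1` [set x | B (x 1%:nng)])) => //.
rewrite XP; first by rewrite -time_one.
exact: (preimage_measurable (@measurable_coord _ R _)).
Qed.

(** The characteristic function in the definition is that of the compound Poisson process at time 1,
    so [char_unique] identifies the time-one marginals and [lispp_unique] the laws. *)
Lemma LISPPP (A : set (pprobability R R)) gamma :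
  (forall mu : probability R R, A mu -> nonneg_supported mu) ->
  LISPP A gamma <-> exists2 mu, A mu & levy_prob gamma ≡μ levy_prob (cp_levy mu).
Proof.
move=> A0; split.
  move=> [d [Om0 [P [X [_ XP [mu Amu H]]]]]]; exists mu => //.
  have mu0 := A0 _ Amu; apply: lispp_unique => //.
  have E u : \int[(marginal (nngr 1) gamma : probability R R)]_x cos (u * x) =
      \int[(marginal (nngr 1) (cp_levy mu) : probability R R)]_x cos (u * x) /\
    \int[(marginal (nngr 1) gamma : probability R R)]_x sin (u * x) =
      \int[(marginal (nngr 1) (cp_levy mu) : probability R R)]_x sin (u * x).
    have mX : measurable_fun setT (X 1%:nng) by [].
    have [H1 H2] := (char_expP P mu u mX).1 (H u).
    have [H3 H4] := Rexp_cp1_trig u mu0.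
    have cpL : has_law (cp_prob mu) (cpZ mu) (cp_levy mu) by move=> B mB.
    rewrite -(has_law_marginal XP (bmf_cos u)) -(has_law_marginal XP (bmf_sin u)).
    rewrite -(has_law_marginal cpL (bmf_cos u)) -(has_law_marginal cpL (bmf_sin u)).
    by rewrite H1 H2 /= H3 H4.
  by apply: char_unique => u; have [] := E u.
move=> [mu Amu H]; have mu0 := A0 _ Amu.
exists _, _, (cp_prob mu), (cpZ mu); split.
- exact: levy_process_cp.
- by move=> B mB; rewrite H.
exists mu => // u; apply/char_expP => //.
exact: Rexp_cp1_trig.
Qed.

End lispp.

Section integral_on.
Import HBSimple HBNNSimple.
Context d (T : measurableType d) (R : realType) (P : probability T R).
Local Open Scope ereal_scope.

(* [f] and [h] are not assumed measurable: the lemma is applied to the map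
   [gamma |-> gamma B] on [levy_laws], whose sigma-algebra only makes the
   evaluations of one-time marginals measurable. *)
Lemma ge0_le_integral_on (S : set T) (f h : T -> \bar R) : measurable S -> P (~` S) = 0 ->
  (forall x, 0 <= f x) -> (forall x, 0 <= h x) -> (forall x, S x -> f x <= h x) ->
  \int[P]_x f x <= \int[P]_x h x.
Proof.
move=> mS PS f0 h0 fh; rewrite !ge0_integralTE//.
apply: ge_ereal_sup => _ [s sf <-].
(* Cutting a simple function below f down to S leaves its integral unchanged and puts it below h
   everywhere. *)
pose s' := proj_nnsfun s mS.
have -> : sintegral P s = sintegral P s'.
  rewrite -!integralT_nnsfun; apply: ge0_ae_eq_integral => //.
  - by apply/measurable_EFinP.
  - by apply/measurable_EFinP.
  - by move=> x _; rewrite lee_fin.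
  - by move=> x _; rewrite lee_fin.
  exists (~` S); split => //; first exact: measurableC.
  move=> x /= Hx Sx; apply: Hx => _.
  by rewrite /s' mindicE mem_set// mulr1.
apply: ereal_sup_ubound; exists s' => // x.
rewrite /s' /= mindicE; have [Sx|Sx] := pselect (S x).
  by rewrite mem_set// mulr1 (le_trans (sf x))// fh.
by rewrite memNset// mulr0.
Qed.

Lemma ge0_eq_integral_on (S : set T) (f h : T -> \bar R) : measurable S -> P (~` S) = 0 ->
  (forall x, 0 <= f x) -> (forall x, 0 <= h x) -> (forall x, S x -> f x = h x) ->
  \int[P]_x f x = \int[P]_x h x.
Proof.
move=> mS PS f0 h0 fh; apply/eqP; rewrite eq_le.
by rewrite !(ge0_le_integral_on mS PS)// => x Sx; rewrite fh.
Qed.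

End integral_on.

Section saturation.
Context d (T : measurableType d) (R : realType).
Implicit Types P Q : pprobability T R.

(** The generators only test values on measurable sets, and being saturated is stable under the
    operations of a sigma-algebra. *)
Lemma measurable_saturated (C : set (pprobability T R)) P Q : measurable C ->
  (P : probability T R) ≡μ Q -> C P <-> C Q.
Proof.
move=> mC PQ.
suff : measurable `<=` [set C : set (pprobability T R) | C P <-> C Q] by exact.
apply: smallest_sub => //.
  split => /=.
  - by [].
  - by move=> D D12; split => -[_ nD]; split => // /D12.
  - by move=> F FH; split => -[n _ Fn]; exists n => //; apply/FH.
by move=> _ [r _ [U mU <-]]; rewrite /= /mset /= (PQ U mU).
Qed.

Lemma measurable_saturated_fun d' (S : measurableType d') (K : pprobability T R -> pprobability S R) P Q :
  measurable_fun setT K -> (P : probability T R) ≡μ Q -> (K P : probability S R) ≡μ K Q.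
Proof.
move=> mK PQ B mB /=.
have mB' : measurable [set P' | (K P' : probability S R) B = (K P : probability S R) B].
  have := measurable_kernel_ev mK mB measurableT (emeasurable_set1 ((K P : probability S R) B)).
  by rewrite setTI.
exact/esym/(measurable_saturated mB' PQ).1.
Qed.

End saturation.

(** * Uniqueness of the mixing measure *)

Section mixing_measure_unique.
Context d (T : measurableType d) (R : realType).
Implicit Types Th : probability (pprobability T R) R.

Definition evaluation_rects : set (set (pprobability T R)) :=
  [set A | exists n (U : nat -> set T) (B : nat -> set R),
    [/\ forall j, measurable (U j), forall j, measurable (B j) &
    A = [set P : pprobability T R | forall j, (j < n)%N -> B j (fine ((P : probability T R) (U j)))]]].

Lemma measurable_fine_ev (U : set T) : measurable U ->
  measurable_fun setT (fun P : pprobability T R => fine ((P : probability T R) U)).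
Proof.
move=> mU; apply: (@measurableT_comp _ _ _ _ _ _ (@fine R)) => //.
exact: measurable_pprobability_ev.
Qed.

Lemma evaluation_rects_setI : setI_closed evaluation_rects.
Proof.
move=> _ _ [n [U [B [mU mB ->]]]] [m [V [C [mV mC ->]]]].
exists (n + m)%N, (fun j => if (j < n)%N then U j else V (j - n)%N),
  (fun j => if (j < n)%N then B j else C (j - n)%N); split.
- by move=> j; case: ifP.
- by move=> j; case: ifP.
apply/seteqP; split => [x [xB xC] j jnm|x xBC].
  case: ifPn => [/xB//|]; rewrite -leqNgt => nj.
  by apply: xC; rewrite ltn_subLR.
split=> j jn; first by have := xBC j; rewrite jn; apply; rewrite ltn_addr.
have nj : (n + j < n)%N = false by rewrite ltnNge leq_addr.
by have := xBC (n + j)%N; rewrite nj addKn; apply; rewrite ltn_add2l.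
Qed.

Lemma evaluation_rects_measurable : evaluation_rects `<=` measurable.
Proof.
move=> _ [n [U [B [mU mB ->]]]].
apply: measurable_forall_lt => j.
exact: (preimage_measurable (measurable_fine_ev (mU j)) (mB j)).
Qed.

Lemma measurable_evaluation_rects : @measurable _ (pprobability T R) = <<s evaluation_rects >>.
Proof.
apply/seteqP; split.
  apply: smallest_sub; first exact: smallest_sigma_algebra.
  move=> _ [r _ [U mU <-]]; apply: sub_sigma_algebra.
  exists 1%N, (fun=> U), (fun=> `]-oo, r[%classic); split => //.
  apply/seteqP; split => [P /= PU j _|P /(_ 0%N erefl)];
    by rewrite /mset/= in_itv/= -lte_fin fineK// fin_num_measure.
apply: smallest_sub; first exact: sigma_algebra_measurable.
exact: evaluation_rects_measurable.
Qed.

(* The uniqueness part of de Finetti's theorem. *)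
Lemma mixing_measure_unique Th1 Th2 :
  (forall n (U : nat -> set T), (forall j, measurable (U j)) ->
    \int[Th1]_P (\prod_(j < n) fine ((P : probability T R) (U j))) =
    \int[Th2]_P (\prod_(j < n) fine ((P : probability T R) (U j)))) ->
  Th1 ≡μ Th2.
Proof.
move=> H; apply: (probability_eq_pi measurable_evaluation_rects evaluation_rects_setI).
move=> _ [n [U [B [mU mB ->]]]].
apply: (@joint_moments_unique _ _ _ _ _ Th1 Th2
  (fun j (P : pprobability T R) => fine ((P : probability T R) (U j)))
  (fun j (P : pprobability T R) => fine ((P : probability T R) (U j)))) => //.
- by move=> j; exact: measurable_fine_ev.
- by move=> j; exact: measurable_fine_ev.
- move=> j P; rewrite fine_ge0//= -lee_fin fineK ?fin_num_measure//.
  exact: probability_le1.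
- move=> j P; rewrite fine_ge0//= -lee_fin fineK ?fin_num_measure//.
  exact: probability_le1.
(* Powers become plain products: in [s] each [U j] is repeated [k j] times, and the hypothesis
   applies to this longer list. *)
move=> k; pose s := flatten [seq nseq (k j) (U j) | j <- iota 0 n].
have ms j : measurable (nth setT s j).
  have [js|js] := ltnP j (size s); last by rewrite nth_default.
  have /flattenP[_ /mapP[i _ ->]] := mem_nth setT js.
  by rewrite mem_nseq => /andP[_ /eqP ->].
have E (P : pprobability T R) : \prod_(i < n) fine ((P : probability T R) (U i)) ^+ k i =
    \prod_(j < size s) fine ((P : probability T R) (nth setT s j)).
  rewrite -(big_mkord xpredT (fun j => fine ((P : probability T R) (nth setT s j)))).
  rewrite -(big_nth setT xpredT (fun V => fine ((P : probability T R) V))).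
  rewrite big_flatten big_map -(big_mkord xpredT (fun j => fine ((P : probability T R) (U j)) ^+ k j)).
  rewrite /index_iota subn0; apply: eq_bigr => i _.
  by rewrite big_nseq; elim: (k i) => [|m IH]; rewrite ?expr0// exprS IH.
under eq_Rexp do rewrite E.
by under [RHS]eq_Rexp do rewrite E; exact: H.
Qed.

End mixing_measure_unique.

(** * Goodness *)

Section cp_laws.
Variable R : realType.
Implicit Types (mu nu : pprobability R R) (A L : set (pprobability R R)).

Definition cp_one mu : pprobability R R := marginal (nngr 1) (cp_levy mu).

Lemma measurable_cp_one : measurable_fun setT cp_one.
Proof. exact: (measurableT_comp (measurable_marginal (nngr 1)) (@measurable_cp_levy R)). Qed.

Lemma laplace_cp_one mu k : laplace (cp_one mu) k%:R = expR (laplace mu k%:R - 1).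
Proof. by rewrite /cp_one laplace_cp_levy// nngrE// mul1r. Qed.

Lemma recover_cp_one mu : nonneg_supported mu -> (recover (cp_one mu) : probability R R) ≡μ mu.
Proof. by move=> mu0; apply: recoverE => // k; exact: laplace_cp_one. Qed.

Lemma nonneg_supported_eq mu nu : (mu : probability R R) ≡μ nu ->
  nonneg_supported mu -> nonneg_supported nu.
Proof. by move=> H mu0; rewrite /nonneg_supported -[LHS]H//; exact: measurableC. Qed.

(** The image of A under [cp_one], up to [≡μ], expressed through the left inverse so that its
    measurability is visible. *)
Definition cp_laws A : set (pprobability R R) :=
  [set nu | [/\ nonneg_supported nu, A (recover nu) &
    forall k : nat, laplace nu k%:R = expR (laplace (recover nu) k%:R - 1)]].

Lemma measurable_nonneg : measurable [set nu : pprobability R R | nonneg_supported nu].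
Proof.
have := @measurable_pprobability_ev _ R R (~` `[0, +oo[%classic) (measurableC (measurable_itv _)).
move=> /(_ measurableT [set 0%E] (emeasurable_set1 _)).
by rewrite setTI.
Qed.

Lemma measurable_cp_laws A : measurable A -> measurable (cp_laws A).
Proof.
move=> mA; have mrA : measurable (@recover R @^-1` A).
  exact: (preimage_measurable (@measurable_recover R) mA).
rewrite (_ : cp_laws A = [set nu | nonneg_supported nu] `&` (@recover R @^-1` A) `&`
    \bigcap_k [set nu | laplace nu k%:R - expR (laplace (recover nu) k%:R - 1) = 0]).
  apply: measurableI; first by apply: measurableI => //; exact: measurable_nonneg.
  apply: bigcapT_measurable => k.
  have mf : measurable_fun setT
      (fun nu => laplace nu k%:R - expR (laplace (recover nu) k%:R - 1)).
    apply: measurable_funB; first exact: measurable_laplace.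
    apply: measurableT_comp => //; apply: measurable_funB => //.
    exact: (measurableT_comp (measurable_laplace (ler0n R k)) (@measurable_recover R)).
  exact: (preimage_measurable mf (measurable_set1 0)).
apply/seteqP; split => [nu [nu0 Anu H]|nu [[nu0 Anu] H]].
  by split => // k _ /=; rewrite H subrr.
by split => // k; apply/eqP; rewrite -subr_eq0; apply/eqP; exact: (H k I).
Qed.

Section sub_nonneg.
Variable A : set (pprobability R R).
Hypothesis mA : measurable A.
Hypothesis A0 : forall mu : probability R R, A mu -> nonneg_supported mu.

Lemma cp_lawsP nu : cp_laws A nu <-> exists2 mu, A mu & (nu : probability R R) ≡μ cp_one mu.
Proof.
split=> [[nu0 Anu H]|[mu Amu numu]].
  exists (recover nu) => //; apply: laplace_unique => // [|k].
    exact: nonneg_supported_cp_levy.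
  by rewrite H laplace_cp_one.
have numu' : (cp_one mu : probability R R) ≡μ nu by move=> B mB; rewrite numu.
have nuE k : laplace nu k%:R = expR (laplace mu k%:R - 1).
  by rewrite -laplace_cp_one; exact: Rexp_eq.
have rE : (recover nu : probability R R) ≡μ mu by apply: recoverE => //; exact: A0.
split.
- by apply: nonneg_supported_eq numu' _; exact: nonneg_supported_cp_levy.
- exact/(measurable_saturated mA rE).
- by move=> k; rewrite nuE; congr (expR (_ - 1)); apply/esym; exact: Rexp_eq.
Qed.

Lemma LISPP_cp_laws : LISPP A = marginal (nngr 1) @^-1` cp_laws A.
Proof.
apply/seteqP; split=> gamma /=.
  move=> /(LISPPP _ A0) [mu Amu H]; apply/cp_lawsP; exists mu => // B mB.
  rewrite /cp_one; have := H (Defs.coord (nngr 1) @^-1` B); apply.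
  exact: (preimage_measurable (@measurable_coord _ R _)).
move=> /cp_lawsP[mu Amu H]; apply/(LISPPP _ A0); exists mu => //.
by apply: lispp_unique => //; exact: A0.
Qed.

Lemma time_one_laws_LISPP : time_one_laws (LISPP A) = cp_laws A.
Proof.
rewrite LISPP_cp_laws /time_one_laws time_one; apply/seteqP; split => nu /=.
  move=> [gamma Hg H]; apply/(measurable_saturated (measurable_cp_laws mA) H).
  exact: Hg.
move=> nuA; have /cp_lawsP[mu Amu H] := nuA.
exists (cp_levy mu); last exact: H.
by have := (measurable_saturated (measurable_cp_laws mA) H).1 nuA.
Qed.

Lemma measurable_LISPP : measurable (LISPP A).
Proof.
rewrite LISPP_cp_laws.
have := measurable_marginal (nngr 1) measurableT (measurable_cp_laws mA).
by rewrite setTI.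
Qed.

End sub_nonneg.
End cp_laws.

Section discrete.
Variable R : realType.
Implicit Types (L : set (pprobability R R)) (Th : probability (pprobability R R) R).

Definition laplace_identifiable L := forall Th1 Th2, Th1 L = 1%E -> Th2 L = 1%E ->
  (forall k n : nat, \int[Th1]_mu laplace mu k%:R ^+ n = \int[Th2]_mu laplace mu k%:R ^+ n) ->
  Th1 ≡μ Th2.

Lemma laplace_power_sum (mu : pprobability R R) n (lam : R) : 0 <= lam -> nonneg_supported mu ->
  \int[power_prob mu]_x laplace_kernel lam (\sum_(j < n) x j) = laplace mu lam ^+ n.
Proof.
move=> lam0 mu0; have bl := bmf_laplace_kernel lam0.
have bp : bmf (fun y : gprod nat R => \prod_(i < n) laplace_kernel lam (y i)).
  apply: (@bmf_prod _ (gprod nat R) R n (fun i y => laplace_kernel lam (y i))) => i.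
  exact: bmf_gcoord.
transitivity (\int[power_prob mu]_x (\prod_(j < n) laplace_kernel lam (x j))).
  apply: (eq_Rexp_on (measurable_first_nonneg n) (power_prob_nonneg n mu0)) => //.
    exact: (bmf_comp bl (measurable_sum_seq _)).
  move=> x x0; have {}x0 (j : 'I_n) : 0 <= x j.
    by have := x0 j (ltn_ord j); rewrite /= in_itv/= andbT.
  rewrite /laplace_kernel max_l ?sumr_ge0// mulr_sumr -sumrN expR_sum.
  by apply: eq_bigr => i _; rewrite max_l.
rewrite (Rexp_power_prod mu n (g := fun=> laplace_kernel lam))//.
by rewrite prodr_const card_ord.
Qed.

Lemma nonneg_power_sum (mu : pprobability R R) n : nonneg_supported mu ->
  power_prob mu [set x | (~` `[0, +oo[%classic : set R) (\sum_(j < n) x j)] = 0%E.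
Proof.
move=> mu0; have mS := @measurable_first_nonneg R n.
apply: (subset_measure0 _ (measurableC mS)) (power_prob_nonneg n mu0).
  exact: (preimage_measurable (measurable_sum_seq _) (measurableC (measurable_itv `[0, +oo[))).
move=> x /= + H; apply; rewrite in_itv/= andbT; apply: sumr_ge0 => i _.
by have := H i (ltn_ord i); rewrite /= in_itv/= andbT.
Qed.

Lemma law_iid_mixture Th d (T : measurableType d) (P : probability T R)
    (X : nat -> {RV P >-> R}) (f : gprod nat R -> R) : iid_mixture Th P X -> bmf f ->
  \int[P]_w f (fun j => X j w) = \int[Th]_mu \int[power_prob (mu : probability R R)]_x f x.
Proof.
move=> XP bf.
have mX : measurable_fun setT ((fun w j => X j w) : T -> gprod nat R).
  by apply: measurable_gprod => j.
have mK := @measurable_power_prob _ R R.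
rewrite -(Rexp_mixture Th mK bf) -(Rexp_law P mX bf); apply: Rexp_eq => B mB.
transitivity (P (trajectory X @^-1` (B : set (prod_space nat R)))) => //.
rewrite XP//; apply: eq_integral => theta _.
exact: iid_powerE.
Qed.

Lemma laplace_mixture_sum Th L n (lam : R) : 0 <= lam -> measurable L -> Th L = 1%E ->
  (forall mu : probability R R, L mu -> nonneg_supported mu) ->
  \int[Th]_mu (\int[power_prob (mu : probability R R)]_x laplace_kernel lam (\sum_(j < n) x j)) =
  \int[Th]_mu laplace mu lam ^+ n.
Proof.
move=> lam0 mL ThL L0.
apply: (eq_Rexp_on mL (prob1_setC mL ThL)).
- apply: (measurable_kernel_Rexp (@measurable_power_prob _ R R)).
  exact: (bmf_comp (bmf_laplace_kernel lam0) (measurable_sum_seq _)).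
- apply: bmfX; apply: bmf01 => [|mu]; first exact: measurable_laplace.
  exact: laplace01.
by move=> mu Lmu; exact/laplace_power_sum/L0.
Qed.

(** To apply goodness to two given mixing measures, the mixtures are realised by the coordinates of
    the sequence space. The sums then have equal laws because these live on the half-line and have
    equal Laplace transforms. *)
Lemma good_discreteP L : measurable L ->
  (forall mu : probability R R, L mu -> nonneg_supported mu) ->
  good_discrete L <-> laplace_identifiable L.
Proof.
move=> mL L0; split=> [[_ G] Th1 Th2 Th1L Th2L H|G].
  have mK := @measurable_power_prob _ R R.
  pose P Th : probability (prod_space nat R) R := mixture_prob Th mK.
  pose X Th j : {RV (P Th) >-> R} := Defs.coord j.
  have XP Th : iid_mixture Th (P Th) (X Th).
    move=> B mB; transitivity (mixture_prob Th mK B) => //.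
    by apply: eq_integral => theta _; exact/esym/iid_powerE.
  apply: (G Th1 Th2 _ _ _ (P Th1) _ (P Th2) (X Th1) (X Th2)) => // n _.
  have mS := measurable_sum_seq (R := R) n.
  have nonneg Th : Th L = 1%E -> nonneg_supported (law (mixture_prob Th mK) mS).
    move=> ThL; transitivity (\int[Th]_mu (power_prob (mu : probability R R)
      [set x | (~` `[0%R, +oo[%classic : set R) (\sum_(j < n) x j)%R]))%E => //.
    transitivity (\int[Th]_mu cst 0 mu)%E; last exact: integral0.
    apply: (ge0_eq_integral_on mL (prob1_setC mL ThL)) => // mu Lmu.
    exact/nonneg_power_sum/L0.
  have : law (mixture_prob Th1 mK) mS ≡μ law (mixture_prob Th2 mK) mS.
    apply: laplace_unique; [exact: nonneg|exact: nonneg|move=> k].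
    have bl := bmf_laplace_kernel (ler0n R k).
    have bs := bmf_comp bl mS.
    by rewrite /laplace !(Rexp_law _ mS bl) !(Rexp_mixture _ mK bs) !(laplace_mixture_sum _ _ mL).
  by move=> HS B mB; exact: HS.
split=> // Th1 Th2 d1 d2 O1 P1 O2 P2 X Y Th1L Th2L XP YP H.
(* Equality of sums is given for n >= 1; the moment of order 0 is 1 on both sides. *)
apply: G => // k [|n]; first by under eq_Rexp do rewrite expr0; under [RHS]eq_Rexp do rewrite expr0; rewrite !Rexp_cst.
have bl := bmf_laplace_kernel (ler0n R k).
rewrite -!(laplace_mixture_sum n.+1 _ mL)//.
have bs := bmf_comp bl (measurable_sum_seq (R := R) n.+1).
rewrite -(law_iid_mixture XP bs) -(law_iid_mixture YP bs).
have msum d (T : measurableType d) (P : probability T R) (Z : nat -> {RV P >-> R}) :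
    measurable_fun setT (fun w => \sum_(j < n.+1) Z j w).
  have mZ : measurable_fun setT ((fun w j => Z j w) : T -> gprod nat R).
    by apply: measurable_gprod => j.
  exact: (measurableT_comp (measurable_sum_seq _) mZ).
have mX := msum _ _ _ X; have mY := msum _ _ _ Y.
rewrite -(Rexp_law P1 mX bl) -(Rexp_law P2 mY bl); apply: Rexp_eq => B mB.
exact: H.
Qed.

End discrete.

Section full_measure.
Context d d' (T : measurableType d) (S : measurableType d') (R : realType).

Lemma law_full (P : probability T R) (f : T -> S) (mf : measurable_fun setT f)
    (L : set T) (C : set S) : measurable L -> measurable C -> P L = 1%E ->
  (forall x, L x -> C (f x)) -> law P mf C = 1%E.
Proof.
move=> mL mC PL LC; apply/eqP; rewrite eq_le probability_le1//=.
rewrite -PL; apply: le_measure; rewrite ?inE//.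
exact: (preimage_measurable mf mC).
Qed.

End full_measure.

Section clamp.
Variable R : realType.

Lemma clamp01 (x : R) : 0 <= clamp x <= 1.
Proof. by rewrite /clamp le_max lexx/= ge_max ler01 ge_min lexx. Qed.

Lemma clamp_id (x : R) : 0 <= x <= 1 -> clamp x = x.
Proof. by move=> /andP[x0 x1]; rewrite /clamp min_r// max_r. Qed.

Lemma bmf_clamp d (T : measurableType d) (f : T -> R) : measurable_fun setT f ->
  bmf (fun x => clamp (f x)).
Proof.
move=> mf; apply: bmf01 => [|x]; last exact: clamp01.
by apply: measurable_maxr => //; exact: measurable_minr.
Qed.

(** Moments determine the integrals of bounded functions on the whole line. Clamping makes exp(t (y
    - 1)) and 1 + ln y bounded without changing them at the values that occur. *)
Lemma bmf_expR_clamp (t : R) : 0 <= t -> bmf (fun y : R => expR (t * (clamp y - 1))).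
Proof.
move=> t0; apply: bmf01 => [|x].
  apply: measurableT_comp => //; apply: measurable_funM => //.
  by apply: measurable_funB => //; exact: (bmf_clamp (@measurable_id _ R setT)).1.
rewrite expR_ge0/= expR_le1 -oppr_ge0 -mulrN mulr_ge0// opprB subr_ge0.
by have /andP[] := clamp01 x.
Qed.

Lemma bmf_clamp_ln n : bmf (fun y : R => clamp (1 + ln y) ^+ n).
Proof.
apply: bmfX; apply: bmf_clamp; apply: measurable_funD => //; exact: measurable_ln.
Qed.

End clamp.

Section goodness.
Variables (R : realType) (A : set (pprobability R R)).
Hypothesis mA : measurable A.
Hypothesis A0 : forall mu : probability R R, A mu -> nonneg_supported mu.
Implicit Types Th : probability (pprobability R R) R.

Let mlaplace (k : nat) : measurable_fun setT (fun mu : pprobability R R => laplace mu k%:R).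
Proof. exact: measurable_laplace. Qed.

Let laplace_nat01 (k : nat) (mu : pprobability R R) : 0 <= laplace mu k%:R <= 1.
Proof. exact: laplace01. Qed.

(** For each k separately, the moments determine the law of L_mu(k) under the mixing measure, hence
    the integral of any bounded function of it. *)
Let laplace_moments_transfer Th1 Th2 k (f : R -> R) : bmf f ->
  (forall n : nat, \int[Th1]_mu laplace mu k%:R ^+ n = \int[Th2]_mu laplace mu k%:R ^+ n) ->
  \int[Th1]_mu f (laplace mu k%:R) = \int[Th2]_mu f (laplace mu k%:R).
Proof.
move=> bf H; exact: (moments_unique_Rexp (mlaplace k) (mlaplace k) (laplace_nat01 k)
  (laplace_nat01 k) H bf).
Qed.

(** On A, [recover] undoes [cp_one] up to [≡μ]. Since measurable sets of laws are saturated, B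
    agrees on A with its preimage under the composite. *)
Lemma cp_one_law_inj Th1 Th2 : Th1 A = 1%E -> Th2 A = 1%E ->
  law Th1 (@measurable_cp_one R) ≡μ law Th2 (@measurable_cp_one R) -> Th1 ≡μ Th2.
Proof.
move=> Th1A Th2A H B mB.
have mrB : measurable (@recover R @^-1` B).
  exact: (preimage_measurable (@measurable_recover R) mB).
have mcrB : measurable (@cp_one R @^-1` (@recover R @^-1` B)).
  exact: (preimage_measurable (@measurable_cp_one R) mrB).
have E Th : Th A = 1%E -> Th B = law Th (@measurable_cp_one R) (@recover R @^-1` B).
  move=> ThA; transitivity (Th (@cp_one R @^-1` (@recover R @^-1` B))) => //.
  apply: (probability_eq_setI mA mB mcrB (prob1_setC mA ThA)).
  apply/seteqP; split => mu /= [Hmu Amu]; split => //;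
    have rE := recover_cp_one (A0 Amu).
    exact/(measurable_saturated mB rE).
  by move/(measurable_saturated mB rE) : Hmu.
transitivity (law Th1 (@measurable_cp_one R) (@recover R @^-1` B)); first exact: E.
transitivity (law Th2 (@measurable_cp_one R) (@recover R @^-1` B)); first exact: H.
exact/esym/E.
Qed.

(** In each direction the mixing measures are pushed, by [cp_one] or [recover], to the set where
    identifiability is assumed, and the equality is pulled back along the other map. The moments
    match because L_nu(k) and L_mu(k) are functions of each other. *)
Lemma identifiable_cp_laws : laplace_identifiable A <-> laplace_identifiable (cp_laws A).
Proof.
have mC := measurable_cp_laws mA; split=> G Th1 Th2 Th1A Th2A H; last first.
  apply: cp_one_law_inj => //; apply: G => [||k n].
  - by apply: law_full mC Th1A _ => // mu Amu; apply/cp_lawsP => //; exists mu.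
  - by apply: law_full mC Th2A _ => // mu Amu; apply/cp_lawsP => //; exists mu.
  have bX : bmf (fun nu : pprobability R R => laplace nu k%:R ^+ n).
    by apply: bmfX; exact: bmf01.
  rewrite !(Rexp_law _ _ bX).
  have E Th : \int[Th]_mu laplace (cp_one mu) k%:R ^+ n =
      \int[Th]_mu expR (n%:R * (clamp (laplace mu k%:R) - 1)).
    by apply: eq_Rexp => mu; rewrite laplace_cp_one -expRM_natl clamp_id.
  rewrite !E.
  exact: (laplace_moments_transfer (bmf_expR_clamp (ler0n R n)) (H k)).
have H' : law Th1 (@measurable_recover R) ≡μ law Th2 (@measurable_recover R).
  apply: G => [||k n].
  - by apply: law_full mA Th1A _ => // nu [].
  - by apply: law_full mA Th2A _ => // nu [].
  have bX : bmf (fun nu : pprobability R R => laplace nu k%:R ^+ n).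
    by apply: bmfX; exact: bmf01.
  rewrite !(Rexp_law _ _ bX).
  have E Th : Th (cp_laws A) = 1%E -> \int[Th]_nu laplace (recover nu) k%:R ^+ n =
      \int[Th]_nu clamp (1 + ln (laplace nu k%:R)) ^+ n.
    move=> ThA; apply: (eq_Rexp_on mC (prob1_setC mC ThA)).
    - exact: (bmf_comp bX (@measurable_recover R)).
    - exact: (bmf_comp (bmf_clamp_ln R n) (mlaplace k)).
    by move=> nu [_ _ ->]; rewrite expRK addrC subrK clamp_id.
  rewrite !E//.
  exact: (laplace_moments_transfer (bmf_clamp_ln R n) (H k)).
move=> B mB.
have mcB : measurable (@cp_one R @^-1` B).
  exact: (preimage_measurable (@measurable_cp_one R) mB).
have mrcB : measurable (@recover R @^-1` (@cp_one R @^-1` B)).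
  exact: (preimage_measurable (@measurable_recover R) mcB).
have E Th : Th (cp_laws A) = 1%E -> Th B = law Th (@measurable_recover R) (@cp_one R @^-1` B).
  move=> ThA; transitivity (Th (@recover R @^-1` (@cp_one R @^-1` B))) => //.
  apply: (probability_eq_setI mC mB mrcB (prob1_setC mC ThA)).
  have cE nu : cp_laws A nu -> (nu : probability R R) ≡μ cp_one (recover nu).
    move=> [nu0 Anu nuE]; apply: laplace_unique => // [|k].
      exact: nonneg_supported_cp_levy.
    by rewrite nuE laplace_cp_one.
  apply/seteqP; split => nu /= [Hnu Cnu]; split => //.
    by move/(measurable_saturated mB (cE nu Cnu)) : Hnu.
  exact/(measurable_saturated mB (cE nu Cnu)).
transitivity (law Th1 (@measurable_recover R) (@cp_one R @^-1` B)); first exact: E.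
transitivity (law Th2 (@measurable_recover R) (@cp_one R @^-1` B)); first exact: H'.
exact/esym/E.
Qed.

Let psi (gamma : levy_laws R) : pprobability R R := recover (marginal (nngr 1) gamma).

Let mpsi : measurable_fun setT psi.
Proof.
exact: (measurableT_comp (@measurable_recover R) (@measurable_marginal R (nngr 1))).
Qed.

Let psiP gamma : LISPP A gamma -> A (psi gamma) /\
  levy_prob gamma ≡μ levy_prob (cp_levy (psi gamma)).
Proof.
rewrite (LISPP_cp_laws mA A0) => -[g0 Ag gE]; split => //.
apply: lispp_unique; first exact: A0.
apply: laplace_unique => // [|k]; first exact: nonneg_supported_cp_levy.
by rewrite gE -laplace_cp_one.
Qed.

Let mLA := measurable_LISPP mA A0.

(** Replaces the integrand on [levy_laws] by a measurable function of the recovered jump law, so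
    that the integral depends on the image of [Th] under [psi] only. *)
Let integral_psi (Th : probability (levy_laws R) R) (B : set (path_space R)) :
  Th (LISPP A) = 1%E -> measurable B ->
  (\int[Th]_gamma levy_prob gamma B)%E = (\int[law Th mpsi]_mu cp_law mu B)%E.
Proof.
move=> ThL mB.
have mcB := measurable_kernel_ev (@measurable_cp_law R) mB.
have cB0 (mu : pprobability R R) : (0 <= cp_law mu B)%E by exact: measure_ge0.
have -> := integral_law Th mpsi mcB cB0.
apply: (ge0_eq_integral_on mLA (prob1_setC mLA ThL)) => [gamma|gamma|gamma /psiP[_ H]].
- exact: measure_ge0.
- exact: cB0.
- exact: H.
Qed.

(** At the integer time n the transform exp(n (L_mu(k) - 1)) is the n-th power of the one at time 1,
    so these times give the moments of the time-one transform under [Th]. *)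
Let laplace_levy_mixture (Th : probability (levy_laws R) R) d (T : measurableType d)
    (P : probability T R) (S : {nonneg R} -> {RV P >-> R}) (k n : nat) :
  Th (LISPP A) = 1%E -> levy_mixture Th P S ->
  \int[P]_w laplace_kernel k%:R (S (nngr n%:R) w) =
  \int[Th]_gamma laplace (marginal (nngr 1) gamma) k%:R ^+ n.
Proof.
move=> ThL SP.
have bl := bmf_laplace_kernel (ler0n R k).
have mm := @measurable_marginal R (nngr n%:R).
have mS : measurable_fun setT (S (nngr n%:R)) by [].
rewrite -(Rexp_law P mS bl).
transitivity (\int[mixture_prob Th mm]_x laplace_kernel k%:R x).
  apply: Rexp_eq => B mB.
  transitivity (P (trajectory S @^-1` [set x | B (x (nngr n%:R))])) => //.
  rewrite SP//; exact: (preimage_measurable (@measurable_coord _ R _)).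
rewrite (Rexp_mixture Th mm bl).
apply: (eq_Rexp_on mLA (prob1_setC mLA ThL)).
- exact: (measurable_kernel_Rexp mm bl).
- apply: bmfX; apply: bmf01 => // .
  exact: (measurableT_comp (mlaplace k) (@measurable_marginal R (nngr 1))).
move=> gamma /psiP[Apsi H].
have E t : laplace (marginal t gamma) k%:R = laplace (marginal t (cp_levy (psi gamma))) k%:R.
  apply: Rexp_eq => B mB; have := H (Defs.coord t @^-1` B); apply.
  exact: (preimage_measurable (@measurable_coord _ R _)).
by rewrite -/(laplace _ _) !E !laplace_cp_levy// !nngrE// mul1r expRM_natl.
Qed.

Lemma good_continuous_identifiable : good_continuous (LISPP A) <-> laplace_identifiable A.
Proof.
split; last first.
  move=> G; split => // Th1 Th2 d1 d2 O1 P1 O2 P2 S T Th1L Th2L SP TP ST B mB.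
  have H : law Th1 mpsi ≡μ law Th2 mpsi.
    apply: G => [||k n].
    - by apply: law_full mLA mA Th1L _ => gamma /psiP[].
    - by apply: law_full mLA mA Th2L _ => gamma /psiP[].
    have bX : bmf (fun nu : pprobability R R => laplace nu k%:R ^+ n).
      by apply: bmfX; exact: bmf01.
    rewrite !(Rexp_law _ _ bX).
    have mZ := measurableT_comp (mlaplace k) (@measurable_marginal R (nngr 1)).
    have E (Th : probability (levy_laws R) R) : Th (LISPP A) = 1%E -> \int[Th]_gamma laplace (psi gamma) k%:R ^+ n =
        \int[Th]_gamma clamp (1 + ln (laplace (marginal (nngr 1) gamma) k%:R)) ^+ n.
      move=> ThA; apply: (eq_Rexp_on mLA (prob1_setC mLA ThA)).
      - exact: (bmf_comp bX mpsi).
      - exact: (bmf_comp (bmf_clamp_ln R n) mZ).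
      move=> gamma; rewrite (LISPP_cp_laws mA A0) => -[_ _ ->].
      by rewrite expRK addrC subrK clamp_id.
    rewrite !E//.
    have Z01 gamma := laplace_nat01 k (marginal (nngr 1) gamma).
    apply: (moments_unique_Rexp mZ mZ Z01 Z01 _ (bmf_clamp_ln R n)) => m.
    rewrite -(laplace_levy_mixture k m Th1L SP) -(laplace_levy_mixture k m Th2L TP).
    have bl := bmf_laplace_kernel (ler0n R k).
    have mS : measurable_fun setT (S (nngr m%:R)) by [].
    have mT : measurable_fun setT (T (nngr m%:R)) by [].
    rewrite -(Rexp_law P1 mS bl) -(Rexp_law P2 mT bl); apply: Rexp_eq.
    exact: ST.
  rewrite SP// TP// !integral_psi//.
  by apply: eq_measure_integral => C mC _; exact: H.
(* Goodness is applied to the coordinate processes under mixtures of compound Poisson laws, with the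
   images of [Th1] and [Th2] on [levy_laws] as mixing measures. *)
move=> [_ G] Th1 Th2 Th1A Th2A H.
have mcp := @measurable_cp_law R.
pose P Th : probability (path_space R) R := mixture_prob Th mcp.
pose S Th (t : {nonneg R}) : {RV (P Th) >-> R} := Defs.coord t.
have AL mu : A mu -> LISPP A (cp_levy mu) by move=> Amu; apply/(LISPPP _ A0); exists mu.
have ThL Th : Th A = 1%E -> law Th (@measurable_cp_levy R) (LISPP A) = 1%E.
  by move=> ThA; exact: law_full mA mLA ThA AL.
have SP Th : Th A = 1%E -> levy_mixture (law Th (@measurable_cp_levy R)) (P Th) (S Th).
  move=> ThA B mB; transitivity (\int[Th]_mu cp_law mu B)%E => //.
  rewrite integral_psi//; last exact: ThL.
  have mcB := measurable_kernel_ev mcp mB.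
  have cB0 (mu : pprobability R R) : (0 <= cp_law mu B)%E by exact: measure_ge0.
  have -> := integral_law (law Th (@measurable_cp_levy R)) mpsi mcB cB0.
  have -> := integral_law Th (@measurable_cp_levy R) (measurableT_comp mcB mpsi)
    (fun gamma => cB0 (psi gamma)).
  apply: (ge0_eq_integral_on mA (prob1_setC mA ThA)) => [mu|mu|mu Amu].
  - exact: cB0.
  - exact: cB0.
  apply/esym; have := measurable_saturated_fun mcp (recover_cp_one (A0 Amu)) mB.
  exact.
have mSt t := @measurable_coord {nonneg R} R t.
(* The transform of the time-t marginal is the integral of exp(t (L_mu(k) - 1)), a bounded function
   of L_mu(k). *)
have St (t : {nonneg R}) : law (P Th1) (mSt t) ≡μ law (P Th2) (mSt t).
  have nonneg Th : nonneg_supported (law (P Th) (mSt t)).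
    transitivity (\int[Th]_mu marginal t (cp_levy mu) (~` `[0%R, +oo[%classic))%E => //.
    apply: integral0_eq => mu _; exact: nonneg_supported_cp_levy.
  apply: laplace_unique => // k.
  have bl := bmf_laplace_kernel (ler0n R k).
  have E Th : laplace (law (P Th) (mSt t)) k%:R =
      \int[Th]_mu expR (t%:num * (clamp (laplace mu k%:R) - 1)).
    rewrite /laplace (Rexp_law _ (mSt t) bl) (Rexp_mixture _ mcp (bmf_comp bl (mSt t))).
    apply: eq_Rexp => mu; rewrite (clamp_id (laplace_nat01 k mu)).
    transitivity (laplace (marginal t (cp_levy mu)) k%:R); last exact: laplace_cp_levy.
    by rewrite /laplace (Rexp_marginal _ _ bl).
  rewrite !E; exact: (laplace_moments_transfer (bmf_expR_clamp _) (H k)).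
have PP : P Th1 ≡μ P Th2.
  move=> B mB; have := G _ _ _ _ _ _ _ _ (S Th1) (S Th2) (ThL _ Th1A) (ThL _ Th2A)
    (SP _ Th1A) (SP _ Th2A) (fun t B mB => St t B mB) B mB.
  exact.
apply: cp_one_law_inj => //; apply: mixing_measure_unique => n U mU.
pose E : set (gprod nat R) := [set y | forall j, (j < n)%N -> U j (y j)].
have mE : measurable E by apply: rects_measurable; apply: irects_rects; exists n, U.
have mI := measurable_increments (fun i => i%:R * 1 : R).
have mIE : measurable (increments (fun i => i%:R * 1 : R) @^-1` E).
  exact: (preimage_measurable mI mE).
have bprod : bmf (fun nu : pprobability R R => \prod_(j < n) fine ((nu : probability R R) (U j))).
  apply: (@bmf_prod _ _ R n (fun j (nu : pprobability R R) => fine ((nu : probability R R) (U j)))) => j.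
  apply: bmf01 => [|nu]; first exact: measurable_fine_ev.
  by rewrite fine_ge0//= -lee_fin fineK ?fin_num_measure// probability_le1.
(* The mixed product moment is the probability that the j-th unit increment lies in [U j] for all j
   < n, an event of the path space. *)
suff EP Th : \int[law Th (@measurable_cp_one R)]_nu
    \prod_(j < n) fine ((nu : probability R R) (U j)) =
    fine (P Th (increments (fun i => i%:R * 1 : R) @^-1` E)).
  by rewrite !EP PP.
rewrite (Rexp_law _ _ bprod) -Rexp_indic// (Rexp_mixture _ mcp (bmf_indic _ mIE)).
apply: eq_Rexp => mu; rewrite Rexp_indic//.
transitivity (fine (power_prob (cp_one mu) E)).
  rewrite power_prob_rect//.
  under [in RHS]eq_bigr do rewrite -(@fineK _ (cp_one mu _)) ?fin_num_measure//.
  by rewrite prodEFin.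
by congr fine; have := grid_increments (cp_levy mu) (@ler01 R) mE; move=> <-.
Qed.

End goodness.

Theorem theorem3p2p4 (R : realType) (A : set (pprobability R R))
    (mA : measurable A)
    (A_pos : forall mu : probability R R, A mu -> nonneg_supported mu)
    (A_compact : forall mu : probability R R, A mu -> compactly_supported mu) :
  (good_discrete A <-> good_continuous (LISPP A)) /\
  (good_continuous (LISPP A) <-> good_discrete (time_one_laws (LISPP A))).
Proof.
have G := good_discreteP mA A_pos.
have GC : good_discrete (time_one_laws (LISPP A)) <-> laplace_identifiable (cp_laws A).
  rewrite (time_one_laws_LISPP mA A_pos).
  by apply: good_discreteP; [exact: measurable_cp_laws|move=> nu []].
have GA := identifiable_cp_laws mA A_pos.
have GL := good_continuous_identifiable mA A_pos.
by split; [rewrite G GL|rewrite GL GC].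
Qed.
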